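(* 1) If the density $f_E(t,y)$ of the inverse subordinator exists, then $$V_{2n,H}^\Psi(t)=\int_0^{+\infty}V_{2n,H}(y)f_E(t,y)\,dy\le V_{2n,H}(\infty),$$ which means that the absolute moments of $U_H^\Psi$ are bounded, too. If the density $f_E(t,y)$ of the inverse subordinator is a continuous function in $t$, then $V_{2n,H}^\Psi(t)$ is continuous in $t$ as well. 2) The moments $V_{2n,H}^\Psi(t)$ are increasing in $t$. 3) For any $n\in\mathbb{N}$ we have that $$\lim_{t\to+\infty}V_{2n,H}^\Psi(t)=H^n(2H-1)^n\,\Gamma(2nH+1)\,\theta^{2nH}\int_{[0,+\infty)^{2n}}\frac{\prod_{i=1}^n|x_i-y_i|^{2H-2}}{\left(1+\sum_{i=1}^n x_i+\sum_{i=1}^n y_i\right)^{2nH+1}}\prod_{i=1}^n dx_i\,dy_i=V_{2n,H}(\infty),$$ and the multiple integral, contained in $V_{2n,H}(\infty)$, is well defined.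
   Context: Fix $H\in(\frac12,1)$ and $\theta>0$. On a complete probability space let $B^H=\{B^H(t),t\ge0\}$ be a fractional Brownian motion with Hurst index $H$, i.e. a Gaussian process with zero mean and $\mathbb{E}[B^H(t)B^H(s)]=\frac12(t^{2H}+s^{2H}-|t-s|^{2H})$. The fractional Ornstein-Uhlenbeck (fOU) process is $U_H(t)=e^{-t/\theta}\int_0^t e^{s/\theta}\,dB^H(s)$, $t\ge0$; it is a centered Gaussian process with variance $$V_{2,H}(t)=H(2H-1)\theta^{2H}\int_0^{t/\theta}\int_0^{t/\theta}e^{-s-u}|u-s|^{2H-2}\,du\,ds.$$ Let $\sigma=\{\sigma(y),y\ge0\}$ be a driftless subordinator with Lévy measure $\nu$ such that $\nu(-\infty,0)=0$, $\int_0^{+\infty}(1\wedge x)\nu(dx)<+\infty$ and $\nu(0,+\infty)=+\infty$, so that $\mathbb{E}[e^{-\lambda\sigma(y)}]=e^{-y\Psi(\lambda)}$ with $\Psi(\lambda)=\int_0^{+\infty}(1-e^{-\lambda x})\nu(dx)$. The inverse subordinator is $E(t)=\inf\{y>0:\sigma(y)>t\}$, assumed independent of $U_H$; $f_E(t,\cdot)$ denotes the probability density function of $E(t)$, $t>0$. The time-changed fOU process is $U_H^\Psi(t)=U_H(E(t))$, $t\ge0$. Notation: for $n\in\mathbb{N}$, $V_{n,H}(t)=\mathbb{E}[|U_H(t)|^n]$ and $V_{n,H}^\Psi(t)=\mathbb{E}[|U_H^\Psi(t)|^n]$; $V_{2,H}(\infty)=\lim_{t\to+\infty}V_{2,H}(t)=\theta^{2H}H\,\Gamma(2H)$,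 and $V_{2n,H}(\infty):=\frac{2^n\Gamma\left(\frac{2n+1}{2}\right)}{\sqrt\pi}\,(V_{2,H}(\infty))^n$.
   Formalization: In item 3 the middle expression is multiplied by 2^n Γ((2n+1)/2)/√π, without which it equals V_{2,H}(∞)^n and the equalities fail for n ≥ 2; B^H is taken with continuous paths. *)

(* Defs.v *)
From HB Require Import structures.
From mathcomp Require Import all_boot all_order all_algebra.
From mathcomp Require Import all_classical all_reals all_analysis.

Set Implicit Arguments.
Unset Strict Implicit.
Unset Printing Implicit Defensive.

Import Order.TTheory GRing.Theory Num.Theory.
Import numFieldNormedType.Exports.

Local Open Scope classical_set_scope.
Local Open Scope ring_scope.

Section lebesgue_tuple.
Context (R : realType).

Definition cons_pair (k : nat)
    (p : measurableTypeR R * k.-tuple (measurableTypeR R)) :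
  k.+1.-tuple (measurableTypeR R) := [tuple of p.1 :: p.2].

Lemma measurable_cons_pair k : measurable_fun [set: _] (@cons_pair k).
Proof. exact: measurable_cons. Qed.

Definition behead_pair (k : nat) (v : k.+1.-tuple (measurableTypeR R)) :
    measurableTypeR R * k.-tuple (measurableTypeR R) :=
  (tnth v ord0, [tuple of behead v]).

Lemma cons_pairK k : cancel (@cons_pair k) (@behead_pair k).
Proof. by case=> x v; rewrite /behead_pair tnth0; congr pair; exact/val_inj. Qed.

Lemma behead_pairK k : cancel (@behead_pair k) (@cons_pair k).
Proof. by move=> v; rewrite [RHS]tuple_eta /cons_pair/=; apply/val_inj. Qed.

Lemma measurable_behead_pair k : measurable_fun [set: _] (@behead_pair k).
Proof.
apply: measurable_fun_pair; first exact: measurable_tnth.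
exact: measurable_behead.
Qed.

Section step.
Context (k : nat)
  (m : {sigma_finite_measure set (k.-tuple (measurableTypeR R)) -> \bar R}).

Definition lebesgue_cons : set (k.+1.-tuple (measurableTypeR R)) -> \bar R :=
  pushforward (@lebesgue_measure R \x m)%E (@cons_pair k).

Let lebesgue_cons0 : lebesgue_cons set0 = 0%E.
Proof. by rewrite /lebesgue_cons /pushforward preimage_set0 measure0. Qed.

Let lebesgue_cons_ge0 A : (0 <= lebesgue_cons A)%E.
Proof. by rewrite /lebesgue_cons /pushforward; exact: measure_ge0. Qed.

Let lebesgue_cons_sigma_additive : semi_sigma_additive lebesgue_cons.
Proof.
move=> F mF tF mUF; rewrite /lebesgue_cons /pushforward preimage_bigcup.
apply: measure_semi_sigma_additive.
- by move=> n; rewrite -[X in measurable X]setTI; exact: measurable_cons_pair.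
- apply/trivIsetP => /= i j _ _ ij; rewrite -preimage_setI.
  by move/trivIsetP : tF => /(_ _ _ _ _ ij) ->//; rewrite preimage_set0.
- rewrite -preimage_bigcup -[X in measurable X]setTI.
  exact: measurable_cons_pair.
Qed.

HB.instance Definition _ := isMeasure.Build _ _ _ lebesgue_cons
  lebesgue_cons0 lebesgue_cons_ge0 lebesgue_cons_sigma_additive.

Let lebesgue_cons_sigma_finite : sigma_finite setT lebesgue_cons.
Proof.
have /sigma_finiteP[F [TF ndF Foo]] := sigma_finiteT (@lebesgue_measure R).
have /sigma_finiteP[G [TG ndG Goo]] := sigma_finiteT m.
exists (fun n => @behead_pair k @^-1` (F n `*` G n)).
  rewrite -preimage_bigcup -(preimage_setT (@behead_pair k)); congr preimage.
  rewrite -setXTT TF TG predeqE => -[x y]; split.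
    move=> [/= [n _ Fnx] [j _ Gjy]]; exists (maxn n j) => //; split.
    - by move: x Fnx; exact/subsetPset/ndF/leq_maxl.
    - by move: y Gjy; exact/subsetPset/ndG/leq_maxr.
  by move=> [n _ []/= ? ?]; split; exists n.
move=> n; have [mFn Fny] := Foo n; have [mGn Gny] := Goo n; split.
  rewrite -[X in measurable X]setTI; apply: measurable_behead_pair => //.
  exact: measurableX.
rewrite /lebesgue_cons /pushforward -comp_preimage.
rewrite (_ : _ \o _ = id); last by apply/funext => p /=; rewrite cons_pairK.
rewrite preimage_id product_measure1E//.
by rewrite lte_mul_pinfty// ge0_fin_numE.
Qed.

HB.instance Definition _ := Measure_isSigmaFinite.Build _ _ _ lebesgue_cons
  lebesgue_cons_sigma_finite.
End step.

(* Lebesgue measure on R^k *)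
Fixpoint lebesgue_tuple (k : nat) :
    {sigma_finite_measure set (k.-tuple (measurableTypeR R)) -> \bar R} :=
  if k is k'.+1 then lebesgue_cons (lebesgue_tuple k')
  else \d_([tuple] : 0.-tuple (measurableTypeR R)).

End lebesgue_tuple.

Section riemann_stieltjes.
Context (R : realType).
Implicit Types (a b : R) (s : seq R).

(* [a :: s] lists the points of the partition, [tag i] is the evaluation point
   in its [i]-th interval. *)
Definition RS_sum (f g : R -> R) a b s (tag : nat -> R) : R :=
  \sum_(0 <= i < size s)
    f (tag i) * (g (nth b (a :: s) i.+1) - g (nth b (a :: s) i)).

Definition is_RS_integral (f g : R -> R) a b (I : R) : Prop :=
  forall e : R, 0 < e -> exists2 delta : R, 0 < delta &
    forall s (tag : nat -> R), itv_partition a b s ->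
    (forall i, (i < size s)%N ->
      nth b (a :: s) i.+1 - nth b (a :: s) i < delta /\
      nth b (a :: s) i <= tag i <= nth b (a :: s) i.+1) ->
    `|RS_sum f g a b s tag - I| < e.

(* junk value 0 if the integral does not exist *)
Definition RS_integral (f g : R -> R) a b : R :=
  xget 0 [set I | is_RS_integral f g a b I].

End riemann_stieltjes.

Section processes.
Context (R : realType) (d : measure_display) (T : measurableType d).
Variable P : probability T R.
(* A process is a family indexed by R; only the indices t >= 0 matter. *)
Implicit Types (X Y B sigma : R -> T -> R).

(* [normal_prob m 0] is not the degenerate law, hence the case split. *)
Definition gaussian_rv (X : T -> R) : Prop :=
  measurable_fun [set: T] X /\
  exists m s : R, forall A : set R, measurable A ->
    P (X @^-1` A) = if s == 0 then \d_m A else normal_prob m s A.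

Definition gaussian_process X : Prop :=
  forall (n : nat) (a t : 'I_n -> R), (forall i, 0 <= t i) ->
    gaussian_rv (fun w => \sum_(i < n) a i * X (t i) w).

Record fBm (H : R) B : Prop := {
  fBm_gaussian : gaussian_process B ;
  fBm_mean : forall t : R, 0 <= t -> ('E_P[B t] = 0)%E ;
  fBm_cov : forall t s : R, 0 <= t -> 0 <= s ->
    ('E_P[fun w => (B t w * B s w)%R] =
     (2^-1 * (t `^ (2 * H) + s `^ (2 * H) - `|t - s| `^ (2 * H)))%R%:E)%E ;
  (* the continuous version, which the pathwise integral below requires *)
  fBm_continuous :
    {ae P, forall w, {within `[0, +oo[, continuous (fun t => B t w)}} }.

(* The stochastic integral is the pathwise Riemann-Stieltjes integral. *)
Definition fOU (theta : R) B : R -> T -> R := fun t w =>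
  expR (- (t / theta)) *
  RS_integral (fun s => expR (s / theta)) (fun s => B s w) 0 t.

Record levy_measure (nu : {measure set (measurableTypeR R) -> \bar R}) : Prop := {
  levy_negative : nu `]-oo, (0 : R)[%classic = 0%E ;
  levy_integrable :
    (\int[nu]_(x in `]0%R, +oo[) (Num.min 1 x)%:E < +oo)%E ;
  levy_infinite : nu `](0 : R), +oo[%classic = +oo%E }.

Definition laplace_exponent (nu : {measure set (measurableTypeR R) -> \bar R})
    (lambda : R) : R :=
  \int[nu]_(x in `]0%R, +oo[) (1 - expR (- (lambda * x))).

Definition mutually_independent n (X : 'I_n -> T -> R) : Prop :=
  forall A : 'I_n -> set R, (forall i, measurable (A i)) ->
    P (\bigcap_(i in [set: 'I_n]) (X i @^-1` A i)) =
    (\prod_(i < n) P (X i @^-1` A i))%E.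

Record subordinator (nu : {measure set (measurableTypeR R) -> \bar R})
    sigma : Prop := {
  sub_measurable : forall y : R, 0 <= y -> measurable_fun [set: T] (sigma y) ;
  sub_paths : {ae P, forall w,
    [/\ sigma 0 w = 0,
        {in `[0, +oo[ &, {homo (fun y => sigma y w) : x y / x <= y}} &
        forall y : R, 0 <= y -> sigma z w @[z --> y^'+] --> sigma y w]} ;
  sub_independent : forall n (y : nat -> R), 0 <= y 0%N ->
    (forall i, y i <= y i.+1) ->
    mutually_independent (fun (i : 'I_n) w => sigma (y i.+1) w - sigma (y i) w) ;
  sub_stationary : forall (y h : R) (A : set R), 0 <= y -> 0 <= h -> measurable A ->
    P ((fun w => sigma (y + h) w - sigma y w) @^-1` A) = P (sigma h @^-1` A) ;
  (* no drift, and Levy measure nu *)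
  sub_laplace : forall y lambda : R, 0 <= y -> 0 <= lambda ->
    ('E_P[fun w => expR (- (lambda * sigma y w))%R] =
     (expR (- (y * laplace_exponent nu lambda)))%R%:E)%E }.

(* The set is nonempty for almost every w since nu is infinite. *)
Definition inverse_subordinator sigma : R -> T -> R := fun t w =>
  inf [set y : R | 0 < y /\ t < sigma y w].

Definition time_change X Y : R -> T -> R := fun t w => X (Y t w) w.

Definition process_sigma_algebra X : set (set T) :=
  <<s [set A | exists (t : R) (C : set R),
         [/\ 0 <= t, measurable C & A = X t @^-1` C]] >>.

Definition independent_processes X Y : Prop :=
  forall A C, process_sigma_algebra X A -> process_sigma_algebra Y C ->
    P (A `&` C) = (P A * P C)%E.

(* [f] is the density on ]0, +oo[ of an almost surely positive variable [X]. *)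
Definition is_density (X : T -> R) (f : R -> R) : Prop :=
  [/\ measurable_fun (`]0, +oo[%classic : set R) f,
      forall y : R, 0 < y -> 0 <= f y &
      forall A : set R, measurable A ->
        P (X @^-1` A) =
        (\int[lebesgue_measure]_(y in A `&` `]0%R, +oo[) (f y)%:E)%E].

Definition abs_moment X (n : nat) (t : R) : \bar R :=
  ('E_P[fun w => (`|X t w| ^+ n)%R])%E.

End processes.

Section constants.
Context (R : realType).
Implicit Types (H theta : R) (n : nat).

Definition Gamma (x : R) : R :=
  \int[lebesgue_measure]_(t in `]0%R, +oo[) (t `^ (x - 1) * expR (- t)).

Definition V2_infty H theta : R := theta `^ (2 * H) * H * Gamma (2 * H).

(* E|N|^(2n) for N standard normal *)
Definition gauss_moment n : R :=
  2 ^+ n * Gamma ((2 * n + 1)%N%:R / 2) / Num.sqrt pi.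

(* the limit moment of order 2n *)
Definition V_infty H theta n : R := gauss_moment n * V2_infty H theta ^+ n.

Definition orthant k : set (k.-tuple (measurableTypeR R)) :=
  [set z | forall i, (0 : R) <= tnth z i].

(* The coordinates of z are x_1, .., x_n, y_1, .., y_n. *)
Definition multi_kernel H n (z : (n + n).-tuple (measurableTypeR R)) : R :=
  let x i : R := tnth z (lshift n i) in
  let y i : R := tnth z (rshift n i) in
  (\prod_(i < n) `|x i - y i| `^ (2 * H - 2)) /
  (1 + \sum_(i < n) x i + \sum_(i < n) y i) `^ (2 * n%:R * H + 1).

Definition multi_integral H n : \bar R :=
  (\int[lebesgue_tuple R (n + n)%N]_(z in @orthant (n + n)%N)
     (multi_kernel H z)%:E)%E.

(* The factor [gauss_moment n] is needed because this expression without it is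
   [V2_infty H theta ^+ n], which differs from [V_infty H theta n] if n >= 2. *)
Definition limit_formula H theta n : \bar R :=
  ((gauss_moment n *
    (H ^+ n * (2 * H - 1) ^+ n * Gamma (2 * n%:R * H + 1) *
     theta `^ (2 * n%:R * H)))%R%:E * multi_integral H n)%E.

End constants.

(* Main.v *)
(* The moments of order 2n of [U] are [gauss_moment n * V2(y)^n], where the variance
   V2(y) = q(q+1)/2 * \iint_(]0,y]^2) |x - x'|^(q-1) exp(-(x + x')/theta), q = 2H - 1,
   is obtained from the uniform Riemann-Stieltjes sums of the stochastic integral; it is
   increasing and converges to V2(oo).  Conditioning on the independent time gives
   E|U(E(t))|^(2n) = E[V_(2n)(E(t))]: this is immediate when E(t) is rounded up to a grid, and
   the continuity of the paths of [U] together with the bound on the moments of order 4n lets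
   the grid step tend to 0.  The integral against the density and its continuity, the
   monotonicity in t (E is nondecreasing) and the limit (E(t) -> oo) follow.  The monotonicity is
   strict since [sigma] takes a value in ]s, t[ with positive probability. *)

Require Import Defs.
From HB Require Import structures.
From mathcomp Require Import all_boot all_order all_algebra.
From mathcomp Require Import all_classical all_reals all_analysis.
From mathcomp Require Import measurable_realfun ring lra.

Set Implicit Arguments.
Unset Strict Implicit.
Unset Printing Implicit Defensive.

Import Order.TTheory GRing.Theory Num.Theory.
Import numFieldNormedType.Exports.

Local Open Scope classical_set_scope.
Local Open Scope ring_scope.

(** * Lebesgue integrals *)

(** The paths of [B] have unbounded variation, but the integrand of the stochastic integral is
    smooth: integration by parts compares every tagged sum with an explicit function that is
    continuous in [t]. This yields existence of the integral, convergence of the left-point sums and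
    continuity in [t] at once, off a single null set that does not depend on [t], and this last
    point is what allows a random time. These limits are only almost sure and have no dominating
    variable; a bound on second moments replaces domination, and for a moment of order [2n] this is
    a bound of order [4n]. The integral identities hold between nonnegative extended integrals, by
    Tonelli, so that finiteness is a conclusion: for [Gamma], for the variance and for the multiple
    integral alike. Pointwise continuity of the density provides no domination either; the minimum
    of two densities does, and using it with the moment function and with its distance to the bound
    gives estimates from both sides. *)

Section affine.
Context {R : realType}.
Local Notation mu := (@lebesgue_measure R).
Local Open Scope ereal_scope.

Lemma measurable_affine (a b : R) :
  measurable_fun [set: measurableTypeR R]
    (fun x : R => (a * x + b)%R : measurableTypeR R).
Proof. by apply: measurable_realfun.measurable_funD => //; apply: measurable_funM. Qed.

(** By uniqueness of Lebesgue measure: the image of [mu] under the affine map, scaled by [|a|], has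
    the right value on half-open intervals. *)
Lemma lebesgue_measure_affine (a b : R) (A : set R) : a != 0%R -> measurable A ->
  mu ((fun x : R => (a * x + b)%R) @^-1` A) = `|a|^-1%:E * mu A.
Proof.
move=> a0 mA.
have na0 : (0 < `|a|)%R by rewrite normr_gt0.
have na0' : (`|a| != 0)%R by rewrite gt_eqF.
suff -> : mu A = `|a|%:E * mu ((fun x : R => (a * x + b)%R) @^-1` A).
  by rewrite muleA -EFinM mulVf// mul1e.
pose f := (fun x : R => (a * x + b)%R : measurableTypeR R).
have mf : measurable_fun [set: measurableTypeR R] f := measurable_affine a b.
unshelve eapply (@lebesgue_measure_unique R
  (mscale (NngNum (ltW na0)) (pushforward mu f)) _ A mA); first exact: mf.
move=> _ [[x y]] _ <-.
change (mu `]x, y]%classic =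
  `|a|%:E * mu ((fun z => (a * z + b)%R) @^-1` `]x, y]%classic)).
rewrite lebesgue_measure_itv/= lte_fin.
have [a1|a1] : (0 < a \/ a < 0)%R by apply/orP; rewrite -real_neqr_lt ?num_real// eq_sym.
- rewrite [X in _ = _ * mu X](_ : _ =
      `]((x - b) / a)%R, ((y - b) / a)%R]%classic); last first.
    apply/seteqP; split => z /=; rewrite !in_itv/= ltr_pdivrMr// ler_pdivlMr//;
    by rewrite ltrBlDr lerBrDr mulrC.
  rewrite lebesgue_measure_itv/= lte_fin ltr_pM2r ?invr_gt0// ltrD2r.
  case: ifPn => _; last by rewrite mule0.
  by rewrite -!EFinB -EFinM gtr0_norm//; congr EFin; field; rewrite gt_eqF.
(* A negative slope swaps the ends, so the preimage is closed on the left and open on the right. *)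
- rewrite [X in _ = _ * mu X](_ : _ =
      `[((y - b) / a)%R, ((x - b) / a)%R[%classic); last first.
    apply/seteqP; split => z /=; rewrite !in_itv/= ltr_ndivlMr// ler_ndivrMr//;
    by rewrite ltrBlDr lerBrDr mulrC andbC.
  rewrite lebesgue_measure_itv/= lte_fin ltr_nM2r ?invr_lt0// ltrD2r.
  case: ifPn => _; last by rewrite mule0.
  by rewrite -!EFinB -EFinM ltr0_norm//; congr EFin; field; rewrite lt_eqF.
Qed.

End affine.

(* [measurableTypeR R] and [R] carry the same sigma-algebra but under different
   displays, which blocks [measurableT_comp]. *)
Lemma measurable_compR {R : realType} d d' (T : measurableType d)
    (T' : measurableType d') (f : R -> T') (g : T -> measurableTypeR R) :
  measurable_fun [set: R] f -> measurable_fun [set: T] g ->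
  measurable_fun [set: T] (fun x => f (g x)).
Proof.
move=> mf mg _ B mB; have mfB := mf measurableT B mB; rewrite setTI in mfB.
exact: (mg measurableT (f @^-1` B) mfB).
Qed.

Section transfer.
Local Open Scope ereal_scope.
Context d1 d2 (T1 : measurableType d1) (T2 : measurableType d2) (R : realType).
Variables (m1 : {measure set T1 -> \bar R}) (m2 : {measure set T2 -> \bar R}).
Variables (D : set T1) (phi : T1 -> T2) (h : T1 -> R).
Hypothesis mD : measurable D.
Hypothesis mphi : measurable_fun D phi.
Hypothesis mh : measurable_fun D h.
Hypothesis h0 : forall x, D x -> (0 <= h x)%R.
Hypothesis m12 : forall A, measurable A ->
  m2 A = \int[m1]_(x in D `&` phi @^-1` A) (h x)%:E.

Import HBNNSimple.

Let mA (A : set T2) : measurable A -> measurable (D `&` phi @^-1` A).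
Proof. by move=> ?; exact: mphi. Qed.

(** One change of variables for three uses: affine maps ([h] constant), laws with a density ([phi]
    the identity) and independence ([m2] a scaled law, [h] equal to 1). The usual passage from
    indicators through simple functions to monotone limits. *)
Lemma ge0_integral_transfer (f : T2 -> \bar R) :
  measurable_fun [set: T2] f -> (forall y, 0 <= f y) ->
  \int[m2]_y f y = \int[m1]_(x in D) ((h x)%:E * f (phi x)).
Proof.
move=> mf f0.
pose f_ := nnsfun_approx measurableT mf.
have mfphi g : measurable_fun [set: T2] g -> measurable_fun D (fun x => (h x)%:E * g (phi x)).
  move=> mg; apply: emeasurable_funM; first exact/measurable_EFinP.
  exact: measurableT_comp.
transitivity (limn (fun n => \int[m2]_x (f_ n x)%:E)).
  rewrite -monotone_convergence//.
  - by apply: eq_integral => y _; apply/esym/cvg_lim => //; exact: cvg_nnsfun_approx.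
  - by move=> n; exact/measurable_EFinP/measurable_funP.
  - by move=> n y _; rewrite lee_fin.
  - by move=> y _ m n mn; rewrite lee_fin; exact/lefP/nd_nnsfun_approx.
transitivity (limn (fun n => \int[m1]_(x in D) ((h x)%:E * (f_ n (phi x))%:E))); last first.
  rewrite -monotone_convergence//; last 3 first.
  - by move=> n; apply: (mfphi (fun y => (f_ n y)%:E)); exact/measurable_EFinP/measurable_funP.
  - by move=> n x Dx; rewrite mule_ge0 ?lee_fin ?h0.
  - by move=> x Dx m n mn; rewrite lee_wpmul2l ?lee_fin ?h0//; exact/lefP/nd_nnsfun_approx.
  apply: eq_integral => x /[!inE] Dx; apply/cvg_lim => //.
  by apply: cvgeZl => //; exact: cvg_nnsfun_approx.
congr (lim (_ @ \oo)); apply/funext => n.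
under eq_integral do rewrite fimfunE -fsumEFin//.
rewrite ge0_integral_fsum//; last 2 first.
- by move=> y; exact/measurable_EFinP/measurable_funM.
- by move=> y x _; rewrite nnfun_muleindic_ge0.
transitivity (\sum_(k \in range (f_ n))
    \int[m1]_(x in D) ((h x)%:E * (k * \1_(f_ n @^-1` [set k]) (phi x))%:E)); last first.
  rewrite -ge0_integral_fsum//.
  - apply: eq_integral => x _; rewrite [in RHS]fimfunE -fsumEFin// ge0_mule_fsumr//.
    by move=> r; rewrite nnfun_muleindic_ge0.
  - move=> r; apply: (mfphi (fun y => (r * \1_(f_ n @^-1` [set r]) y)%:E)).
    exact/measurable_EFinP/measurable_funM.
  - by move=> r x Dx; rewrite mule_ge0 ?lee_fin ?h0// -lee_fin nnfun_muleindic_ge0.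
apply: eq_fsbigr => r /[!inE] -[y _ fy].
rewrite integralZl_indic_nnsfun// integral_indic// setIT m12//.
have r0 : (0 <= r)%R by rewrite -fy.
rewrite -ge0_integralZl//; last 3 first.
- exact: mA.
- by apply/measurable_EFinP; apply: measurable_funS mh => //; exact: subIsetl.
- by move=> x [Dx _]; rewrite lee_fin h0.
rewrite integral_mkcondr; apply: eq_integral => x _.
rewrite patchE indicE.
have -> : (phi x \in f_ n @^-1` [set r]) = (x \in phi @^-1` (f_ n @^-1` [set r])).
  by apply/idP/idP; rewrite !inE.
by case: ifPn => xA; rewrite ?mulr1 ?mulr0 ?mule0// muleC.
Qed.

End transfer.

Section affine_integral.
Context {R : realType}.
Local Notation mu := (@lebesgue_measure R).
Local Open Scope ereal_scope.

Lemma ge0_integral_affine (a b : R) (f : R -> \bar R) : a != 0%R ->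
  measurable_fun [set: R] f -> (forall x, 0 <= f x) ->
  \int[mu]_x f (a * x + b)%R = `|a|^-1%:E * \int[mu]_x f x.
Proof.
move=> a0 mf f0.
rewrite [in RHS](@ge0_integral_transfer _ _ _ _ _ mu mu setT
  (fun x => (a * x + b)%R) (cst `|a|%R))//.
- rewrite /= (@ge0_integralZl _ _ _ mu setT measurableT (fun x => f (a * x + b)%R))//; last first.
    by apply: measurableT_comp => //; exact: measurable_affine.
  by rewrite muleA -EFinM mulVf ?normr_eq0// mul1e.
- exact: measurable_affine.
- move=> A mA; rewrite setTI -[X in _ = integral _ _ X]/(cst `|a|%:E) integral_cst//=; last first.
    by rewrite -[X in measurable X]setTI; exact: measurable_affine.
  by rewrite lebesgue_measure_affine// muleA -EFinM divff ?normr_eq0// mul1e.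
Qed.

End affine_integral.

Section density.
Local Open Scope ereal_scope.
Context d (T : measurableType d) (R : realType) (P : probability T R).
Local Notation mu := (@lebesgue_measure R).

Lemma ge0_integral_law (X : T -> R) (D : set R) (h : R -> R) (f : R -> \bar R) :
  measurable_fun [set: T] X -> measurable D -> measurable_fun D h ->
  (forall x, D x -> (0 <= h x)%R) ->
  (forall A : set R, measurable A -> P (X @^-1` A) = \int[mu]_(y in D `&` A) (h y)%:E) ->
  measurable_fun [set: R] f -> (forall y, 0 <= f y) ->
  \int[P]_w f (X w) = \int[mu]_(y in D) ((h y)%:E * f y).
Proof.
move=> mX mD mh h0 PX mf f0.
pose X' : {mfun T >-> R} := HB.pack X (isMeasurableFun.Build _ _ _ _ X mX).
rewrite -(@ge0_integral_distribution _ _ _ _ _ P X')//.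
have H := @ge0_integral_transfer _ _ _ R _ mu (distribution P X') D idfun h.
by apply: H => // _ B mB; rewrite preimage_id; exact: (@measurableI _ (measurableTypeR R)).

Qed.

End density.

(** * Convergence of expectations from almost sure convergence *)

Section moment_convergence.
Local Open Scope ereal_scope.
Context d (T : measurableType d) (R : realType) (P : probability T R).

Lemma bounded_cvg (X : nat -> T -> R) (Y : T -> R) (M : R) :
  (forall k, measurable_fun [set: T] (X k)) -> measurable_fun [set: T] Y ->
  (forall k w, (`|X k w| <= M)%R) ->
  {ae P, forall w, X k w @[k --> \oo] --> Y w} ->
  \int[P]_w (X k w)%:E @[k --> \oo] --> \int[P]_w (Y w)%:E.
Proof.
move=> mX mY XM XY.
have [|||||_ _] := @dominated_convergence _ T R P setT measurableT
  (fun k w => (X k w)%:E) (fun w => (Y w)%:E) (cst M%:E).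
- by move=> k; exact/measurable_EFinP.
- exact/measurable_EFinP.
- apply: filterS XY => w XY _; apply: cvg_EFin => //; exact: nearW.
- exact: finite_measure_integrable_cst.
- by apply: aeW => w k _; rewrite lee_fin.
- exact.
Qed.

(** Bounded second moments give uniform integrability: since [x <= min x n + x^2 / n], truncation at
    [n] costs at most [C / n] uniformly in [k], and the truncated variables converge by bounded
    convergence. *)
Lemma moment_cvg (X : nat -> T -> R) (Y : T -> R) (C : R) :
  (forall k, measurable_fun [set: T] (X k)) -> measurable_fun [set: T] Y ->
  (forall k w, (0 <= X k w)%R) -> (forall w, (0 <= Y w)%R) ->
  {ae P, forall w, X k w @[k --> \oo] --> Y w} ->
  (forall k, \int[P]_w (X k w ^+ 2)%:E <= C%:E) ->
  \int[P]_w (X k w)%:E @[k --> \oo] --> \int[P]_w (Y w)%:E.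
Proof.
move=> mX mY X0 Y0 XY XC.
have C0 : (0 <= C)%R.
  rewrite -lee_fin; apply: le_trans (XC 0%N).
  by apply: integral_ge0 => w _; rewrite lee_fin sqr_ge0.
pose tr (Z : T -> R) n w := Num.min (Z w) n%:R.
have mtr Z n : measurable_fun [set: T] Z -> measurable_fun [set: T] (tr Z n).
  by move=> mZ; exact: measurable_minr.
have tr0 (Z : T -> R) n w : (0 <= Z w -> 0 <= tr Z n w)%R.
  by move=> Z0; rewrite /tr le_min Z0 ler0n.
have trn (Z : T -> R) n w : (0 <= Z w -> `|tr Z n w| <= n%:R)%R.
  by move=> Z0; rewrite ger0_norm ?tr0// /tr ge_min lexx orbT.
have trle (Z : T -> R) n w : (tr Z n w <= Z w)%R by rewrite /tr ge_min lexx.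
pose a k := \int[P]_w (X k w)%:E.
pose b k n := \int[P]_w (tr (X k) n w)%:E.
pose c n := \int[P]_w (tr Y n w)%:E.
have ab k n : b k n <= a k.
  apply: ge0_le_integral => //.
  - by move=> w _; rewrite lee_fin tr0.
  - exact/measurable_EFinP/mtr.
  - exact/measurable_EFinP.
  - by move=> w _; rewrite lee_fin.
have bfin k n : b k n \is a fin_num.
  rewrite ge0_fin_numE; last by apply: integral_ge0 => w _; rewrite lee_fin tr0.
  apply: (@le_lt_trans _ _ (\int[P]_w (cst n%:R%:E) w)).
    apply: ge0_le_integral => //.
    - by move=> w _; rewrite lee_fin tr0.
    - exact/measurable_EFinP/mtr.
    - by move=> w _; rewrite lee_fin (le_trans (ler_norm _))// trn.
  by rewrite integral_cst//= [P _]probability_setT mule1 ltry.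
have ba k n : (0 < n)%N -> a k <= b k n + (C / n%:R)%:E.
  move=> n0; have n0' : (0 < n%:R :> R)%R by rewrite ltr0n.
  apply: (@le_trans _ _ (b k n + \int[P]_w ((n%:R^-1)%:E * (X k w ^+ 2)%:E))).
    rewrite /b -ge0_integralD//.
    - apply: ge0_le_integral => //.
      + by move=> w _; rewrite lee_fin.
      + exact/measurable_EFinP.
      + apply: emeasurable_funD; first exact/measurable_EFinP/mtr.
        apply: emeasurable_funM => //; apply/measurable_EFinP.
        exact: measurable_funX.
      + move=> w _; rewrite -EFinM -EFinD lee_fin /tr.
        case: (leP (X k w) n%:R) => h.
          by rewrite lerDl mulr_ge0// ?invr_ge0 ?sqr_ge0.
        (* For [x = X k w], the difference [n + x^2 / n - x] equals [(x - n)^2 / n + x]. *)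
        rewrite -subr_ge0 (_ : _ - _ = n%:R^-1 * (X k w - n%:R) ^+ 2 + X k w)%R.
          by rewrite addr_ge0// mulr_ge0 ?sqr_ge0// invr_ge0 ltW.
        by field; rewrite gt_eqF.
    - by move=> w _; rewrite lee_fin tr0.
    - exact/measurable_EFinP/mtr.
    - by move=> w _; rewrite mule_ge0 ?lee_fin ?invr_ge0 ?sqr_ge0.
    - apply: emeasurable_funM => //; apply/measurable_EFinP.
      exact: measurable_funX.
  rewrite leeD2l// ge0_integralZl//.
  - by rewrite mulrC EFinM lee_wpmul2l// lee_fin invr_ge0.
  - by apply/measurable_EFinP; exact: measurable_funX.
  - by move=> w _; rewrite lee_fin sqr_ge0.
have afin k : a k \is a fin_num.
  rewrite ge0_fin_numE; last by apply: integral_ge0 => w _; rewrite lee_fin.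
  apply: le_lt_trans (ba k 1%N isT) _.
  by rewrite lte_add_pinfty ?ltry// ltey_eq bfin.
have bc n : b k n @[k --> \oo] --> c n.
  apply: (@bounded_cvg _ _ n%:R).
  - by move=> k; exact: mtr.
  - exact: mtr.
  - by move=> k w; exact: trn.
  - apply: filterS XY => w XY.
    apply: (cvg_comp _ (fun x : R => Num.min x n%:R) XY).
    apply: (@continuous_min _ R id (cst n%:R) (Y w)); first exact: cvg_id.
    exact: cvg_cst.
have cY : c n @[n --> \oo] --> \int[P]_w (Y w)%:E.
  rewrite (_ : (fun w => (Y w)%:E) = fun w => limn (fun n => (tr Y n w)%:E)).
    apply: cvg_monotone_convergence => //.
    - by move=> n; exact/measurable_EFinP/mtr.
    - by move=> n w _; rewrite lee_fin tr0.
    - move=> w _ m n mn; rewrite lee_fin /tr le_min ge_min lexx/=.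
      by rewrite ge_min ler_nat mn orbT.
  apply/funext => w; apply/esym/cvg_lim => //; apply: cvg_near_cst.
  near=> n; congr EFin; apply/min_idPl; apply/ltW.
  by near: n; exact: nbhs_infty_gtr.
(* Truncation at level 1 bounds every [a k] by [1 + C]. In the limit this bounds the expectation of
   [Y], so that the [e / 3] argument below can run on real numbers. *)
have cub n : c n <= (C + 1)%:E.
  rewrite -(cvg_lim _ (bc n))//; apply: lime_le; first by apply/cvg_ex; exists (c n).
  apply: nearW => k; apply: le_trans (ab k n) _.
  apply: le_trans (ba k 1%N isT) _.
  rewrite divr1 EFinD addeC leeD2l//.
  apply: (@le_trans _ _ (\int[P]_w (cst 1%:E) w)).
    apply: ge0_le_integral => //.
    - by move=> w _; rewrite lee_fin tr0.
    - exact/measurable_EFinP/mtr.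
    - by move=> w _; rewrite lee_fin (le_trans (ler_norm _))// (trn _ 1%N).
  by rewrite integral_cst//= [P _]probability_setT mule1.
set y := \int[P]_w (Y w)%:E in cY *.
have yfin : y \is a fin_num.
  rewrite ge0_fin_numE; last by apply: integral_ge0 => w _; rewrite lee_fin.
  apply: (@le_lt_trans _ _ (C + 1)%:E); last by rewrite ltry.
  rewrite -(cvg_lim _ cY)//; apply: lime_le; first by apply/cvg_ex; exists y.
  exact: nearW.
have cfin n : c n \is a fin_num.
  rewrite ge0_fin_numE; last by apply: integral_ge0 => w _; rewrite lee_fin tr0.
  by apply: le_lt_trans (cub n) _; rewrite ltry.
rewrite -(fineK yfin); apply: cvg_EFin; first exact: nearW.
apply/cvgrPdist_lt => e e0.
have e3 : (0 < e / 3)%R by rewrite divr_gt0.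
have {}cY : fine (c n) @[n --> \oo] --> fine y.
  by apply: fine_cvg; rewrite fineK.
move/cvgrPdist_lt : cY => /(_ _ e3) cY.
have : \forall n \near \oo, (C / n%:R < e / 3)%R.
  near=> n; have n0 : (0 < n%:R :> R)%R by rewrite ltr0n; near: n; exact: nbhs_infty_gt.
  rewrite ltr_pdivrMr// mulrC -ltr_pdivrMr//; near: n; exact: nbhs_infty_gtr.
move=> /(filterI cY) /(filterI (nbhs_infty_gt 0%N)) /filter_ex[n [/= n0 [yn Cn]]].
have {}bc : fine (b k n) @[k --> \oo] --> fine (c n).
  by apply: fine_cvg; rewrite fineK.
move/cvgrPdist_lt : bc => /(_ _ e3); apply: filterS => k.
move: (ab k n) (ba k n n0).
rewrite -(fineK (bfin k n)) -(fineK (afin k)) -EFinD !lee_fin /=.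
move: yn; rewrite !ltr_norml => /andP[? ?] ? ? /andP[? ?]; apply/andP; split; lra.
Unshelve. all: by end_near. Qed.

End moment_convergence.

(** * The Gamma function and Gaussian moments *)

Section gamma_function.
Context {R : realType}.
Local Notation mu := (@lebesgue_measure R).
Local Open Scope ereal_scope.

Lemma integral_mkindic (D : set R) (f : R -> R) :
  \int[mu]_(x in D) (f x)%:E = \int[mu]_x (f x * \1_D x)%:E.
Proof.
rewrite integral_mkcond; apply: eq_integral => x _.
by rewrite patchE indicE; case: ifPn => _; rewrite ?mulr1 ?mulr0.
Qed.

Lemma powRD_gt0 (x r s : R) : (0 < x)%R -> (x `^ (r + s) = x `^ r * x `^ s)%R.
Proof. by move=> x0; rewrite powRD// (gt_eqF x0)/= implybT. Qed.

Lemma powR_continuous (p z : R) : (0 < z)%R -> {for z, continuous (fun t : R => t `^ p)%R}.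
Proof.
move=> z0; apply: differentiable_continuous; apply/derivable1_diffP.
by apply: derivable_powR; rewrite in_itv/= z0.
Qed.

Lemma integral_powR_gt0 (q x y : R) : (0 < q)%R -> (0 < x)%R -> (x <= y)%R ->
  \int[mu]_(z in `]x, y]) (z `^ (q - 1))%:E = ((y `^ q - x `^ q) / q)%:E.
Proof.
move=> q0 x0; rewrite le_eqVlt => /predU1P[<-|xy].
  by rewrite set_itvoc0 integral_set0 subrr mul0r.
have d (z : R) : (0 < z)%R -> is_derive z 1%R (fun z : R => z `^ q / q)%R (z `^ (q - 1))%R.
  move=> z0; have h := is_derive1_powR q z0.
  by apply: is_derive_eq; rewrite scaler0 add0r /GRing.scale/= mulrA mulVf ?mul1r// gt_eqF.
have c' z : (0 < z)%R -> {for z, continuous (fun z : R => z `^ q / q)%R}.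
  move=> z0; apply: differentiable_continuous; apply/derivable1_diffP.
  by have [] := d z z0.
rewrite integral_itv_obnd_cbnd; last first.
  by apply/measurable_EFinP/measurable_funTS; exact: measurable_powR.
rewrite (@continuous_FTC2 _ _ (fun z => z `^ q / q)%R)//.
- by rewrite -EFinB -mulrBl.
- apply: continuous_in_subspaceT => z /[!inE]/=; rewrite in_itv/= => /andP[xz _].
  by apply: powR_continuous; exact: lt_le_trans xz.
- split.
  + move=> z; rewrite in_itv/= => /andP[xz _].
    by have [] := d z (lt_trans x0 xz).
  + by apply/cvg_at_right_filter; exact: c'.
  + by apply/cvg_at_left_filter; apply: c'; exact: lt_trans xy.
- move=> z; rewrite in_itv/= => /andP[xz _].
  by rewrite derive1E; have [_] := d z (lt_trans x0 xz).
Qed.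

(** For [q < 1] the integrand is unbounded near 0, so the fundamental theorem of calculus is used on
    [[e n, y]] only and monotone convergence lets [e n] tend to 0. *)
Lemma integral_powR (q x y : R) : (0 < q)%R -> (0 <= x)%R -> (x <= y)%R ->
  \int[mu]_(z in `]x, y]) (z `^ (q - 1))%:E = ((y `^ q - x `^ q) / q)%:E.
Proof.
move=> q0; rewrite le_eqVlt => /predU1P[<-|]; last exact: integral_powR_gt0.
rewrite le_eqVlt => /predU1P[<-|y0].
  by rewrite set_itvoc0 integral_set0 subrr mul0r.
pose e n : R := (y / n.+1%:R)%R.
have e0 n : (0 < e n)%R by rewrite divr_gt0.
have ey n : (e n <= y)%R by rewrite ler_pdivrMr// ler_peMr ?ler1n// ltW.
have e_cvg : e n @[n --> \oo] --> (0 : R)%R.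
  rewrite -(mulr0 y); apply: cvgM; first exact: cvg_cst.
  exact: cvg_harmonic.
have -> : `]0%R, y]%classic = \bigcup_n `]e n, y]%classic.
  apply/seteqP; split => [z /=|z [n _] /=]; rewrite !in_itv/= => /andP[z0 zy].
    move/cvgrPdist_lt : e_cvg => /(_ z z0) /filter_ex[n].
    rewrite sub0r normrN gtr0_norm// => enz.
    by exists n => //=; rewrite in_itv/= enz zy.
  by rewrite zy (lt_trans _ z0).
have cv := @ge0_nondecreasing_set_cvg_integral _ (measurableTypeR R) R
  (fun n => `]e n, y]%classic) (fun z : R => (z `^ (q - 1))%:E) mu.
rewrite -(cvg_lim _ (cv _ _ _ _))//; first last.
- by move=> n z _; rewrite lee_fin powR_ge0.
- by move=> n; apply/measurable_EFinP/measurable_funTS; exact: measurable_powR.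
- apply/nondecreasing_seqP => n; rewrite subsetEset; apply: subset_itvr.
  by rewrite bnd_simp ler_pM2l// lef_pV2 ?posrE// ler_nat.
apply/cvg_lim => //; under eq_fun do rewrite integral_powR_gt0//.
apply: cvg_EFin; first exact: nearW.
apply: cvgM; last exact: cvg_cst.
apply: cvgB; first exact: cvg_cst.
rewrite powR0 ?gt_eqF//.
by have /cvg_at_rightP := powR_cvg0 q0; apply; split.
Qed.

Lemma integral_expRN (l u : R) : (0 < l)%R ->
  \int[mu]_(t in `]u, +oo[) (expR (- (l * t)))%:E = (expR (- (l * u)) / l)%:E.
Proof.
move=> l0.
have d (z : R) : is_derive z 1%R (fun z : R => - (expR (- (l * z)) / l))%R (expR (- (l * z))).
  apply: is_derive_eq; rewrite scaler0 add0r /GRing.scale/= mulr1.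
  by field; rewrite gt_eqF.
have c : continuous (fun z : R => expR (- (l * z)))%R.
  move=> z; apply: (@continuous_comp _ _ _ (fun z => - (l * z))%R); last exact: continuous_expR.
  by apply: cvgN; apply: cvgM; [exact: cvg_cst|exact: cvg_id].
have c' : continuous (fun z : R => - (expR (- (l * z)) / l))%R.
  by move=> z; apply: cvgN; apply: cvgM; [exact: c|exact: cvg_cst].
rewrite integral_itv_obnd_cbnd; last first.
  by apply/measurable_EFinP/measurable_funTS; exact: continuous_measurable_fun.
rewrite (@ge0_continuous_FTC2y _ _ (fun z => - (expR (- (l * z)) / l))%R _ 0%R)//.
- by rewrite sub0e -EFinN opprK.
- by apply: continuous_subspaceT.
- rewrite -oppr0 -(mul0r (l^-1)%R); apply: cvgN; apply: cvgM; last exact: cvg_cst.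
  rewrite (_ : (fun z => _) = (fun z : R => expR (- z)%R) \o (fun z : R => (l * z)%R))//.
  apply: (@cvg_comp _ _ _ _ _ _ (pinfty_nbhs R)); last exact: cvgr_expR.
  exact: gt0_cvgMry.
- by apply/cvg_at_right_filter; exact: c'.
- by move=> z _; rewrite derive1E; have [] := d z.
Qed.

(** [Gamma] is the real part of this integral and would be 0 if it diverged. The identities are
    proved for the extended value, where Tonelli applies directly, and carried over once
    [gammaE_fin] is known. *)
Definition gammaE (x : R) : \bar R :=
  \int[mu]_(t in `]0%R, +oo[) (t `^ (x - 1) * expR (- t))%:E.

Lemma Gamma_fine (x : R) : Gamma x = fine (gammaE x).
Proof. by []. Qed.

Lemma measurable_gamma_fun (x l : R) :
  measurable_fun [set: R] (fun t : R => t `^ (x - 1) * expR (- (l * t)))%R.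
Proof.
apply: measurable_funM; first exact: measurable_powR.
by apply: measurableT_comp => //; apply: measurableT_comp => //; exact: measurable_funM.
Qed.

Lemma measurable_gamma_fun1 (x : R) :
  measurable_fun [set: R] (fun t : R => t `^ (x - 1) * expR (- t))%R.
Proof. by have := measurable_gamma_fun x 1; under eq_fun do rewrite mul1r. Qed.

Lemma gammaE_scale (a l : R) : (0 < l)%R ->
  \int[mu]_(t in `]0%R, +oo[) (t `^ (a - 1) * expR (- (l * t)))%:E =
  (l `^ (- a))%:E * gammaE a.
Proof.
move=> l0; rewrite /gammaE !(integral_mkindic `]0%R, +oo[%classic).
pose f (t : R) := (t `^ (a - 1) * expR (- t) * \1_`]0%R, +oo[ t)%R.
have f0 t : (0 <= f t)%R by rewrite !mulr_ge0 ?powR_ge0 ?expR_ge0.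
have mf : measurable_fun [set: R] f.
  apply: measurable_funM; last exact: measurable_indic.
  by have := measurable_gamma_fun a 1; under eq_fun do rewrite mul1r.
have gf (x : R) : (x `^ (a - 1) * expR (- (l * x)) * \1_`]0%R, +oo[ x)%:E =
    (l `^ (1 - a))%:E * (f (l * x + 0)%R)%:E.
  rewrite -EFinM /f addr0 !indicE !mem_setE !in_itv/= !andbT.
  rewrite pmulr_rgt0//; case: ltP => [x0|]; last by rewrite !mulr0.
  rewrite !mulr1 powRM ?ltW// !mulrA -powRD_gt0//.
  have -> : (1 - a + (a - 1) = 0)%R by ring.
  by rewrite powRr0 mul1r.
transitivity (\int[mu]_x ((l `^ (1 - a))%:E * (f (l * x + 0)%R)%:E)).
  by apply: eq_integral => x _; rewrite gf.
have mf' : measurable_fun [set: R] (EFin \o f) by exact/measurable_EFinP.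
rewrite ge0_integralZl//; last 3 first.
- by apply/measurable_EFinP; apply: measurableT_comp => //; exact: measurable_affine.
- by move=> x _; rewrite lee_fin.
- by rewrite lee_fin powR_ge0.
rewrite (@ge0_integral_affine R l 0 (EFin \o f))// ?gt_eqF//.
rewrite muleA -EFinM gtr0_norm//; congr (_%:E * _).
by rewrite -(powR_inv1 (ltW l0)) -powRD_gt0// addrC addKr.
Qed.

(** In place of an integration by parts: [t^x] is the integral of [x u^(x-1)] over []0, t]], and
    Tonelli on the region [0 < u <= t] integrates [t] out first, which leaves [exp(-u)]. *)
Lemma gammaED1 (x : R) : (0 < x)%R -> gammaE (x + 1) = x%:E * gammaE x.
Proof.
move=> x0.
pose A := [set p : measurableTypeR R * measurableTypeR R | 0 < p.2 <= p.1]%R.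
have mA : measurable A.
  have m0 : measurable_fun [set: measurableTypeR R * measurableTypeR R]
      (fun p => (0 < p.2) && (p.2 <= p.1))%R.
    apply: measurable_and; first exact: measurable_fun_ltr.
    exact: measurable_fun_ler.
  by have := m0 measurableT [set true] I; rewrite setTI.
pose F (p : measurableTypeR R * measurableTypeR R) : R :=
  (x * (p.2 `^ (x - 1)) * expR (- p.1) * \1_A p)%R.
have mF : measurable_fun [set: _] F.
  apply: measurable_funM; last exact: measurable_indic.
  apply: measurable_funM; last by apply: measurable_compR => //; exact: measurableT_comp.
  apply: measurable_funM => //; apply: (measurable_compR (f := fun z => z `^ (x - 1))%R).
    exact: measurable_powR.
  exact: measurable_snd.
have F0 p : (0 <= F p)%R by rewrite !mulr_ge0 ?powR_ge0 ?expR_ge0// ltW.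
transitivity (\int[mu]_t \int[mu]_u (F (t, u))%:E).
  rewrite /gammaE integral_mkindic; apply: eq_integral => t _.
  have -> : \int[mu]_u (F (t, u))%:E =
      \int[mu]_(u in `]0%R, t]) ((x * expR (- t))%:E * (u `^ (x - 1))%:E).
    rewrite [RHS]integral_mkcond; apply: eq_integral => u _.
    rewrite /F patchE indicE (_ : ((t, u) \in A) = (u \in `]0%R, t]%classic)).
      by case: ifPn => _; rewrite ?mulr0// mulr1 -EFinM mulrAC.
    by apply/idP/idP; rewrite !inE /A/= ?in_itv.
  rewrite ge0_integralZl//; last 3 first.
  - by apply/measurable_EFinP/measurable_funTS; exact: measurable_powR.
  - by move=> u _; rewrite lee_fin powR_ge0.
  - by rewrite lee_fin mulr_ge0 ?expR_ge0// ltW.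
  rewrite addrK indicE mem_setE in_itv/= andbT.
  case: ltP => [t0|t0]; last first.
    by rewrite set_itv_ge ?bnd_simp -?leNgt// integral_set0 mule0 mulr0.
  rewrite integral_powR// ?ltW// powR0 ?gt_eqF// subr0 mulr1 -EFinM.
  by congr EFin; field; rewrite gt_eqF.
have mEF : measurable_fun setT (EFin \o F) by exact/measurable_EFinP.
have EF0 p : 0 <= (EFin \o F) p by rewrite lee_fin.
rewrite [LHS](@fubini_tonelli _ _ _ _ R mu mu (EFin \o F) mEF EF0).
transitivity (\int[mu]_(u in `]0%R, +oo[) (x%:E * (u `^ (x - 1) * expR (- u))%:E)); last first.
  rewrite ge0_integralZl//.
  - apply/measurable_EFinP/measurable_funTS.
    by have := measurable_gamma_fun x 1; under eq_fun do rewrite mul1r.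
  - by move=> u _; rewrite lee_fin mulr_ge0 ?powR_ge0 ?expR_ge0.
  - by rewrite lee_fin ltW.
rewrite [RHS]integral_mkcond; apply: eq_integral => u _ /=.
rewrite patchE mem_setE in_itv/= andbT; case: ltP => [u0|u0]; last first.
  rewrite integral0_eq// => t _; rewrite /F indicE memNset ?mulr0//= => -[]/andP/=[].
  by rewrite ltNge u0.
transitivity (\int[mu]_(t in `[u, +oo[) ((x * u `^ (x - 1))%:E * (expR (- (1 * t)))%:E)).
  rewrite [RHS]integral_mkcond; apply: eq_integral => t _.
  rewrite /F patchE indicE (_ : ((t, u) \in A) = (t \in `[u, +oo[%classic)).
    by case: ifPn => _; rewrite ?mulr0// mulr1 -EFinM mul1r.
  by apply/idP/idP; rewrite !inE /A/= ?in_itv/= ?u0 ?andbT.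
have me : measurable_fun [set: R] (fun t : R => expR (- (1 * t)))%R.
  by apply: measurableT_comp => //; apply: measurableT_comp => //; exact: measurable_funM.
rewrite ge0_integralZl//; last 2 first.
- exact/measurable_EFinP/measurable_funTS.
- by rewrite lee_fin mulr_ge0 ?powR_ge0// ltW.
- rewrite -integral_itv_obnd_cbnd; last exact/measurable_EFinP/measurable_funTS.
  by rewrite integral_expRN// divr1 mul1r -!EFinM mulrA.
Qed.

Lemma gammaE_ge0 (x : R) : 0 <= gammaE x.
Proof.
by apply: integral_ge0 => t _; rewrite lee_fin mulr_ge0 ?powR_ge0 ?expR_ge0.
Qed.

(** Induction on an integer bound for [x]. The functional equation lowers [x > 1]; for [x <= 1] the
    integral is split at 1, with [t^(x-1)] dominating on the left and [exp(-t)] on the right. *)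
Lemma gammaE_fin (x : R) : (0 < x)%R -> gammaE x \is a fin_num.
Proof.
suff H n : (0 < x)%R -> (x <= n%:R)%R -> gammaE x \is a fin_num.
  move=> x0; apply: (H (Num.bound x)) => //.
  exact/ltW/archi_boundP/ltW.
elim: n x => [x x0 xn|n IH x x0 xn]; first by move: x0; rewrite ltNge xn.
have [x1|x1] := leP x 1%R; last first.
  have x10 : (0 < x - 1)%R by rewrite subr_gt0.
  rewrite -(subrK 1%R x) gammaED1// fin_numM//.
  by apply: IH => //; rewrite lerBlDr natr1.
rewrite ge0_fin_numE ?gammaE_ge0//.
have -> : gammaE x = \int[mu]_(t in `]0%R, 1%R] `|` `]1%R, +oo[) (t `^ (x - 1) * expR (- t))%:E.
  by congr (integral _ _ _); rewrite -itv_bndbnd_setU// bnd_simp ?ler01.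
have mg : measurable_fun [set: R] (fun t : R => t `^ (x - 1) * expR (- t))%R.
  by have := measurable_gamma_fun x 1; under eq_fun do rewrite mul1r.
rewrite ge0_integral_setU//; last 3 first.
- exact/measurable_EFinP/measurable_funTS.
- by move=> t _; rewrite lee_fin mulr_ge0 ?powR_ge0 ?expR_ge0.
- by apply/disj_setPS => t [/=]; rewrite !in_itv/= andbT => /andP[_ t1]; rewrite ltNge t1.
apply: lte_add_pinfty.
  apply: (@le_lt_trans _ _ (\int[mu]_(t in `]0%R, 1%R]) (t `^ (x - 1))%:E)); last first.
    by rewrite integral_powR// ltry.
  apply: ge0_le_integral => //.
  - by move=> t _; rewrite lee_fin mulr_ge0 ?powR_ge0 ?expR_ge0.
  - exact/measurable_EFinP/measurable_funTS.
  - by apply/measurable_EFinP/measurable_funTS; exact: measurable_powR.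
  - move=> t /=; rewrite in_itv/= => /andP[t0 _].
    by rewrite lee_fin ler_piMr ?powR_ge0// -expR0 ler_expR oppr_le0 ltW.
apply: (@le_lt_trans _ _ (\int[mu]_(t in `]1%R, +oo[) (expR (- (1 * t)))%:E)); last first.
  by rewrite integral_expRN// ltry.
apply: ge0_le_integral => //.
- by move=> t _; rewrite lee_fin mulr_ge0 ?powR_ge0 ?expR_ge0.
- exact/measurable_EFinP/measurable_funTS.
- apply/measurable_EFinP/measurable_funTS.
  by apply: measurableT_comp => //; apply: measurableT_comp => //; exact: measurable_funM.
- move=> t /=; rewrite in_itv/= andbT => t1.
  rewrite lee_fin mul1r ler_piMl ?expR_ge0//.
  have x10 : (x - 1 <= 0)%R by rewrite subr_le0.
  by have := ler_powR (ltW t1) x10; rewrite powRr0.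
Qed.

Lemma gammaEE (x : R) : (0 < x)%R -> gammaE x = (Gamma x)%:E.
Proof. by move=> x0; rewrite Gamma_fine fineK// gammaE_fin. Qed.

Lemma GammaD1 (x : R) : (0 < x)%R -> Gamma (x + 1) = (x * Gamma x)%R.
Proof.
move=> x0; apply: EFin_inj.
by rewrite EFinM -!gammaEE ?gammaED1// addr_gt0.
Qed.

Lemma Gamma_ge0 (x : R) : (0 <= Gamma x)%R.
Proof. by rewrite Gamma_fine fine_ge0// gammaE_ge0. Qed.

(** On []0, 1]] the integrand is at least [exp(-1) t^(x-1)], whose integral is explicit and
    positive. *)
Lemma Gamma_gt0 (x : R) : (0 < x)%R -> (0 < Gamma x)%R.
Proof.
move=> x0; rewrite -lte_fin -gammaEE//.
apply: (@lt_le_trans _ _ (\int[mu]_(t in `]0%R, 1%R]) ((expR (- 1))%:E * (t `^ (x - 1))%:E))).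
  rewrite ge0_integralZl//.
  - rewrite integral_powR// -EFinM lte_fin mulr_gt0 ?expR_gt0// divr_gt0//.
    by rewrite powR1 powR0 ?subr0// gt_eqF.
  - by apply/measurable_EFinP/measurable_funTS; exact: measurable_powR.
  - by move=> t _; rewrite lee_fin powR_ge0.
have mg : measurable_fun [set: R] (fun t : R => t `^ (x - 1) * expR (- t))%R.
  by have := measurable_gamma_fun x 1; under eq_fun do rewrite mul1r.
apply: (@le_trans _ _ (\int[mu]_(t in `]0%R, 1%R]) (t `^ (x - 1) * expR (- t))%:E)).
  apply: ge0_le_integral => //.
  - by move=> t _; rewrite mule_ge0 ?lee_fin ?powR_ge0 ?expR_ge0.
  - apply: emeasurable_funM => //.
    by apply/measurable_EFinP/measurable_funTS; exact: measurable_powR.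
  - exact/measurable_EFinP/measurable_funTS.
  - move=> t /=; rewrite in_itv/= => /andP[_ t1].
    by rewrite -EFinM lee_fin mulrC ler_wpM2l ?powR_ge0// ler_expR lerN2.
apply: ge0_subset_integral => //.
- exact/measurable_EFinP/measurable_funTS.
- by move=> t _; rewrite lee_fin mulr_ge0 ?powR_ge0 ?expR_ge0.
- by apply: subset_itvl.
Qed.

End gamma_function.

(** * Even moments of the normal density *)

Section gauss_moments.
Context {R : realType}.
Local Notation mu := (@lebesgue_measure R).
Local Open Scope ereal_scope.

(** Substitution [y = t^(1/2)], kept away from 0 because the derivative of the root is unbounded
    there; [integral_gauss_Gamma] then lets [e] tend to 0. *)
Lemma integral_gauss_Gamma_ge (n : nat) (e : R) : (0 < e)%R ->
  \int[mu]_(y in `[Num.sqrt e, +oo[) (y ^+ (2 * n) * expR (- y ^+ 2))%:E =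
  (2^-1)%:E * \int[mu]_(t in `[e, +oo[) (t `^ (n%:R + 2^-1 - 1) * expR (- t))%:E.
Proof.
move=> e0.
pose F (t : R) : R := (t `^ 2^-1)%R.
have dF (t : R) : (0 < t)%R -> is_derive t 1%R F (2^-1 * t `^ (2^-1 - 1))%R.
  by move=> t0; exact: is_derive1_powR.
have F'E (t : R) : (0 < t)%R -> F^`()%classic t = (2^-1 * t `^ (2^-1 - 1))%R.
  by move=> t0; rewrite derive1E; have [] := dF t t0.
have cF' (t : R) : (0 < t)%R -> {for t, continuous F^`()%classic}.
  move=> t0; rewrite /prop_for /continuous_at (F'E _ t0).
  have c1 : (2^-1 * z `^ (2^-1 - 1))%R @[z --> t] --> (2^-1 * t `^ (2^-1 - 1))%R.
    apply: cvgM; [exact: cvg_cst|exact: powR_continuous].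
  apply: cvg_trans c1.
  apply: near_eq_cvg; near=> z; rewrite F'E//; near: z; exact: lt_nbhsr.
have cF (t : R) : (0 < t)%R -> {for t, continuous F}.
  exact: powR_continuous.
have Fy : F t @[t --> +oo%R] --> +oo%R.
  apply/cvgryPge => A; near=> t.
  have t0 : (`|A| ^+ 2 <= t)%R by near: t; exact: nbhs_pinfty_ge.
  apply: (le_trans (ler_norm A)).
  have -> : `|A|%R = ((`|A| ^+ 2) `^ 2^-1)%R.
    by rewrite powR12_sqrt ?sqr_ge0// sqrtr_sqr normr_id.
  by apply: ge0_ler_powR; rewrite ?invr_ge0 ?nnegrE ?sqr_ge0// (le_trans _ t0)// sqr_ge0.
pose G (y : R) := (y ^+ (2 * n) * expR (- y ^+ 2))%R.
have cG : continuous G.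
  move=> y; apply: cvgM; first exact: exprn_continuous.
  apply: continuous_comp; last exact: continuous_expR.
  by apply: cvgN; exact: exprn_continuous.
have -> : Num.sqrt e = F e by rewrite /F powR12_sqrt// ltW.
rewrite (@increasing_ge0_integration_by_substitutiony _ F G).
- rewrite -ge0_integralZl//.
  + apply: eq_integral => t; rewrite inE/= in_itv/= andbT => et.
    have t0 : (0 < t)%R by exact: lt_le_trans et.
    rewrite fctE /= F'E// /G /F -EFinM; congr EFin.
    have E1 : ((t `^ 2^-1) ^+ 2 = t)%R by rewrite powR12_sqrt ?ltW// sqr_sqrtr ?ltW.
    rewrite exprM E1 -addrA (powRD_gt0 n%:R _ t0) powR_mulrn ?ltW//; ring.
  + apply/measurable_EFinP/measurable_funTS.
    exact: measurable_gamma_fun1.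
  + by move=> t _; rewrite lee_fin mulr_ge0 ?powR_ge0 ?expR_ge0.
- move=> x y; rewrite !in_itv/= !andbT => xe ye xy.
  by apply: gt0_ltr_powR => //; rewrite ?nnegrE; apply: ltW; apply: lt_le_trans xe || apply: lt_le_trans ye.
- by move=> x; rewrite in_itv/= andbT => ex; apply: cF'; exact: lt_trans ex.
- by apply/cvg_ex; exists (F^`()%classic e); apply/cvg_at_right_filter; exact: cF'.
- apply/cvg_ex; exists 0%R; apply/cvgrPdist_lt => d d0; near=> t.
  have t0 : (0 < t)%R by near: t; exact: nbhs_pinfty_gt.
  rewrite sub0r normrN F'E// (_ : 2^-1 - 1 = - 2^-1)%R; last by field.
  rewrite powRN ger0_norm ?mulr_ge0 ?invr_ge0 ?powR_ge0//.
  rewrite ltr_pdivrMr ?powR_gt0// -ltr_pdivrMl//.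
  near: t; apply: (cvgryPgt _).1 Fy _; exact: num_real.
- split; last by apply/cvg_at_right_filter; exact: cF.
  by move=> x; rewrite in_itv/= andbT => ex; have [] := dF x (lt_trans e0 ex).
- exact: Fy.
- exact: continuous_subspaceT.
- by move=> x _; rewrite /G mulr_ge0 ?expR_ge0// exprM exprn_ge0// sqr_ge0.
Unshelve. all: end_near. Qed.

Lemma integral_gauss_Gamma (n : nat) :
  \int[mu]_(y in `]0%R, +oo[) (y ^+ (2 * n) * expR (- y ^+ 2))%:E =
  (2^-1 * Gamma ((2 * n + 1)%N%:R / 2))%:E.
Proof.
have nE : ((2 * n + 1)%N%:R / 2 = n%:R + 2^-1 :> R)%R.
  by rewrite natrD natrM; field.
pose e k : R := k.+1%:R^-1%R.
have e0 k : (0 < e k)%R by rewrite invr_gt0.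
have e_cvg : e k @[k --> \oo] --> (0 : R)%R by exact: cvg_harmonic.
have eD k : (0 < Num.sqrt (e k))%R by rewrite sqrtr_gt0.
have ndE (u : nat -> R) : (forall m n, (m <= n)%N -> (u n <= u m)%R) ->
    nondecreasing_seq (fun k => `[u k, +oo[%classic).
  move=> h a b ab; rewrite subsetEset; apply: subset_itvr.
  by rewrite bnd_simp; exact: h.
have bigE (u : nat -> R) : (forall k, (0 < u k)%R) -> (u k @[k --> \oo] --> (0 : R)%R) ->
    `]0%R, +oo[%classic = \bigcup_k `[u k, +oo[%classic.
  move=> u0 ucvg; apply/seteqP; split => [z|z [k _]] /=; rewrite !in_itv/= !andbT.
    move=> z0; move/cvgrPdist_lt : ucvg => /(_ z z0) /filter_ex[k].
    rewrite sub0r normrN gtr0_norm// => uz.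
    by exists k => //=; rewrite in_itv/= andbT ltW.
  exact: lt_le_trans.
have e_ni m k : (m <= k)%N -> (e k <= e m)%R.
  by move=> mk; rewrite lef_pV2 ?posrE// ler_nat.
have s_cvg : Num.sqrt (e k) @[k --> \oo] --> (0 : R)%R.
  rewrite -(@sqrtr0 R); apply: continuous_cvg => //.
  exact: sqrt_continuous.
have mg : measurable_fun [set: R] (fun t : R => t `^ (n%:R + 2^-1 - 1) * expR (- t))%R.
  exact: measurable_gamma_fun1.
have mG : measurable_fun [set: R] (fun y : R => y ^+ (2 * n) * expR (- y ^+ 2))%R.
  apply: measurable_funM; first exact: measurable_funX.
  by apply: measurableT_comp => //; apply: measurableT_comp => //; exact: measurable_funX.
have c1 : \int[mu]_(y in `[Num.sqrt (e k), +oo[) (y ^+ (2 * n) * expR (- y ^+ 2))%:E @[k --> \oo]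
    --> \int[mu]_(y in `]0%R, +oo[) (y ^+ (2 * n) * expR (- y ^+ 2))%:E.
  rewrite (bigE _ eD s_cvg).
  apply: (@ge0_nondecreasing_set_cvg_integral _ (measurableTypeR R)) => //.
  - by apply: ndE => a b ab; rewrite ler_wsqrtr// e_ni.
  - by move=> k; exact/measurable_EFinP/measurable_funTS.
  - by move=> k y _; rewrite lee_fin mulr_ge0 ?expR_ge0// exprM exprn_ge0// sqr_ge0.
have c2 : \int[mu]_(t in `[e k, +oo[) (t `^ (n%:R + 2^-1 - 1) * expR (- t))%:E @[k --> \oo]
    --> gammaE (n%:R + 2^-1)%R.
  rewrite /gammaE (bigE _ e0 e_cvg).
  apply: (@ge0_nondecreasing_set_cvg_integral _ (measurableTypeR R)) => //.
  - exact: ndE.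
  - by move=> k; exact/measurable_EFinP/measurable_funTS.
  - by move=> k y _; rewrite lee_fin mulr_ge0 ?powR_ge0 ?expR_ge0.
rewrite nE EFinM -gammaEE; last by rewrite ltr_wpDl// invr_gt0.
rewrite -(cvg_lim _ c1)//; apply/cvg_lim => //.
under eq_fun do rewrite integral_gauss_Gamma_ge//.
by apply: cvgeZl.
Qed.

Lemma integral_normal_moment (s : R) (n : nat) : s != 0%R ->
  \int[mu]_x ((normal_pdf 0 s x)%:E * (x ^+ (2 * n))%:E) =
  (gauss_moment R n * (s ^+ 2) ^+ n)%:E.
Proof.
move=> s0.
(* With this scale, [x = a y] turns the exponent of the density into [- y^2]. *)
pose a : R := (`|s| * Num.sqrt 2)%R.
have a0 : (0 < a)%R by rewrite mulr_gt0 ?normr_gt0 ?sqrtr_gt0.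
have a2 : (a ^+ 2 = 2 * s ^+ 2)%R.
  by rewrite exprMn sqr_sqrtr// real_normK ?num_real// mulrC.
pose f (x : R) := (normal_pdf 0 s x * x ^+ (2 * n))%R.
have f0 x : (0 <= f x)%R.
  by rewrite mulr_ge0 ?normal_pdf_ge0// exprM exprn_ge0// sqr_ge0.
have mf : measurable_fun [set: R] (EFin \o f).
  apply/measurable_EFinP; apply: measurable_funM; first exact: measurable_normal_pdf.
  exact: measurable_funX.
pose g (y : R) := (y ^+ (2 * n) * expR (- y ^+ 2))%R.
have g0 y : (0 <= g y)%R by rewrite mulr_ge0 ?expR_ge0// exprM exprn_ge0// sqr_ge0.
have cg : continuous g.
  move=> y; apply: cvgM; first exact: exprn_continuous.
  apply: continuous_comp; last exact: continuous_expR.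
  by apply: cvgN; exact: exprn_continuous.
have fg y : f (a * y + 0)%R = ((Num.sqrt pi)^-1 * a^-1 * (2 * s ^+ 2) ^+ n * g y)%R.
  have ay2 : ((a * y) ^+ 2 = 2 * s ^+ 2 * y ^+ 2)%R by rewrite exprMn a2.
  rewrite addr0 /f normal_pdfE//= /normal_fun subr0 exprM !ay2 (exprMn n).
  rewrite /g exprM (_ : normal_peak s = (Num.sqrt pi)^-1 * a^-1)%R; last first.
    rewrite /normal_peak -invfM; congr (_^-1)%R.
    rewrite -mulr_natr -mulrA mulrC sqrtrM ?mulr_ge0 ?pi_ge0// sqrtr_sqr.
    rewrite sqrtrM ?pi_ge0// /a; ring.
  rewrite (_ : (- (2 * s ^+ 2 * y ^+ 2) / (s ^+ 2 *+ 2) = - y ^+ 2)%R); first by ring.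
  by rewrite -mulr_natr; field.
have := @ge0_integral_affine R a 0 (EFin \o f) _ mf _.
rewrite gt_eqF// gtr0_norm//= => /(_ isT).
under eq_integral do rewrite fg.
move=> H.
have {H} -> : \int[mu]_x ((normal_pdf 0 s x)%:E * (x ^+ (2 * n))%:E) =
  a%:E * \int[mu]_x ((Num.sqrt pi)^-1 * a^-1 * (2 * s ^+ 2) ^+ n * g x)%:E.
  by rewrite H// muleA -EFinM divff ?gt_eqF// mul1e.
have c0 : (0 <= (Num.sqrt pi)^-1 * a^-1 * (2 * s ^+ 2) ^+ n :> R)%R.
  by rewrite !mulr_ge0 ?invr_ge0 ?sqrtr_ge0 ?(ltW a0)// exprn_ge0// mulr_ge0 ?sqr_ge0.
under eq_integral do rewrite EFinM.
rewrite ge0_integralZl//; last 2 first.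
- by apply/measurable_EFinP; exact: continuous_measurable_fun.
- by move=> x _; rewrite lee_fin.
rewrite ge0_symfun_integralT//; last first.
  by move=> y; rewrite /g /= !exprM !sqrrN.
rewrite -set_itvcy -integral_itv_obnd_cbnd; last first.
  by apply/measurable_EFinP/measurable_funTS; exact: continuous_measurable_fun.
rewrite /g integral_gauss_Gamma -!EFinM; congr EFin.
rewrite /gauss_moment exprMn; field.
by rewrite !gt_eqF ?sqrtr_gt0 ?pi_gt0.
Qed.

End gauss_moments.

(** * The kernel |x - y|^(2H-2) *)

Section fubini_rectangles.
Local Open Scope ereal_scope.
Context d1 d2 (T1 : measurableType d1) (T2 : measurableType d2) (R : realType).
Variables (m1 : {sigma_finite_measure set T1 -> \bar R})
  (m2 : {sigma_finite_measure set T2 -> \bar R}).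
Variables (A : set T1) (B : set T2) (f : T1 * T2 -> \bar R).
Hypotheses (mA : measurable A) (mB : measurable B).
Hypotheses (mf : measurable_fun [set: T1 * T2] f) (f0 : forall z, 0 <= f z).

Let mfAB : measurable_fun [set: T1 * T2] (f \_ (A `*` B)).
Proof.
by apply/(measurable_restrictT f (measurableX mA mB)); exact: measurable_funTS.
Qed.

Let fAB0 z : 0 <= (f \_ (A `*` B)) z.
Proof. by rewrite patchE; case: ifPn. Qed.

Lemma fubini_rectangle1 : \int[m1 \x m2]_(z in A `*` B) f z =
  \int[m1]_(x in A) \int[m2]_(y in B) f (x, y).
Proof.
rewrite integral_mkcond (fubini_tonelli1 _ mfAB fAB0) [RHS]integral_mkcond.
apply: eq_integral => x _; rewrite /fubini_F patchE; case: ifPn => xA.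
  rewrite [RHS]integral_mkcond; apply: eq_integral => y _.
  by rewrite !patchE in_setX xA.
by rewrite integral0_eq// => y _; rewrite patchE in_setX (negbTE xA).
Qed.

Lemma fubini_rectangle2 : \int[m1 \x m2]_(z in A `*` B) f z =
  \int[m2]_(y in B) \int[m1]_(x in A) f (x, y).
Proof.
rewrite integral_mkcond (fubini_tonelli2 _ mfAB fAB0) [RHS]integral_mkcond.
apply: eq_integral => y _; rewrite /fubini_G patchE; case: ifPn => yB.
  rewrite [RHS]integral_mkcond; apply: eq_integral => x _.
  by rewrite !patchE in_setX yB andbT.
by rewrite integral0_eq// => x _; rewrite patchE in_setX (negbTE yB) andbF.
Qed.

Lemma measurable_fubini_rectangle :
  measurable_fun [set: T1] (fun x => \int[m2]_(y in B) f (x, y)).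
Proof.
have mfB : measurable_fun [set: T1 * T2] (f \_ (setT `*` B)).
  by apply/(measurable_restrictT f (measurableX measurableT mB)); exact: measurable_funTS.
rewrite (_ : (fun x => _) = fubini_F m2 (f \_ (setT `*` B))).
  by apply: measurable_fun_fubini_tonelli_F => // z; rewrite patchE; case: ifPn.
apply/funext => x; rewrite /fubini_F [LHS]integral_mkcond; apply: eq_integral => y _.
by rewrite !patchE in_setX in_setT.
Qed.

End fubini_rectangles.

Section affine_set.
Context {R : realType}.
Local Notation mu := (@lebesgue_measure R).
Local Open Scope ereal_scope.

Lemma ge0_integral_affine_set (a b : R) (D : set R) (f : R -> \bar R) : a != 0%R ->
  measurable D ->
  measurable_fun [set: R] f -> (forall x, 0 <= f x) ->
  \int[mu]_(x in (fun x => a * x + b)%R @^-1` D) f (a * x + b)%R =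
  `|a|^-1%:E * \int[mu]_(x in D) f x.
Proof.
move=> a0 mD mf f0; rewrite [in RHS]integral_mkcond -(ge0_integral_affine b a0).
- rewrite integral_mkcond; apply: eq_integral => x _; rewrite !patchE.
  by congr (if _ then _ else _); apply/idP/idP; rewrite !inE.
- by apply/(measurable_restrictT f mD); exact: measurable_funTS.
- by move=> x; rewrite patchE; case: ifPn.
Qed.

Lemma integral_shift (c d s : R) (f : R -> \bar R) :
  measurable_fun [set: R] f -> (forall x, 0 <= f x) ->
  \int[mu]_(u in `]c, d]) f u = \int[mu]_(z in `](c - s)%R, (d - s)%R]) f (z + s)%R.
Proof.
move=> mf f0.
have := @ge0_integral_affine_set 1 s `]c, d]%classic f (oner_neq0 _) (measurable_itv _) mf f0.
rewrite normr1 invr1 mul1e => <-.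
rewrite (_ : _ @^-1` _ = `](c - s)%R, (d - s)%R]%classic).
  by apply: eq_integral => x _; rewrite mul1r.
by apply/seteqP; split => x /=; rewrite !in_itv/= mul1r ltrBlDr lerBrDr.
Qed.

Lemma integral_reflect (c d s : R) (f : R -> \bar R) :
  measurable_fun [set: R] f -> (forall x, 0 <= f x) ->
  \int[mu]_(u in `]c, d]) f u = \int[mu]_(z in `](s - d)%R, (s - c)%R]) f (s - z)%R.
Proof.
move=> mf f0.
have mf' : measurable_fun [set: R] (fun z => f (s - z)%R).
  by apply: (measurableT_comp mf); exact: measurable_funB.
have := @ge0_integral_affine_set (-1) s `]c, d]%classic f _ (measurable_itv _) mf f0.
rewrite oppr_eq0 oner_neq0 normrN1 invr1 mul1e => /(_ isT) <-.
rewrite (_ : _ @^-1` _ = `[(s - d)%R, (s - c)%R[%classic).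
  rewrite -integral_itv_bndo_bndc ?integral_itv_obnd_cbnd//; last 2 first.
  - exact/measurable_funTS.
  - exact/measurable_funTS.
  by apply: eq_integral => x _; rewrite mulN1r addrC.
by apply/seteqP; split => x /=; rewrite !in_itv/= mulN1r => /andP[h1 h2];
  apply/andP; split; lra.
Qed.

End affine_set.

Section kernel.
Context {R : realType}.
Variable q : R.
Hypothesis q0 : 0 < q.
Local Notation mu := (@lebesgue_measure R).
Local Notation RR := (measurableTypeR R * measurableTypeR R)%type.
Local Open Scope ereal_scope.

(** For [q = 2H - 1] the exponent is [2H - 2]; positivity of [q] makes the singularity on the
    diagonal integrable. *)
Definition kernel (z : RR) : R := (`|z.1 - z.2| `^ (q - 1))%R.

Lemma kernel_ge0 z : (0 <= kernel z)%R.
Proof. exact: powR_ge0. Qed.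

Lemma measurable_kernel : measurable_fun [set: RR] kernel.
Proof.
apply: (measurable_compR (f := fun x => x `^ (q - 1))%R); first exact: measurable_powR.
by apply: measurableT_comp => //; exact: measurable_funB.
Qed.

Lemma kernelC x y : kernel (x, y) = kernel (y, x).
Proof. by rewrite /kernel distrC. Qed.

Lemma measurable_abs_powR (s p : R) : measurable_fun [set: R] (fun u => (`|s - u| `^ p)%:E).
Proof.
apply/measurable_EFinP; apply: (measurableT_comp (measurable_powR p)).
by apply: measurableT_comp => //; exact: measurable_funB.
Qed.

Lemma integral_abs_powR_right (p s c d : R) : (0 < p)%R -> (s <= c <= d)%R ->
  \int[mu]_(u in `]c, d]) (`|s - u| `^ (p - 1))%:E = (((d - s) `^ p - (c - s) `^ p) / p)%:E.
Proof.
move=> p0 /andP[sc cd].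
rewrite (integral_shift _ _ s (measurable_abs_powR s (p - 1))); last first.
  by move=> x; rewrite lee_fin powR_ge0.
have h1 : (0 <= c - s)%R by rewrite subr_ge0.
have h2 : (c - s <= d - s)%R by rewrite lerD2r.
rewrite -(integral_powR p0 h1 h2).
apply: eq_integral => z; rewrite inE/= in_itv/= => /andP[z0 _].
rewrite (_ : s - (z + s) = - z)%R; last by ring.
by rewrite normrN ger0_norm// (le_trans h1 (ltW z0)).
Qed.

Lemma integral_abs_powR_left (p s c d : R) : (0 < p)%R -> (c <= d <= s)%R ->
  \int[mu]_(u in `]c, d]) (`|s - u| `^ (p - 1))%:E = (((s - c) `^ p - (s - d) `^ p) / p)%:E.
Proof.
move=> p0 /andP[sc cd].
rewrite (integral_reflect _ _ s (measurable_abs_powR s (p - 1))); last first.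
  by move=> x; rewrite lee_fin powR_ge0.
have h1 : (0 <= s - d)%R by rewrite subr_ge0.
have h2 : (s - d <= s - c)%R by rewrite lerD2l lerN2.
rewrite -(integral_powR p0 h1 h2).
apply: eq_integral => z; rewrite inE/= in_itv/= => /andP[z0 _].
rewrite (_ : s - (s - z) = z)%R; last by ring.
by rewrite ger0_norm// (le_trans h1 (ltW z0)).
Qed.

Definition kernel_int (A B : set R) : \bar R :=
  \int[mu \x mu]_(z in A `*` B) (kernel z)%:E.

Let mk : measurable_fun [set: RR] (EFin \o kernel).
Proof. by apply/measurable_EFinP; exact: measurable_kernel. Qed.

Let k0 z : 0 <= (EFin \o kernel) z. Proof. by rewrite lee_fin kernel_ge0. Qed.

Lemma kernel_intE (A B : set R) : measurable A -> measurable B ->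
  kernel_int A B = \int[mu]_(x in A) \int[mu]_(y in B) (`|x - y| `^ (q - 1))%:E.
Proof.
move=> mA mB.
exact: (@fubini_rectangle1 _ _ _ _ R mu mu A B (EFin \o kernel) mA mB mk k0).
Qed.

Lemma kernel_intC (A B : set R) : measurable A -> measurable B ->
  kernel_int A B = kernel_int B A.
Proof.
move=> mA mB.
rewrite kernel_intE//.
have -> : kernel_int B A = _ :=
  @fubini_rectangle2 _ _ _ _ R mu mu B A (EFin \o kernel) mB mA mk k0.
by apply: eq_integral => x _; apply: eq_integral => y _; rewrite /= kernelC.
Qed.

(* E[(B_b - B_a)(B_d - B_c)] for a fractional Brownian motion B with 2H = q + 1 *)
Definition inc_cov (a b c d : R) : R :=
  (2^-1 * (`|b - c| `^ (q + 1) + `|a - d| `^ (q + 1) - `|b - d| `^ (q + 1)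
     - `|a - c| `^ (q + 1)))%R.

(** Off the diagonal the mixed derivative of [|x - y|^(q+1)] is [- q (q+1) |x - y|^(q-1)], and
    [inc_cov] is a mixed difference of that power over the rectangle. The order of the intervals
    fixes the sign of [x - y]. *)
Lemma kernel_int_lt (a b c d : R) : (a <= b <= c)%R -> (c <= d)%R ->
  kernel_int `]a, b] `]c, d] = (inc_cov a b c d * 2 / (q * (q + 1)))%:E.
Proof.
move=> /andP[ab bc] cd.
have q10 : (0 < q + 1)%R by rewrite addr_gt0.
have A e : (b <= e)%R -> \int[mu]_(x in `]a, b]) (`|e - x| `^ q)%:E =
    (((e - a) `^ (q + 1) - (e - b) `^ (q + 1)) / (q + 1))%:E.
  move=> be; have h : (a <= b <= e)%R by rewrite ab.
  by rewrite -(integral_abs_powR_left q10 h) addrK.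
rewrite kernel_intE//.
have inner x : x \in `]a, b]%classic -> \int[mu]_(y in `]c, d]) (`|x - y| `^ (q - 1))%:E =
    ((`|d - x| `^ q - `|c - x| `^ q) / q)%:E.
  rewrite inE/= in_itv/= => /andP[ax xb].
  have h : (x <= c <= d)%R by apply/andP; split; lra.
  have hd : (0 <= d - x)%R by lra.
  have hc : (0 <= c - x)%R by lra.
  by rewrite (integral_abs_powR_right q0 h) (ger0_norm hd) (ger0_norm hc).
transitivity (\int[mu]_(x in `]a, b]) ((`|d - x| `^ q - `|c - x| `^ q) / q)%:E).
  exact: eq_integral.
have fin : (\int[mu]_(x in `]a, b]) (`|c - x| `^ q / q)%:E) =
    (((c - a) `^ (q + 1) - (c - b) `^ (q + 1)) / (q + 1) / q)%:E.
  rewrite EFinM -A//; under eq_integral do rewrite EFinM.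
  rewrite ge0_integralZr//.
  - by apply/measurable_funTS; exact: measurable_abs_powR.
  - by rewrite lee_fin invr_ge0 ltW.
have fid : (\int[mu]_(x in `]a, b]) (`|d - x| `^ q / q)%:E) =
    (((d - a) `^ (q + 1) - (d - b) `^ (q + 1)) / (q + 1) / q)%:E.
  rewrite EFinM -A//; last exact: le_trans cd.
  under eq_integral do rewrite EFinM.
  rewrite ge0_integralZr//.
  - by apply/measurable_funTS; exact: measurable_abs_powR.
  - by rewrite lee_fin invr_ge0 ltW.
have mq e : measurable_fun [set: R] (fun x => `|e - x| `^ q)%R.
  by apply/measurable_EFinP; exact: measurable_abs_powR.
have mqq e : measurable_fun [set: R] (fun x => `|e - x| `^ q / q)%R.
  exact: measurable_funM.
have md : measurable_fun [set: R] (fun x => (`|d - x| `^ q - `|c - x| `^ q) / q)%R.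
  by apply: measurable_funM => //; exact: measurable_funB.
have nn x : x \in `]a, b]%classic -> (0 <= (`|d - x| `^ q - `|c - x| `^ q) / q)%R.
  rewrite inE/= in_itv/= => /andP[ax xb].
  rewrite divr_ge0 ?(ltW q0)// subr_ge0 ge0_ler_powR ?nnegrE ?(ltW q0)//.
  have hd : (0 <= d - x)%R by lra.
  have hc : (0 <= c - x)%R by lra.
  by rewrite (ger0_norm hd) (ger0_norm hc); lra.
(* The difference is integrated by adding the subtrahend back, which stays within integrals of
   nonnegative functions. *)
have sum : \int[mu]_(x in `]a, b]) ((`|d - x| `^ q - `|c - x| `^ q) / q)%:E +
    \int[mu]_(x in `]a, b]) (`|c - x| `^ q / q)%:E = \int[mu]_(x in `]a, b]) (`|d - x| `^ q / q)%:E.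
  rewrite -ge0_integralD//.
  - by apply: eq_integral => x _; rewrite -EFinD mulrBl subrK.
  - by move=> x ?; rewrite lee_fin nn// inE.
  - exact/measurable_EFinP/measurable_funTS.
  - by move=> x ?; rewrite lee_fin mulr_ge0 ?powR_ge0 ?invr_ge0 ?(ltW q0).
  - by apply/measurable_EFinP/measurable_funTS; exact: mqq.
move: sum; rewrite fin fid => sum.
have {sum} := congr1 (fun z =>
  z - (((c - a) `^ (q + 1) - (c - b) `^ (q + 1)) / (q + 1) / q)%:E) sum.
rewrite addeK// => ->; rewrite -EFinB; congr EFin.
rewrite /inc_cov (distrC b c) (distrC a d) (distrC b d) (distrC a c).
have h1 : (0 <= c - b)%R by lra.
have h2 : (0 <= d - a)%R by lra.
have h3 : (0 <= d - b)%R by lra.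
have h4 : (0 <= c - a)%R by lra.
rewrite (ger0_norm h1) (ger0_norm h2) (ger0_norm h3) (ger0_norm h4).
by field; rewrite !gt_eqF.
Qed.

(** The inner integral is split at [x], where the kernel is singular; each half is an explicit
    power. *)
Lemma kernel_int_diag (a b : R) : (a <= b)%R ->
  kernel_int `]a, b] `]a, b] = (inc_cov a b a b * 2 / (q * (q + 1)))%:E.
Proof.
move=> ab.
have q10 : (0 < q + 1)%R by rewrite addr_gt0.
rewrite kernel_intE//.
have mq e : measurable_fun [set: R] (fun x => `|e - x| `^ q)%R.
  by apply/measurable_EFinP; exact: measurable_abs_powR.
have inner x : x \in `]a, b]%classic -> \int[mu]_(y in `]a, b]) (`|x - y| `^ (q - 1))%:E =
    (`|a - x| `^ q / q)%:E + (`|b - x| `^ q / q)%:E.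
  rewrite inE/= in_itv/= => /andP[ax xb].
  rewrite (_ : `]a, b]%classic = `]a, x] `|` `]x, b]); last first.
    by rewrite -itv_bndbnd_setU// bnd_simp// ltW.
  rewrite ge0_integral_setU//; last 2 first.
  - by apply/measurable_funTS; exact: measurable_abs_powR.
  - by apply/disj_setPS => t [/=]; rewrite !in_itv/= => /andP[_ t1] /andP[]; rewrite ltNge t1.
  rewrite integral_abs_powR_left ?lexx ?(ltW ax)// integral_abs_powR_right ?lexx ?xb//.
  by rewrite !subrr powR0 ?gt_eqF// !subr0 (distrC a) !ger0_norm ?subr_ge0// ltW.
transitivity (\int[mu]_(x in `]a, b]) ((`|a - x| `^ q / q)%:E + (`|b - x| `^ q / q)%:E)).
  exact: eq_integral.
have mqq e : measurable_fun [set: R] (fun x => `|e - x| `^ q / q)%R.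
  exact: measurable_funM.
have nn e x : 0 <= (`|e - x| `^ q / q)%:E.
  by rewrite lee_fin mulr_ge0 ?powR_ge0 ?invr_ge0 ?(ltW q0).
have mm e : measurable_fun `]a, b] (fun x => (`|e - x| `^ q / q)%:E).
  by apply/measurable_EFinP/measurable_funTS; exact: mqq.
rewrite ge0_integralD//; last 2 first.
- exact: mm.
- exact: mm.
have I e : \int[mu]_(x in `]a, b]) (`|e - x| `^ q / q)%:E =
    (q^-1)%:E * \int[mu]_(x in `]a, b]) (`|e - x| `^ (q + 1 - 1))%:E.
  rewrite -ge0_integralZl//.
  - by apply: eq_integral => x _; rewrite -EFinM mulrC addrK.
  - by apply/measurable_funTS; exact: measurable_abs_powR.
  - by rewrite lee_fin invr_ge0 ltW.
have hb : (a <= b <= b)%R by rewrite ab lexx.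
have ha : (a <= a <= b)%R by rewrite ab lexx.
rewrite !I (integral_abs_powR_left q10 hb) (integral_abs_powR_right q10 ha).
rewrite !subrr powR0 ?gt_eqF// !subr0 -!EFinM -EFinD; congr EFin.
rewrite /inc_cov !subrr normr0 powR0 ?gt_eqF// (distrC a b) ger0_norm ?subr_ge0//.
by field; rewrite !gt_eqF.
Qed.

Lemma kernel_int_gt0 (a b : R) : (a < b)%R -> 0 < kernel_int `]a, b] `]a, b].
Proof.
move=> ab; rewrite kernel_int_diag ?(ltW ab)// lte_fin.
rewrite /inc_cov !subrr normr0 powR0 ?gt_eqF ?addr_gt0// !subr0 (distrC a b).
by rewrite divr_gt0 ?mulr_gt0 ?addr_gt0 ?powR_gt0 ?normr_gt0 ?subr_eq0 ?gt_eqF.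
Qed.

End kernel.

Lemma measurable_expRNM {R : realType} (l : R) :
  measurable_fun [set: R] (fun t : R => expR (- (l * t))).
Proof.
by apply: measurableT_comp => //; apply: measurableT_comp => //; exact: measurable_funM.
Qed.

(** * The kernel with an exponential weight *)

Section damped_kernel.
Context {R : realType}.
Variable q : R.
Hypothesis q0 : 0 < q.
Local Notation mu := (@lebesgue_measure R).
Local Notation RR := (measurableTypeR R * measurableTypeR R)%type.
Local Notation kernel := (kernel q).
Local Open Scope ereal_scope.

(** The parameter [l] is [theta^-1] in the variance of the process, and the auxiliary integration
    variable [t] in the multiple integral. *)
Definition damped (l : R) (z : RR) : R := (kernel z * expR (- (l * (z.1 + z.2))))%R.

Lemma damped_ge0 l z : (0 <= damped l z)%R.
Proof. by rewrite mulr_ge0 ?expR_ge0 ?kernel_ge0. Qed.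

Lemma measurable_damped l : measurable_fun [set: RR] (damped l).
Proof.
apply: measurable_funM; first exact: measurable_kernel.
by apply: measurableT_comp => //; apply: measurableT_comp => //; apply: measurable_funM => //; exact: measurable_funD.
Qed.

Definition damped_int (l : R) (D : set R) : \bar R :=
  \int[mu \x mu]_(z in D `*` D) (damped l z)%:E.

Let md l : measurable_fun [set: RR] (EFin \o damped l).
Proof. by apply/measurable_EFinP; exact: measurable_damped. Qed.

Let d0 l z : 0 <= (EFin \o damped l) z. Proof. by rewrite lee_fin damped_ge0. Qed.

Lemma damped_intE l (D : set R) : measurable D ->
  damped_int l D = \int[mu]_(x in D) \int[mu]_(y in D) (damped l (x, y))%:E.
Proof.
move=> mD.
exact: (@fubini_rectangle1 _ _ _ _ R mu mu D D (EFin \o damped l) mD mD (md l) (d0 l)).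
Qed.

Lemma le_damped_int l (C D : set R) : measurable C -> measurable D -> C `<=` D ->
  damped_int l C <= damped_int l D.
Proof.
move=> mC mD CD; apply: ge0_subset_integral.
- exact: measurableX.
- exact: measurableX.
- by apply: measurable_funTS; exact: md.
- by move=> z _; exact: d0.
- by move=> [x y] [] /= /CD ? /CD ?.
Qed.

Lemma damped_int_cvg l : damped_int l `]0%R, n%:R] @[n --> \oo] --> damped_int l `]0%R, +oo[.
Proof.
rewrite /damped_int (_ : `]0%R, +oo[%classic `*` `]0%R, +oo[%classic =
  \bigcup_n (`]0%R, n%:R]%classic `*` `]0%R, n%:R]%classic) :> set RR).
  apply: ge0_nondecreasing_set_cvg_integral.
  - move=> m n mn; rewrite subsetEset => -[x y] [] /=; rewrite !in_itv/= => /andP[x0 xm] /andP[y0 ym].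
    have mn' : (m%:R <= n%:R :> R)%R by rewrite ler_nat.
    by split => /=; rewrite ?in_itv/= ?x0 ?y0/= (le_trans _ mn').
  - by move=> n; exact: measurableX.
  - by move=> n; apply: measurable_funTS; exact: md.
  - by move=> n z _; exact: d0.
apply/seteqP; split => [[x y] [] /=|[x y] [n _] [] /=]; rewrite !in_itv/= ?andbT.
  move=> x0 y0; exists (Num.bound (Num.max x y)) => //=.
  have : (Num.max x y <= (Num.bound (Num.max x y))%:R)%R.
    by apply/ltW/archi_boundP; rewrite le_max (ltW x0).
  by rewrite ge_max => /andP[? ?]; split => /=; rewrite ?in_itv/= ?x0 ?y0.
by move=> /andP[? _] /andP[? _]; split => /=; rewrite ?in_itv/= ?andbT.
Qed.

(** By symmetry in the diagonal the quadrant is twice the region [s < u]. There [u = z + s] produces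
    a Gamma integral times [exp(-2 l s)], and integrating over [s] gives the factor [1 / (2 l)]. *)
Lemma damped_int_total l : (0 < l)%R ->
  damped_int l `]0%R, +oo[ = (l `^ (- (q + 1)) * Gamma q)%:E.
Proof.
move=> l0; rewrite damped_intE//.
have l20 : (0 < 2 * l)%R by rewrite mulr_gt0.
have shift (f : R -> \bar R) (s : R) : measurable_fun [set: R] f -> (forall x, 0 <= f x) ->
    \int[mu]_(u in `]s, +oo[) f u = \int[mu]_(z in `]0%R, +oo[) f (z + s)%R.
  move=> mf f0.
  have := @ge0_integral_affine_set R 1 s `]s, +oo[%classic f (oner_neq0 _) (measurable_itv _) mf f0.
  rewrite normr1 invr1 mul1e => <-.
  rewrite (_ : _ @^-1` _ = `]0%R, +oo[%classic).
    by apply: eq_integral => x _; rewrite mul1r.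
  by apply/seteqP; split => x /=; rewrite !in_itv/= mul1r !andbT => ?; lra.
have mdx x : measurable_fun [set: R] (fun y => (damped l (x, y))%:E).
  have mk : measurable_fun [set: R] (fun y => `|x - y| `^ (q - 1))%R.
    by apply/measurable_EFinP; exact: measurable_abs_powR.
  have me : measurable_fun [set: R] (fun y => expR (- (l * (x + y))))%R.
    by apply: measurableT_comp => //; apply: measurableT_comp => //; apply: measurable_funM => //; exact: measurable_funD.
  by apply/measurable_EFinP; exact: (measurable_funM mk me).
have dC x y : damped l (x, y) = damped l (y, x).
  by rewrite /damped kernelC /= addrC.
have up s : \int[mu]_(u in `]s, +oo[) (damped l (s, u))%:E =
    (l `^ (- q) * Gamma q * expR (- (2 * l * s)))%:E.
  rewrite (shift _ _ (mdx s)); last by move=> x; exact: d0.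
  transitivity (\int[mu]_(z in `]0%R, +oo[)
      ((expR (- (2 * l * s)))%:E * (z `^ (q - 1) * expR (- (l * z)))%:E)).
    apply: eq_integral => z; rewrite inE/= in_itv/= andbT => z0.
    rewrite -EFinM /damped /kernel /= (_ : s - (z + s) = - z)%R; last by ring.
    rewrite normrN gtr0_norm// mulrCA -expRD; congr (_ * expR _)%:E; ring.
  rewrite ge0_integralZl//.
  - by rewrite gammaE_scale// gammaEE// -!EFinM mulrC.
  - by apply/measurable_EFinP/measurable_funTS; exact: measurable_gamma_fun.
  - by move=> z _; rewrite lee_fin mulr_ge0 ?powR_ge0 ?expR_ge0.
have split s : s \in `]0%R, +oo[%classic -> \int[mu]_(u in `]0%R, +oo[) (damped l (s, u))%:E =
    \int[mu]_(u in `]0%R, s]) (damped l (s, u))%:E + \int[mu]_(u in `]s, +oo[) (damped l (s, u))%:E.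
  rewrite inE/= in_itv/= andbT => s0.
  rewrite (_ : `]0%R, +oo[%classic = `]0%R, s] `|` `]s, +oo[); last first.
    by rewrite -itv_bndbnd_setU// bnd_simp// ltW.
  apply: ge0_integral_setU => //.
  - by apply: measurable_funTS; exact: mdx.
  - by move=> x _; exact: d0.
  - by apply/disj_setPS => t [/=]; rewrite !in_itv/= andbT => /andP[_ t1]; rewrite ltNge t1.
pose A := [set z : RR | 0 < z.2 <= z.1]%R.
have mA : measurable A.
  have m0 : measurable_fun [set: RR] (fun p => (0 < p.2) && (p.2 <= p.1))%R.
    apply: measurable_and; first exact: measurable_fun_ltr.
    exact: measurable_fun_ler.
  by have := m0 measurableT [set true] I; rewrite setTI.
have mdA : measurable_fun [set: RR] ((EFin \o damped l) \_ A).
  by apply/(measurable_restrictT _ mA); apply: measurable_funTS; exact: md.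
have dA0 z : 0 <= ((EFin \o damped l) \_ A) z.
  by rewrite patchE; case: ifPn.
have lowE x : \int[mu]_y ((EFin \o damped l) \_ A) (x, y) =
    \int[mu]_(u in `]0%R, x]) (damped l (x, u))%:E.
  rewrite [RHS]integral_mkcond; apply: eq_integral => y _; rewrite !patchE.
  by congr (if _ then _ else _); apply/idP/idP; rewrite !inE /A/= ?in_itv.
(* Tonelli on the region [0 < u <= s] and the symmetry of [damped] exchange the two triangles. *)
have low : \int[mu]_(s in `]0%R, +oo[) \int[mu]_(u in `]0%R, s]) (damped l (s, u))%:E =
    \int[mu]_(s in `]0%R, +oo[) \int[mu]_(u in `]s, +oo[) (damped l (s, u))%:E.
  transitivity (\int[mu]_x \int[mu]_y ((EFin \o damped l) \_ A) (x, y)).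
    rewrite [LHS]integral_mkcond; apply: eq_integral => x _; rewrite lowE patchE.
    case: ifPn => //; rewrite notin_setE/= in_itv/= andbT => /negP; rewrite -leNgt => x0.
    by rewrite set_itv_ge ?integral_set0// bnd_simp -leNgt.
  rewrite (@fubini_tonelli _ _ _ _ R mu mu _ mdA dA0).
  rewrite [RHS]integral_mkcond; apply: eq_integral => y _; rewrite patchE.
  case: ifPn; rewrite ?inE ?notin_setE/= in_itv/= andbT => y0; last first.
    apply: integral0_eq => x _; rewrite patchE memNset// /A/= => /andP[y0' _].
    by rewrite y0' in y0.
  rewrite integral_itv_obnd_cbnd; last by apply: measurable_funTS; exact: mdx.
  rewrite [RHS]integral_mkcond; apply: eq_integral => x _; rewrite !patchE dC.
  by congr (if _ then _ else _); apply/idP/idP; rewrite !inE /A/= ?in_itv/= ?y0 ?andbT.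
transitivity (\int[mu]_(s in `]0%R, +oo[)
  (\int[mu]_(u in `]0%R, s]) (damped l (s, u))%:E + \int[mu]_(u in `]s, +oo[) (damped l (s, u))%:E)).
  exact: eq_integral.
have mlow : measurable_fun [set: R] (fun s => \int[mu]_(u in `]0%R, s]) (damped l (s, u))%:E).
  rewrite (_ : (fun s => _) = fun x => \int[mu]_y ((EFin \o damped l) \_ A) (x, y)).
    exact: (measurable_fun_fubini_tonelli_F _ mdA dA0).
  by apply/funext => x; rewrite lowE.
have mup : measurable_fun [set: R] (fun s => \int[mu]_(u in `]s, +oo[) (damped l (s, u))%:E).
  pose c := (l `^ (- q) * Gamma q)%R.
  have mc : measurable_fun [set: R] (fun s : R => c * expR (- (2 * l * s)))%R.
    exact: (measurable_funM (measurable_cst c) (measurable_expRNM (2 * l))).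
  rewrite (_ : (fun s => _) = fun s => (c * expR (- (2 * l * s)))%:E).
    exact/measurable_EFinP.
  by apply/funext => s; exact: up.
have low0 x : 0 <= \int[mu]_(u in `]0%R, x]) (damped l (x, u))%:E.
  by apply: integral_ge0 => y _; exact: d0.
have up0 x : 0 <= \int[mu]_(u in `]x, +oo[) (damped l (x, u))%:E.
  by apply: integral_ge0 => y _; exact: d0.
rewrite ge0_integralD; [|exact: measurable_itv|by move=> x _; exact: low0
  |exact: measurable_funTS|by move=> x _; exact: up0|exact: measurable_funTS].
rewrite low.
have -> : \int[mu]_(s in `]0%R, +oo[) \int[mu]_(u in `]s, +oo[) (damped l (s, u))%:E =
    (l `^ (- q) * Gamma q / (2 * l))%:E.
  transitivity (\int[mu]_(s in `]0%R, +oo[)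
      ((l `^ (- q) * Gamma q)%:E * (expR (- (2 * l * s)))%:E)).
    by apply: eq_integral => s _; rewrite up EFinM.
  rewrite ge0_integralZl; [|exact: measurable_itv|..]; last 3 first.
  - by apply/measurable_EFinP/measurable_funTS; exact: measurable_expRNM.
  - by move=> x _; rewrite lee_fin expR_ge0.
  - by rewrite lee_fin mulr_ge0 ?powR_ge0 ?Gamma_ge0.
  by rewrite (integral_expRN 0%R l20) mulr0 oppr0 expR0 mul1r.
rewrite -EFinD; congr EFin.
rewrite opprD (powRD_gt0 _ _ l0) (powR_inv1 (ltW l0)).
by field; rewrite gt_eqF.
Qed.

Lemma damped_int_fin l (D : set R) : (0 < l)%R -> measurable D ->
  D `<=` `]0%R, +oo[%classic -> damped_int l D \is a fin_num.
Proof.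
move=> l0 mD D0; rewrite ge0_fin_numE; last by apply: integral_ge0 => z _; exact: d0.
apply: le_lt_trans (le_damped_int _ mD _ D0) _ => //.
by rewrite damped_int_total// ltry.
Qed.

(** The square on []x, y]] lies in the larger square and is disjoint from the smaller one. It has
    positive mass, as the exponential weight is at least [exp(-2 l y)] on it. *)
Lemma lt_damped_int l (x y : R) : (0 < l)%R -> (0 <= x < y)%R ->
  damped_int l `]0%R, x] < damped_int l `]0%R, y].
Proof.
move=> l0 /andP[x0 xy].
have y0 : (0 < y)%R by exact: le_lt_trans xy.
have pos : 0 < damped_int l `]x, y].
  apply: (@lt_le_trans _ _ ((expR (- (l * (2 * y))))%:E * kernel_int q `]x, y] `]x, y])).
    by rewrite mule_gt0 ?lte_fin ?expR_gt0// kernel_int_gt0.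
  have mk : measurable_fun [set: RR] (EFin \o kernel).
    by apply/measurable_EFinP; exact: measurable_kernel.
  rewrite /kernel_int -ge0_integralZl//; last 3 first.
  - exact: measurableX.
  - exact: measurable_funTS.
  - by move=> z _; rewrite lee_fin kernel_ge0.
  apply: ge0_le_integral => //.
  - exact: measurableX.
  - by move=> z _; rewrite mule_ge0 ?lee_fin ?expR_ge0 ?kernel_ge0.
  - by apply: emeasurable_funM => //; exact: measurable_funTS.
  - by apply: measurable_funTS; exact: md.
  - move=> [a b] [] /=; rewrite !in_itv/= => /andP[_ ay] /andP[_ bY].
    rewrite -EFinM lee_fin mulrC ler_wpM2l ?kernel_ge0// ler_expR lerN2 ler_pM2l//=.
    by rewrite mulr2n mulrDl mul1r lerD.
have xfin := @damped_int_fin l `]0%R, x]%classic l0 (measurable_itv _) _.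
apply: (@lt_le_trans _ _ (damped_int l `]0%R, x] + damped_int l `]x, y])).
  by rewrite lteDl// xfin//; exact: subset_itvl.
rewrite /damped_int -ge0_integral_setU//; last 5 first.
- exact: measurableX.
- exact: measurableX.
- by apply: measurable_funTS; exact: md.
- by move=> z _; exact: d0.
- apply/disj_setPS => -[a b] [] [] /=; rewrite !in_itv/= => /andP[_ ax] _ [] /andP[].
  by rewrite ltNge ax.
apply: ge0_subset_integral.
- by apply: measurableU; exact: measurableX.
- exact: measurableX.
- by apply: measurable_funTS; exact: md.
- by move=> z _; exact: d0.
- move=> [a b] [] [] /=; rewrite !in_itv/= => /andP[? ?] /andP[? ?]; split => /=; rewrite ?in_itv/=;
  apply/andP; split; lra.
Qed.

End damped_kernel.

(** * The multiple integral *)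

Section lebesgue_tuple_integrals.
Context {R : realType}.
Local Notation mu := (@lebesgue_measure R).
Local Notation mT := (measurableTypeR R).
Local Open Scope ereal_scope.

Lemma integral_lebesgue_cons k (f : k.+1.-tuple mT -> \bar R) :
  measurable_fun [set: _] f -> (forall z, 0 <= f z) ->
  \int[lebesgue_tuple R k.+1]_z f z =
  \int[mu]_x \int[lebesgue_tuple R k]_v f (cons_pair (x, v)).
Proof.
move=> mf f0.
have mfc : measurable_fun [set: _] (f \o @cons_pair R k).
  by apply: measurableT_comp => //; exact: measurable_cons_pair.
have fc0 p : 0 <= (f \o @cons_pair R k) p by exact: f0.
rewrite -(@fubini_tonelli1 _ _ _ _ R mu (lebesgue_tuple R k) _ mfc fc0).
have := @ge0_integral_pushforward _ _ _ _ R _ (@measurable_cons_pair R k)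
  (mu \x lebesgue_tuple R k) setT f measurableT mf (fun y _ => f0 y).
by rewrite preimage_setT.
Qed.

Lemma integral_lebesgue_tuple0 (f : 0.-tuple mT -> \bar R) :
  measurable_fun [set: _] f -> \int[lebesgue_tuple R 0]_z f z = f [tuple].
Proof. by move=> mf; rewrite /= integral_dirac// diracT mul1e. Qed.

Definition cat_pair m n (p : m.-tuple mT * n.-tuple mT) : (m + n).-tuple mT :=
  [tuple of p.1 ++ p.2].

Lemma measurable_cat_pair m n : measurable_fun [set: _] (@cat_pair m n).
Proof.
apply/measurable_fun_tnthP => i.
have [j ->|j ->] := split_ordP i.
- rewrite (_ : _ \o _ = fun p => tnth p.1 j).
    by apply: (measurableT_comp (measurable_tnth j)).
  by apply/funext => p /=; rewrite tnth_lshift.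
- rewrite (_ : _ \o _ = fun p => tnth p.2 j).
    by apply: (measurableT_comp (measurable_tnth j)).
  by apply/funext => p /=; rewrite tnth_rshift.
Qed.

(** The coordinates come as a block of all [x_i] followed by a block of all [y_i]. Integrating the
    second block first leaves a product over [i] in each of the two steps. *)
Lemma integral_lebesgue_cat m n (f : (m + n).-tuple mT -> \bar R) :
  measurable_fun [set: _] f -> (forall z, 0 <= f z) ->
  \int[lebesgue_tuple R (m + n)]_z f z =
  \int[lebesgue_tuple R m]_x \int[lebesgue_tuple R n]_y f (cat_pair (x, y)).
Proof.
have mG k (g : (k + n).-tuple mT -> \bar R) : measurable_fun [set: _] g -> (forall z, 0 <= g z) ->
    measurable_fun [set: _] (fun x : k.-tuple mT => \int[lebesgue_tuple R n]_y g (cat_pair (x, y))).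
  move=> mg g0; apply: (measurable_fun_fubini_tonelli_F (g \o @cat_pair k n)).
    by apply: measurableT_comp => //; exact: measurable_cat_pair.
  by move=> z; exact: g0.
elim: m f => [|m IH] f mf f0.
  rewrite integral_lebesgue_tuple0; last exact: mG.
  by apply: eq_integral => y _; congr f; apply/val_inj.
rewrite (integral_lebesgue_cons (k := m + n) mf f0) integral_lebesgue_cons; last 2 first.
- exact: mG.
- by move=> x; exact: integral_ge0.
apply: eq_integral => a _; rewrite IH.
- apply: eq_integral => x _; apply: eq_integral => y _; congr f; exact/val_inj.
- apply: measurableT_comp => //.
  apply: (measurableT_comp (@measurable_cons_pair R (m + n))).
  exact: measurable_pair1.
- by move=> z.
Qed.

Lemma integral_lebesgue_prod n (g : 'I_n -> R -> \bar R) :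
  (forall i, measurable_fun [set: R] (g i)) -> (forall i x, 0 <= g i x) ->
  \int[lebesgue_tuple R n]_y (\prod_(i < n) g i (tnth y i)) =
  \prod_(i < n) \int[mu]_x g i x.
Proof.
have mP k (h : 'I_k -> R -> \bar R) : (forall i, measurable_fun [set: R] (h i)) ->
    measurable_fun [set: k.-tuple mT] (fun y => \prod_(i < k) h i (tnth y i)).
  move=> mh; elim: (index_enum _) => [|i s IHs].
    rewrite (_ : (fun y => _) = cst 1); first exact: measurable_cst.
    by apply/funext => y; rewrite big_nil.
  rewrite (_ : (fun y => _) = fun y : k.-tuple mT =>
      h i (tnth y i) * \prod_(j <- s) h j (tnth y j)); last first.
    by apply/funext => y; rewrite big_cons.
  apply: emeasurable_funM => //.
  by apply: measurable_compR => //; exact: measurable_tnth.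
have P0 k (h : 'I_k -> R -> \bar R) : (forall i x, 0 <= h i x) ->
    forall y : k.-tuple mT, 0 <= \prod_(i < k) h i (tnth y i).
  by move=> h0 y; apply: prode_ge0 => i _.
elim: n g => [|n IH] g mg g0.
  by rewrite integral_lebesgue_tuple0 ?big_ord0//; exact: mP.
rewrite integral_lebesgue_cons; [|exact: mP|exact: P0].
rewrite big_ord_recl -IH//.
have mP' := mP n (fun i => g (lift ord0 i)) (fun i => mg _).
have P0' := P0 n (fun i => g (lift ord0 i)) (fun i => g0 _).
have I0 : 0 <= \int[lebesgue_tuple R n]_y \prod_(i < n) g (lift ord0 i) (tnth y i).
  by apply: integral_ge0 => y _; exact: P0'.
rewrite -ge0_integralZr//; last exact: mg.
apply: eq_integral => x _.
rewrite -ge0_integralZl//.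
apply: eq_integral => y _; rewrite big_ord_recl; congr (_ * _).
by apply: eq_bigr => i _; rewrite tnthS.
Qed.

End lebesgue_tuple_integrals.

Section multi_integral.
Context {R : realType}.
Local Notation mu := (@lebesgue_measure R).
Local Notation mT := (measurableTypeR R).
Local Open Scope ereal_scope.
Variable H : R.
Hypothesis H1 : (2^-1 < H < 1)%R.
Let q := (2 * H - 1)%R.
Let q0 : (0 < q)%R. Proof. by rewrite /q; move/andP: H1 => [? ?]; lra. Qed.
(** The indicators extend the integrals over the quadrant to the whole plane, so that products of
    such factors can be integrated over all tuples. *)
Let dd (t x y : R) : R := (damped q t (x, y) * \1_`[0%R, +oo[ x * \1_`[0%R, +oo[ y)%R.

Let dd0 t x y : (0 <= dd t x y)%R.
Proof. by apply: mulr_ge0 => //; apply: mulr_ge0 => //; exact: damped_ge0. Qed.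

Let mdd t : measurable_fun [set: mT * mT] (fun z => dd t z.1 z.2).
Proof.
rewrite (_ : (fun z => _) = fun z : mT * mT =>
    (damped q t z * \1_`[0%R, +oo[ z.1 * \1_`[0%R, +oo[ z.2)%R); last first.
  by apply/funext => -[].
apply: measurable_funM; last exact: measurableT_comp.
apply: measurable_funM; last exact: measurableT_comp.
exact: measurable_damped.
Qed.

Let mddc d (T : measurableType d) t (f g : T -> mT) :
  measurable_fun [set: T] f -> measurable_fun [set: T] g ->
  measurable_fun [set: T] (fun x => dd t (f x) (g x)).
Proof. by move=> mf mg; exact: (measurableT_comp (mdd t) (measurable_fun_pair mf mg)). Qed.

Let dd_total t : (0 < t)%R ->
  \int[mu]_x \int[mu]_y (dd t x y)%:E = (t `^ (- (q + 1)) * Gamma q)%:E.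
Proof.
move=> t0; rewrite -(damped_int_total q0 t0) (damped_intE _ _ (measurable_itv _)).
have md : measurable_fun [set: mT * mT] (EFin \o damped q t).
  by apply/measurable_EFinP; exact: measurable_damped.
have d0 z : 0 <= (EFin \o damped q t) z by rewrite lee_fin damped_ge0.
rewrite integral_itv_obnd_cbnd; last first.
  apply: measurable_funTS.
  exact: (@measurable_fubini_rectangle _ _ _ _ R mu _ _ (measurable_itv _) md d0).
rewrite [RHS]integral_mkcond; apply: eq_integral => x _; rewrite patchE.
case: ifPn => x0; last first.
  by apply: integral0_eq => y _; rewrite /dd !indicE (negbTE x0) mulr0 mul0r.
rewrite integral_itv_obnd_cbnd; last first.
  by apply: measurable_funTS; apply: (measurableT_comp md); exact: measurable_pair1.
rewrite [RHS]integral_mkcond; apply: eq_integral => y _; rewrite patchE /dd !indicE x0.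
by case: ifPn => _; rewrite ?mulr1 ?mulr0.
Qed.

Let integral_prod_damped n t : (0 < t)%R ->
  \int[lebesgue_tuple R (n + n)]_z
    (\prod_(i < n) dd t (tnth z (lshift n i)) (tnth z (rshift n i)))%:E =
  ((t `^ (- (q + 1)) * Gamma q) ^+ n)%:E.
Proof.
move=> t0.
rewrite integral_lebesgue_cat; last 2 first.
- apply/measurable_EFinP; apply: measurable_prod => i _.
  by apply: mddc; exact: measurable_tnth.
- by move=> z; rewrite lee_fin prodr_ge0.
have mdx x : measurable_fun [set: R] (fun y => (dd t x y)%:E).
  by apply/measurable_EFinP; exact: (mddc t (measurable_cst (x : mT)) (@measurable_id _ mT setT)).
transitivity (\int[lebesgue_tuple R n]_x \prod_(i < n) (fun a => \int[mu]_y (dd t a y)%:E) (tnth x i)).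
  apply: eq_integral => x _.
  rewrite -(@integral_lebesgue_prod _ n (fun i y => (dd t (tnth x i) y)%:E)); last 2 first.
  - by move=> i; exact: mdx.
  - by move=> i y; rewrite lee_fin.
  apply: eq_integral => y _; rewrite [RHS]prodEFin; congr EFin.
  by apply: eq_bigr => i _; rewrite tnth_lshift tnth_rshift.
pose kappa a := \int[mu]_y (dd t a y)%:E.
have mkappa : measurable_fun [set: R] kappa.
  have m2 : measurable_fun [set: mT * mT] (fun z => (dd t z.1 z.2)%:E).
    exact/measurable_EFinP.
  have n2 (z : mT * mT) : 0 <= (dd t z.1 z.2)%:E by rewrite lee_fin.
  exact: (@measurable_fun_fubini_tonelli_F _ _ mT mT R mu _ m2 n2).
have kappa0 a : 0 <= kappa a by apply: integral_ge0 => y _; rewrite lee_fin.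
have := @integral_lebesgue_prod R n (fun=> kappa) (fun=> mkappa) (fun=> kappa0).
rewrite dd_total// => ->.
by rewrite prodEFin prodr_const card_ord.
Qed.

Lemma measurable_orthant k : measurable (@orthant R k).
Proof.
rewrite (_ : @orthant R k = \bigcap_(i in [set: 'I_k])
    ((fun z : k.-tuple mT => tnth z i) @^-1` `[0%R, +oo[)).
  apply: fin_bigcap_measurable => // i _.
  by rewrite -[X in measurable X]setTI; apply: measurable_tnth.
apply/seteqP; split => z /= h i; first by move=> _ /=; rewrite in_itv/= andbT; exact: h.
by have := h i I; rewrite /= in_itv/= andbT.
Qed.

Section fixed_dimension.
Variable n : nat.
Let b := (2 * n%:R * H + 1)%R.
Let H0 : (0 < H)%R.
Proof. by move/andP: H1 => [h _]; apply: lt_trans h; rewrite invr_gt0. Qed.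
Let b0 : (0 < b)%R.
Proof. by rewrite ltr_wpDl// !mulr_ge0// ltW. Qed.

Let X (z : (n + n).-tuple mT) i : R := tnth z (lshift n i).
Let Y (z : (n + n).-tuple mT) i : R := tnth z (rshift n i).
Let G (t : R) z : R := (\prod_(i < n) dd t (X z i) (Y z i))%R.
(** The integrand to which Tonelli is applied: integrating out [t] gives [multi_kernel] up to the
    factor [Gamma b], integrating out the tuple gives the [n]-th power of one planar integral. *)
Let Phi (p : (n + n).-tuple mT * mT) : R :=
  (p.2 `^ (b - 1) * expR (- p.2) * \1_`]0%R, +oo[ p.2 * G p.2 p.1)%R.

Let G0 t z : (0 <= G t z)%R. Proof. exact: prodr_ge0. Qed.

Let Phi0 p : 0 <= (EFin \o Phi) p.
Proof. by rewrite lee_fin !mulr_ge0 ?powR_ge0 ?expR_ge0. Qed.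

Let mPhi : measurable_fun [set: _] (EFin \o Phi).
Proof.
apply/measurable_EFinP; apply: measurable_funM.
  apply: measurable_funM; last exact: measurableT_comp.
  apply: (measurable_compR (f := fun t => t `^ (b - 1) * expR (- t))%R) => //.
  exact: measurable_gamma_fun1.
apply: measurable_prod => i _.
have mX : measurable_fun [set: (n + n).-tuple mT * mT] (fun p => X p.1 i).
  by apply: (measurableT_comp (measurable_tnth _)).
have mY : measurable_fun [set: (n + n).-tuple mT * mT] (fun p => Y p.1 i).
  by apply: (measurableT_comp (measurable_tnth _)).
apply: measurable_funM.
  apply: measurable_funM; last exact: measurableT_comp.
  apply: measurable_funM.
    by apply: (measurableT_comp (measurable_kernel q)); exact: measurable_fun_pair.
  apply: measurableT_comp => //; apply: measurableT_comp => //.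
  by apply: measurable_funM => //; exact: measurable_funD.
exact: measurableT_comp.
Qed.

Let sumXY z : R := (1 + \sum_(i < n) X z i + \sum_(i < n) Y z i)%R.

Let integral_Phi z : \int[mu]_t (EFin \o Phi) (z, t) =
  (Gamma b)%:E * ((EFin \o @multi_kernel R H n) \_ (@orthant R (n + n))) z.
Proof.
rewrite patchE; case: ifPn => zo; last first.
  rewrite mule0; apply: integral0_eq => t _ /=.
  rewrite /Phi (_ : G t z = 0%R) ?mulr0//.
  have : exists i, (tnth z i < 0)%R.
    apply: contrapT => h; move/negP: zo; apply; rewrite inE => i.
    by rewrite leNgt; apply/negP => zi; apply: h; exists i.
  case => i zi; have [j ij|j ij] := split_ordP i; apply/eqP/prodf_eq0; exists j => //; apply/eqP.
    have hX : (X z j \in `[0%R, +oo[%classic) = false.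
      by apply/negbTE; rewrite notin_setE/= in_itv/= andbT /X -ij leNgt zi.
    by rewrite /dd !indicE hX mulr0 mul0r.
  have hY : (Y z j \in `[0%R, +oo[%classic) = false.
    by apply/negbTE; rewrite notin_setE/= in_itv/= andbT /Y -ij leNgt zi.
  by rewrite /dd !indicE hY mulr0.
have {}zo i : (0 <= tnth z i)%R by move: zo; rewrite inE; exact.
pose K := (\prod_(i < n) `|X z i - Y z i| `^ (2 * H - 2))%R.
have K0 : (0 <= K)%R by apply: prodr_ge0 => i _; exact: powR_ge0.
have S0 : (0 < sumXY z)%R.
  by rewrite /sumXY -addrA ltr_wpDr// addr_ge0// sumr_ge0// => i _; exact: zo.
(* The summand 1 of [sumXY] is taken out here because its factor [exp(-t)] stands in [Phi]
   itself. *)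
have GE t : G t z = (K * expR (- ((sumXY z - 1) * t)))%R.
  rewrite (_ : (- _ = \sum_(i < n) - (t * (X z i + Y z i)))%R); last first.
    rewrite sumrN -mulr_sumr big_split/= /sumXY; congr (- _)%R; ring.
  rewrite expR_sum /K -big_split/=; apply: eq_bigr => i _.
  rewrite /dd !indicE !mem_set ?mulr1/=; [|by rewrite in_itv/= andbT zo..].
  by rewrite /damped /kernel/=; congr (_ `^ _ * _)%R; rewrite /q; ring.
transitivity (\int[mu]_(t in `]0%R, +oo[) (K%:E * (t `^ (b - 1) * expR (- (sumXY z * t)))%:E)).
  rewrite [RHS]integral_mkcond; apply: eq_integral => t _.
  rewrite patchE /= /Phi /= indicE; case: ifPn => _; last by rewrite mulr0 mul0r.
  rewrite GE -EFinM mulr1; congr EFin.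
  rewrite mulrCA -!mulrA -expRD; congr (_ * (_ * expR _))%R; ring.
rewrite ge0_integralZl; [|exact: measurable_itv| | |].
- rewrite gammaE_scale// gammaEE// -!EFinM; congr EFin.
  by rewrite /multi_kernel -/b powRN mulrA [RHS]mulrC.
- by apply/measurable_EFinP/measurable_funTS; exact: measurable_gamma_fun.
- by move=> t _; rewrite lee_fin mulr_ge0 ?powR_ge0 ?expR_ge0.
- by rewrite lee_fin.
Qed.

(** Read off from [integral_Phi]: a partial integral of a nonnegative measurable function is
    measurable, and [Gamma b] is not 0. *)
Let mMK : measurable_fun [set: _] ((EFin \o @multi_kernel R H n) \_ (@orthant R (n + n))).
Proof.
rewrite (_ : _ \_ _ = fun z => (Gamma b)^-1%:E * \int[mu]_t (EFin \o Phi) (z, t)).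
  apply: emeasurable_funM => //.
  exact: (measurable_fun_fubini_tonelli_F _ mPhi Phi0).
apply/funext => z; rewrite integral_Phi muleA -EFinM mulVf ?mul1e//.
by rewrite gt_eqF// Gamma_gt0.
Qed.

Lemma measurable_multi_kernel :
  measurable_fun (@orthant R (n + n)) (fun z => (multi_kernel H z)%:E).
Proof.
have [_ mr] := measurable_restrictT (EFin \o @multi_kernel R H n) (@measurable_orthant (n + n)%N).
exact: mr mMK.
Qed.

(* [Gamma b * A^(-b)] is the integral of [t^(b-1) exp(-t A)] over [t > 0]; by Tonelli the
   orthant integral becomes the n-th power of a double integral over the quadrant, of order
   [t^(-2H)], which cancels all the powers of [t]. *)
Lemma multi_integralE :
  (Gamma (2 * n%:R * H + 1))%:E * multi_integral H n = (Gamma q ^+ n)%:E.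
Proof.
rewrite /multi_integral integral_mkcond -ge0_integralZl; last 4 first.
- exact: measurableT.
- exact: mMK.
- move=> z _; rewrite patchE; case: ifPn => // _; rewrite lee_fin.
  by rewrite mulr_ge0 ?invr_ge0 ?powR_ge0// prodr_ge0// => i _; exact: powR_ge0.
- by rewrite lee_fin Gamma_ge0.
transitivity (\int[lebesgue_tuple R (n + n)]_z \int[mu]_t (EFin \o Phi) (z, t)).
  by apply: eq_integral => z _; rewrite integral_Phi.
rewrite (@fubini_tonelli _ _ _ _ R (lebesgue_tuple R (n + n)) mu _ mPhi Phi0).
transitivity (\int[mu]_(t in `]0%R, +oo[) ((Gamma q ^+ n)%:E * (expR (- (1 * t)))%:E)).
  rewrite [RHS]integral_mkcond; apply: eq_integral => t _; rewrite patchE.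
  rewrite mem_setE in_itv/= andbT; case: ltP => t0; last first.
    apply: integral0_eq => z _ /=.
    by rewrite /Phi/= indicE mem_setE in_itv/= andbT ltNge t0 mulr0 mul0r.
  pose c := (t `^ (b - 1) * expR (- t))%R.
  have mG : measurable_fun [set: (n + n).-tuple mT] (EFin \o G t).
    apply/measurable_EFinP; apply: measurable_prod => i _.
    by apply: mddc; exact: measurable_tnth.
  transitivity (\int[lebesgue_tuple R (n + n)]_z (c%:E * (EFin \o G t) z)).
    apply: eq_integral => z _; rewrite /= /Phi/= indicE mem_setE in_itv/= andbT t0.
    by rewrite mulr1 -EFinM.
  rewrite ge0_integralZl; last 4 first.
  - exact: measurableT.
  - exact: mG.
  - by move=> z _; rewrite lee_fin.
  - by rewrite lee_fin mulr_ge0 ?powR_ge0 ?expR_ge0.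
  rewrite [X in _ * X](integral_prod_damped n t0) -!EFinM; congr EFin.
  have e1 : ((t `^ (- (q + 1))) ^+ n = t `^ (- (q + 1) * n%:R))%R.
    by rewrite powRrM powR_mulrn ?powR_ge0.
  have e2 : (t `^ (b - 1) * t `^ (- (q + 1) * n%:R) = 1)%R.
    rewrite -(powRD_gt0 _ _ t0) (_ : (b - 1 + - (q + 1) * n%:R = 0)%R) ?powRr0//.
    by rewrite /b /q; ring.
  by rewrite /c mul1r exprMn e1 mulrA [X in (X * _)%R]mulrAC e2 mul1r mulrC.
rewrite ge0_integralZl; last 4 first.
- exact: measurable_itv.
- by apply/measurable_EFinP/measurable_funTS; exact: measurable_expRNM.
- by move=> t _; rewrite lee_fin expR_ge0.
- by rewrite lee_fin exprn_ge0// Gamma_ge0.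
by rewrite integral_expRN// mulr0 oppr0 expR0 divr1 mule1.
Qed.

End fixed_dimension.

End multi_integral.

(** * Riemann-Stieltjes integrals of exponentials *)

Section uniform_continuity.
Context {R : realType}.

(** Compactness in its near-covering form. Only [x] is confined to the segment; halving the radius
    of each ball leaves room for [y]. *)
Lemma continuous_segment_unif (g : R -> R) (a b e : R) : continuous g -> 0 < e ->
  exists2 d : R, 0 < d & forall x y, a <= x <= b -> `|x - y| < d -> `|g x - g y| < e.
Proof.
move=> cg e0.
have := @segment_compact R a b; rewrite compact_near_coveringP => /(_ R (0^'+)
  (fun d x => forall y, `|x - y| < d -> `|g x - g y| < e) _) [].
- move=> x _.
  have e2 : 0 < e / 2 by rewrite divr_gt0.
  have /cvgrPdist_lt/(_ _ e2) := cg x; rewrite near_nbhs => -[r /= r0 Hr].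
  have r2 : 0 < r / 2 by rewrite divr_gt0.
  exists (ball x (r / 2), [set d | 0 < d < r / 2]%R).
    split => /=; first exact: nbhsx_ballx.
    near=> d; apply/andP; split; near: d; first exact: nbhs_right_gt.
    exact: nbhs_right_lt.
  move=> [x' d] [/= xx' /andP[d0 dr]] y x'y.
  have h1 : `|g x - g x'| < e / 2.
    by apply: Hr; apply: lt_trans xx' _; rewrite ltr_pdivrMr// ltr_pMr// ltrDl.
  have h2 : `|g x - g y| < e / 2.
    apply: Hr; rewrite /= -(subrKA x') (le_lt_trans (ler_normD _ _))//.
    by rewrite [X in _ < X]splitr ltrD// (lt_trans x'y).
  rewrite -(subrKA (g x)) (le_lt_trans (ler_normD _ _))//.
  by rewrite [X in _ < X]splitr ltrD// distrC.
- move=> d /= d0 H; exists (d / 2); first by rewrite divr_gt0.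
  move=> x y xab xy; apply: (H (d / 2)).
  + by rewrite /= sub0r normrN gtr0_norm ?divr_gt0// ltr_pdivrMr// ltr_pMr// ltrDl.
  + by rewrite divr_gt0.
  + by rewrite /= in_itv.
  + exact: xy.
Unshelve. all: by end_near. Qed.

(** The base point -1 makes the derivative two-sided at 0, the left end of all the stochastic
    integrals. *)
Lemma antiderivative (h : R -> R) : continuous h ->
  exists G : R -> R, forall x : R, -1 < x -> is_derive x 1 G (h x).
Proof.
move=> ch; exists (fun x => \int[lebesgue_measure]_(t in `[-1, x]) h t) => x x1.
have xu : x < x + 1 by rewrite ltrDl.
have ih : lebesgue_measure.-integrable `[-1, x + 1] (EFin \o h).
  apply: continuous_compact_integrable; first exact: segment_compact.
  exact: continuous_subspaceT.
have [d dE] := continuous_FTC1_closed xu ih x1 (ch x).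
apply: DeriveDef; first exact: d.
by rewrite -derive1E.
Qed.

End uniform_continuity.

Section exponential_riemann_stieltjes.
Context {R : realType}.
Variables (theta : R) (g : R -> R).
Hypothesis theta0 : 0 < theta.
Hypothesis cg : {within `[0, +oo[, continuous g}.

Local Notation f := (fun s : R => expR (s / theta)).
Let f' s := expR (s / theta) / theta.

Let df (x : R) : is_derive x 1 f (f' x).
Proof.
by apply: is_derive_eq; rewrite /f' scaler0 add0r /GRing.scale/= mulr1 mulrC.
Qed.

Let cf : continuous f.
Proof.
by move=> x; apply: differentiable_continuous; apply/derivable1_diffP; have [] := df x.
Qed.

Let f'0 x : 0 <= f' x.
Proof. by rewrite divr_ge0 ?expR_ge0// ltW. Qed.

Let f'_le x y : x <= y -> f' x <= f' y.
Proof. by move=> xy; rewrite ler_pM2r ?invr_gt0// ler_expR ler_pM2r ?invr_gt0. Qed.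

Let cf' : continuous f'.
Proof.
move=> x; apply: cvgM; last exact: cvg_cst.
apply: continuous_comp; last exact: continuous_expR.
by apply: cvgM; [exact: cvg_id|exact: cvg_cst].
Qed.

(** The constant extension of [g] to the left of 0, continuous on the whole line. *)
Let ge (s : R) := g (Num.max s 0).

Let geE s : 0 <= s -> ge s = g s.
Proof. by move=> s0; rewrite /ge max_l. Qed.

Let cge : continuous ge.
Proof.
move=> x.
have /subspace_continuousP/(_ (Num.max x 0)) := cg.
rewrite /= in_itv/= le_max lexx orbT andbT => /(_ isT) c.
have cm : continuous (fun s : R => Num.max s 0).
  move=> z; apply: (@continuous_max _ R id (cst 0)); [exact: cvg_id|exact: cst_continuous].
apply/cvgrPdist_lt => e e0; move/cvgrPdist_lt : c => /(_ e e0).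
rewrite near_withinE => c.
have {}c : \forall z \near x, (`[0, +oo[%classic (Num.max z 0) ->
    `|g (Num.max x 0) - g (Num.max z 0)| < e) by exact: (cm x _ c).
apply: filterS c => z; apply.
by rewrite /= in_itv/= le_max lexx orbT.
Qed.

(* integration by parts: [G] will be an antiderivative of [g * f'] *)
Definition parts (G : R -> R) (x : R) : R := f x * g x - G x.

Section with_antiderivative.
Variable G : R -> R.
Hypothesis dG : forall x : R, -1 < x -> is_derive x 1 G (ge x * f' x).

Let cG x : -1 < x -> {for x, continuous G}.
Proof.
by move=> x1; apply: differentiable_continuous; apply/derivable1_diffP; have [] := dG x1.
Qed.

(** On a short cell [g] is close to [g a]. The mean value theorem for [G - g a * f] and the
    monotonicity of [f'] bound two error terms by [e * (f' t * (b - a))] each. The factor [b - a]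
    makes the errors summable although [g] may have unbounded variation. *)
Lemma parts_cell (t a b tau e : R) : 0 <= a -> a <= tau <= b -> b <= t ->
  (forall s, a <= s <= b -> `|g s - g a| <= e) ->
  `|f tau * (g b - g a) - (parts G b - parts G a)| <= 2 * e * (f' t * (b - a)).
Proof.
move=> a0 /andP[at_ tb] bt ge_e.
have ab : a <= b := le_trans at_ tb.
have e0 : 0 <= e by apply: le_trans (ge_e a _); rewrite ?lexx.
have ba0 : 0 <= b - a by rewrite subr_ge0.
have lt1 x : a <= x -> -1 < x by move=> ax; rewrite (lt_le_trans _ (le_trans a0 ax)).
have [c /[!in_itv]/= /andP[ac cb] GE] : exists2 c, c \in `[a, b] &
    (G b - g a * f b) - (G a - g a * f a) = ((g c - g a) * f' c) * (b - a).
  have [||c cab cE] := @MVT_segment R (fun x => G x - g a * f x)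
    (fun x => (ge x - g a) * f' x) a b ab; last first.
  - exists c => //; rewrite cE geE//.
    by move: cab; rewrite in_itv/= => /andP[ac _]; exact: le_trans ac.
  - apply: continuous_in_subspaceT => x /[!inE]/=; rewrite in_itv/= => /andP[ax _].
    apply: cvgB; first exact/cG/lt1.
    apply: cvgM; first exact: cvg_cst.
    exact: cf.
  - move=> x; rewrite in_itv/= => /andP[ax _].
    have := dG (lt1 _ (ltW ax)) => dGx.
    by apply: is_derive_eq; rewrite scaler0 add0r mulrBl /GRing.scale/= mulr1 /f'; ring.
have fE x y : a <= x -> x <= y -> y <= b -> 0 <= f y - f x <= f' t * (b - a).
  move=> ax xy yb; have [||z zxy ->] := @MVT_segment R f f' x y xy.
  - by move=> z _; exact: df.
  - exact: continuous_subspaceT.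
  - move: zxy; rewrite in_itv/= => /andP[xz zy].
    rewrite mulr_ge0 ?subr_ge0//= ler_pM ?subr_ge0 ?lerB//.
    by apply: f'_le; rewrite (le_trans zy)// (le_trans yb).
rewrite /parts.
have -> : f tau * (g b - g a) - (f b * g b - G b - (f a * g a - G a)) =
   (g c - g a) * (f' c * (b - a)) - (f b - f tau) * (g b - g a).
  have -> : (g c - g a) * (f' c * (b - a)) = G b - g a * f b - (G a - g a * f a).
    by rewrite GE mulrA.
  ring.
rewrite (le_trans (ler_normB _ _))// [`|(g c - g a) * _|]normrM [`|(f b - f tau) * _|]normrM.
rewrite (_ : 2 * e * _ = e * (f' t * (b - a)) + (f' t * (b - a)) * e); last by ring.
apply: lerD.
  apply: (ler_pM (normr_ge0 _) (normr_ge0 _)); first by apply: ge_e; rewrite ac.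
  have h : 0 <= f' c * (b - a) by apply: mulr_ge0.
  rewrite (ger0_norm h); apply: ler_wpM2r => //.
  by apply: f'_le; exact: le_trans bt.
have /andP[h1 h2] := fE tau b at_ tb (lexx b).
apply: (ler_pM (normr_ge0 _) (normr_ge0 _)); first by rewrite ger0_norm.
by apply: ge_e; rewrite ab lexx.
Qed.

Lemma parts_is_RS_integral (t : R) : 0 <= t ->
  is_RS_integral f g 0 t (parts G t - parts G 0).
Proof.
move=> t0 e e0.
have M0 : 0 <= 2 * (f' t * t) by apply: mulr_ge0 => //; exact: mulr_ge0.
(* The bound of [parts_cell] summed over all cells is [2 * e' * (f' t * t)]; the added 1 keeps the
   denominator positive when [t = 0]. *)
pose e' := e / (2 * (f' t * t) + 1).
have D0 : 0 < 2 * (f' t * t) + 1 by rewrite ltr_wpDl.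
have e'0 : 0 < e' by rewrite divr_gt0.
have [d d0 Hd] := continuous_segment_unif 0 t cge e'0.
exists d => // s tag [ps /eqP ls] Hs.
pose x i := nth t (0 :: s) i.
have xle i : (i <= size s)%N -> 0 <= x i <= t.
  move=> si; have sx : sorted <=%R (0 :: s).
    by rewrite /=; apply: sub_path ps => ? ?; exact: ltW.
  have xnth j k : (j <= k)%N -> (k <= size s)%N -> x j <= x k.
    move=> jk ks; apply: (sorted_leq_nth le_trans le_refl) => //=; rewrite inE ltnS//.
    exact: leq_trans ks.
  have x0 : x 0%N = 0 by [].
  have xs : x (size s) = t by rewrite /x -[RHS]ls (last_nth t).
  by rewrite -{1}x0 -xs !xnth.
have -> : parts G t - parts G 0 = \sum_(0 <= i < size s) (parts G (x i.+1) - parts G (x i)).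
  rewrite telescope_sumr// /x/= -[in LHS]ls (last_nth t); congr (_ - _).
rewrite /RS_sum -sumrB (le_lt_trans (ler_norm_sum _ _ _))//.
apply: (@le_lt_trans _ _ (\sum_(0 <= i < size s) 2 * e' * (f' t * (x i.+1 - x i)))).
  rewrite big_nat [leRHS]big_nat; apply: ler_sum => i /= si.
  have [Hd1 /andP[Ht1 Ht2]] := Hs i si.
  have /andP[xi0 xit] := xle i (ltnW si).
  have /andP[xi1 xi1t] := xle i.+1 si.
  apply: parts_cell => //; first by rewrite Ht1.
  move=> z /andP[xz zx].
  rewrite -(geE (le_trans xi0 xz)) -(geE xi0) distrC ltW// Hd ?xi0//.
  by rewrite distrC ger0_norm ?subr_ge0// (le_lt_trans _ Hd1)// lerB.
rewrite -!mulr_sumr telescope_sumr// (_ : x (size s) - x 0%N = t); last first.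
  by rewrite /x/= subr0 -[RHS]ls (last_nth t).
rewrite (_ : 2 * e' * (f' t * t) = e' * (2 * (f' t * t))); last by ring.
by rewrite /e' mulrAC ltr_pdivrMr// ltr_pM2l// ltrDl.
Qed.

Definition unif_point (t : R) (N i : nat) : R := t * i%:R / N.+1%:R.

Definition unif_sum (t : R) (N : nat) : R :=
  \sum_(i < N.+1) f (unif_point t N i) * (g (unif_point t N i.+1) - g (unif_point t N i)).

Lemma RS_integral_unif (t I : R) : 0 < t ->
  is_RS_integral f g 0 t I -> unif_sum t N @[N --> \oo] --> I.
Proof.
move=> t0 HI; apply/cvgrPdist_lt => e e0.
have [d d0 Hd] := HI e e0.
near=> N.
have N0 : (0 : R) < N.+1%:R by rewrite ltr0n.
pose s := [seq unif_point t N i.+1 | i <- iota 0 N.+1].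
have ss : size s = N.+1 by rewrite size_map size_iota.
have xE i : (i <= N.+1)%N -> nth t (0 :: s) i = unif_point t N i.
  case: i => [|i] iN /=; first by rewrite /unif_point mulr0 mul0r.
  by rewrite (nth_map 0%N) ?size_iota// nth_iota.
have step i : unif_point t N i.+1 - unif_point t N i = t / N.+1%:R.
  by rewrite /unif_point -mulrBl -mulrBr -natr1 addrAC subrr add0r mulr1.
have itv : itv_partition 0 t s.
  split; last first.
    rewrite (last_nth t) ss xE// /unif_point mulfK// gt_eqF//.
  apply/(pathP t) => i; rewrite ss => iN.
  rewrite (xE i (ltnW iN)) -[nth t s i]/(nth t (0 :: s) i.+1) xE//.
  by rewrite -subr_gt0 step divr_gt0.
have := Hd s (unif_point t N) itv _.
rewrite /RS_sum ss big_mkord distrC => H.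
rewrite /unif_sum (eq_bigr (fun i : 'I_N.+1 => f (unif_point t N i) *
  (g (nth t (0 :: s) i.+1) - g (nth t (0 :: s) i)))); last first.
  by move=> i _; rewrite !xE// ltnW.
apply: H => i iN; rewrite !xE ?(ltnW iN)// step lexx/=; split.
  rewrite ltr_pdivrMr// mulrC -ltr_pdivrMr// (@lt_trans _ _ N%:R) ?ltr_nat//.
  by near: N; exact: nbhs_infty_gtr.
by rewrite -subr_ge0 step divr_ge0// ltW.
Unshelve. all: by end_near. Qed.

(** The value selected by [RS_integral] is unique because the uniform sums converge to every
    candidate. *)
Lemma RS_integralE (t : R) : 0 <= t ->
  RS_integral f g 0 t = parts G t - parts G 0.
Proof.
move=> t0; rewrite /RS_integral; apply: xget_unique; first exact: parts_is_RS_integral.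
move=> I HI; move: t0; rewrite le_eqVlt => /predU1P[t0|t0]; last first.
  have h1 := RS_integral_unif t0 HI.
  have h2 := RS_integral_unif t0 (parts_is_RS_integral (ltW t0)).
  exact: cvg_unique h1 h2.
(* On the degenerate interval the empty partition has sum 0, at distance [|I|] from [I], so a
   nonzero [I] violates the definition with tolerance [|I|]. *)
rewrite -t0 subrr; apply/eqP; rewrite -normr_eq0; apply/negPn/negP => I0.
have e0 : 0 < `|I| by rewrite lt_neqAle eq_sym I0 normr_ge0.
have [d d0 Hd] := HI _ e0.
have := Hd [::] (fun=> 0); rewrite -t0 /RS_sum big_geq// sub0r normrN ltxx => H.
by have : false by apply: H.
Qed.

End with_antiderivative.

Lemma RS_integral_cvg_unif (t : R) : 0 <= t ->
  unif_sum t N @[N --> \oo] --> RS_integral f g 0 t.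
Proof.
have [G dG] : exists G : R -> R, forall x : R, -1 < x -> is_derive x 1 G (ge x * f' x).
  by apply: antiderivative => x; apply: cvgM; [exact: cge|exact: cf'].
move=> t0; rewrite (RS_integralE dG t0).
move: t0; rewrite le_eqVlt => /predU1P[<-|t0].
  rewrite subrr (_ : unif_sum 0 = cst 0); first exact: cvg_cst.
  apply/funext => N; rewrite /unif_sum big1// => i _.
  by rewrite /unif_point !mul0r subrr mulr0.
exact: (RS_integral_unif t0 (parts_is_RS_integral dG (ltW t0))).
Qed.

Lemma RS_integral_cvg (u : nat -> R) (t : R) : 0 <= t -> (forall k, 0 <= u k) ->
  u k @[k --> \oo] --> t -> RS_integral f g 0 (u k) @[k --> \oo] --> RS_integral f g 0 t.
Proof.
move=> t0 u0 ut.
have [G dG] : exists G : R -> R, forall x : R, -1 < x -> is_derive x 1 G (ge x * f' x).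
  by apply: antiderivative => x; apply: cvgM; [exact: cge|exact: cf'].
have cG : {for t, continuous G}.
  apply: differentiable_continuous; apply/derivable1_diffP.
  by have [] := dG t (lt_le_trans (ltrN10 _) t0).
rewrite (RS_integralE dG t0); under eq_fun do rewrite (RS_integralE dG (u0 _)).
apply: cvgB; last exact: cvg_cst.
have h1 : f (u k) @[k --> \oo] --> f t.
  by apply: (@continuous_cvg _ _ _ _ _ u f t) => //; exact: cf.
have h2 : ge (u k) @[k --> \oo] --> ge t.
  by apply: (@continuous_cvg _ _ _ _ _ u ge t) => //; exact: cge.
have h3 : G (u k) @[k --> \oo] --> G t by apply: (@continuous_cvg _ _ _ _ _ u G t).
rewrite /parts; apply: cvgB => //; apply: cvgM => //.
by rewrite -(geE t0); under eq_fun do rewrite -(geE (u0 _)).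
Qed.

End exponential_riemann_stieltjes.

(** * Moments of the fractional Ornstein-Uhlenbeck process *)

Section complete_measurability.
Context d (T : measurableType d) (R : realType) (P : probability T R).
Hypothesis Pc : measure_is_complete P.

Lemma ae_eq_measurable (X Y : T -> R) : {ae P, forall w, X w = Y w} ->
  measurable_fun [set: T] X -> measurable_fun [set: T] Y.
Proof.
move=> XY mX; apply/measurable_EFinP.
apply: (ae_measurable_fun Pc (f := EFin \o X)); last exact/measurable_EFinP.
by apply: filterS XY => w XY _ /=; rewrite XY.
Qed.

(** Multiplication by the indicator of the complement of a measurable null set [N] makes the
    convergence hold everywhere; completeness then transfers measurability to [Y]. *)
Lemma ae_cvg_measurable (X : nat -> T -> R) (Y : T -> R) :
  (forall k, measurable_fun [set: T] (X k)) ->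
  {ae P, forall w, X k w @[k --> \oo] --> Y w} -> measurable_fun [set: T] Y.
Proof.
move=> mX [N [mN N0 XY]].
apply: (@ae_eq_measurable (fun w => Y w * \1_(~` N) w)).
  exists N; split => // w /= h; apply: contrapT => Nw; apply: h.
  by rewrite indicE mem_set ?mulr1.
apply: (measurable_fun_cvg (h := fun k w => X k w * \1_(~` N) w)).
  move=> k; apply: measurable_funM => //.
  by apply: measurable_indic; exact: measurableC.
move=> w _; have [Nw|Nw] := pselect (N w).
  rewrite indicE memNset ?mulr0; last by move=> /(_ Nw).
  by under eq_fun do rewrite mulr0; exact: cvg_cst.
apply: cvgM; last exact: cvg_cst.
by apply: contrapT => h; apply: Nw; exact: XY.
Qed.
End complete_measurability.

Section gaussian_moments.
Context d (T : measurableType d) (R : realType) (P : probability T R).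
Local Notation mu := (@lebesgue_measure R).
Local Open Scope ereal_scope.

(** This amounts to [Gamma (1/2) = sqrt pi], and follows from the total mass of the normal
    density. *)
Lemma gauss_moment0 : gauss_moment R 0 = 1%R.
Proof.
have h := @integral_normal_moment R 1 0 (oner_neq0 _).
rewrite expr0 mulr1 in h; apply: EFin_inj; rewrite -h.
transitivity (\int[mu]_x (normal_pdf 0%R 1%R x : R)%:E); last exact: integral_normal_pdf.
by apply: eq_integral => y _; rewrite expr0 mule1.
Qed.

Lemma gauss_moment1 : gauss_moment R 1 = 1%R.
Proof.
have := gauss_moment0; rewrite /gauss_moment.
have -> : ((2 * 1 + 1)%N%:R / 2 = (2 * 0 + 1)%N%:R / 2 + 1 :> R)%R by field.
rewrite GammaD1; last by rewrite divr_gt0.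
by move=> h; rewrite -[RHS]h; field; rewrite gt_eqF// sqrtr_gt0 pi_gt0.
Qed.

Lemma gauss_moment_ge0 n : (0 <= gauss_moment R n)%R.
Proof. by rewrite divr_ge0 ?sqrtr_ge0// mulr_ge0 ?exprn_ge0// Gamma_ge0. Qed.

Lemma gauss_moment_gt0 n : (0 < gauss_moment R n)%R.
Proof.
rewrite divr_gt0 ?sqrtr_gt0 ?pi_gt0// mulr_gt0 ?exprn_gt0// Gamma_gt0// divr_gt0//.
Qed.

Lemma gaussian_shift (X : T -> R) (m s : R) (f : R -> \bar R) :
  measurable_fun [set: T] X -> s != 0%R ->
  (forall A : set R, measurable A -> P (X @^-1` A) = normal_prob m s A) ->
  measurable_fun [set: R] f -> (forall y, 0 <= f y) ->
  \int[P]_w f (X w) = \int[mu]_y ((normal_pdf 0 s y)%:E * f (y + m)%R).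
Proof.
move=> mX s0 PX mf f0.
have PX' A : measurable A ->
    P (X @^-1` A) = \int[mu]_(y in setT `&` A) (normal_pdf m s y)%:E.
  by move=> mA; rewrite setTI; exact: PX.
have pdf0 x : setT x -> (0 <= normal_pdf m s x)%R by move=> _; exact: normal_pdf_ge0.
have mpdf := @measurable_normal_pdf R m s.
rewrite (ge0_integral_law mX measurableT mpdf pdf0 PX' mf f0).
have mg : measurable_fun [set: R] (fun y => (normal_pdf m s y)%:E * f y).
  by apply: emeasurable_funM => //; apply/measurable_EFinP; exact: measurable_normal_pdf.
have g0 y : 0 <= (normal_pdf m s y)%:E * f y.
  by rewrite mule_ge0// lee_fin normal_pdf_ge0.
have := @ge0_integral_affine R 1 m _ (oner_neq0 _) mg g0.
rewrite normr1 invr1 mul1e => <-; apply: eq_integral => y _.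
by rewrite mul1r !normal_pdfE//= /normal_fun addrK subr0.
Qed.

(** [gaussian_rv] leaves the parameters of the law unspecified, so they are identified first:
    [m = 0] from the vanishing expectation and [s^2 = v] from the second moment. The point mass
    [s = 0] is a separate case. *)
Lemma gaussian_even_moment (X : T -> R) (v : R) (n : nat) :
  gaussian_rv P X -> \int[P]_w (X w)%:E = 0 -> \int[P]_w (X w ^+ 2)%:E = v%:E ->
  \int[P]_w (`|X w| ^+ (2 * n))%:E = (gauss_moment R n * v ^+ n)%:E.
Proof.
move=> [mX [m [s PX]]] EX EX2.
have XE w : (`|X w| ^+ (2 * n) = X w ^+ (2 * n))%R.
  by rewrite -normrX ger0_norm// exprM exprn_ge0// sqr_ge0.
under eq_integral do rewrite XE.
have [s0|s0] := eqVneq s 0%R.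
  have Xm : {ae P, forall w, X w = m}.
    exists (X @^-1` (~` [set m])); split => //.
      by rewrite -[X in measurable X]setTI; apply: mX => //; exact: measurableC.
    rewrite PX; last exact: measurableC.
    by rewrite s0 eqxx diracE memNset//= => /(_ erefl).
  have Xf (f : R -> R) : measurable_fun [set: R] f ->
      \int[P]_w (f (X w))%:E = (f m)%:E.
    move=> mf; rewrite (ae_eq_integral (cst (f m)%:E))//.
    - by rewrite integral_cst//= [P _]probability_setT mule1.
    - by apply/measurable_EFinP; exact: measurableT_comp.
    - by apply: filterS Xm => w -> _.
  have m0 : m = 0%R.
    apply: EFin_inj; transitivity (\int[P]_w (X w)%:E); last exact: EX.
    by apply/esym/(Xf id).
  have v0 : v = 0%R.
    have mf : measurable_fun [set: R] (fun x : R => x ^+ 2)%R by exact: measurable_funX.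
    by apply: EFin_inj; rewrite -EX2 (Xf _ mf) m0 expr0n.
  have mf : measurable_fun [set: R] (fun x : R => x ^+ (2 * n))%R by exact: measurable_funX.
  rewrite v0 (Xf _ mf).
  rewrite m0 !expr0n muln_eq0/=; case: (n) => [|k] /=; first by rewrite gauss_moment0 mulr1.
  by rewrite mulr0.
have {}PX A : measurable A -> P (X @^-1` A) = normal_prob m s A.
  by move=> mA; rewrite PX// (negbTE s0).
have sh f := @gaussian_shift X m s f mX s0 PX.
(* By symmetry of the centred density, the positive and negative parts of [X - m] have the same mean
   [a]. Once [a] is finite this forces the expectation of [X] to be [m]. *)
pose pos (y : R) := Num.max y 0%R.
have mpos : measurable_fun [set: R] pos by exact: measurable_maxr.
have pos0 y : (0 <= pos y)%R by rewrite /pos le_max lexx orbT.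
pose a := \int[mu]_y ((normal_pdf 0 s y)%:E * (pos y)%:E).
have mpdf : measurable_fun [set: R] (fun y => (normal_pdf 0 s y)%:E).
  by apply/measurable_EFinP; exact: measurable_normal_pdf.
have pdf0 y : 0 <= (normal_pdf 0 s y)%:E by rewrite lee_fin normal_pdf_ge0.
have E1 : \int[P]_w (pos (X w - m))%:E = a.
  rewrite (sh (fun x => (pos (x - m))%:E)).
  - by apply: eq_integral => y _; rewrite addrK.
  - by apply/measurable_EFinP; apply: measurableT_comp => //; exact: measurable_funB.
  - by move=> y; rewrite lee_fin.
have E2 : \int[P]_w (pos (m - X w))%:E = a.
  rewrite (sh (fun x => (pos (m - x))%:E)); last 2 first.
  - by apply/measurable_EFinP; apply: measurableT_comp => //; exact: measurable_funB.
  - by move=> y; rewrite lee_fin.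
  have mg : measurable_fun [set: R] (fun y => (normal_pdf 0 s y)%:E * (pos y)%:E).
    by apply: emeasurable_funM => //; exact/measurable_EFinP.
  have := @ge0_integral_affine R (-1) 0 _ _ mg _.
  rewrite /a oppr_eq0 oner_neq0 normrN1 invr1 mul1e => /(_ isT) <-.
    apply: eq_integral => y _; rewrite addr0 mulN1r !normal_pdfE//= /normal_fun !subr0 sqrrN.
    by congr (_ * (pos _)%:E); ring.
  by move=> y; rewrite mule_ge0 ?pdf0 ?lee_fin ?pos0.
have afin : a \is a fin_num.
  rewrite ge0_fin_numE; last by apply: integral_ge0 => y _; rewrite mule_ge0 ?pdf0 ?lee_fin ?pos0.
  (* [max y 0 <= 1 + y^2], and both terms on the right have known Gaussian integrals. *)
  apply: (@le_lt_trans _ _ (\int[mu]_y ((normal_pdf 0 s y)%:E * (y ^+ (2 * 0))%:E +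
    (normal_pdf 0 s y)%:E * (y ^+ (2 * 1))%:E))).
    apply: ge0_le_integral => //.
    - by move=> y _; rewrite mule_ge0 ?pdf0 ?lee_fin ?pos0.
    - by apply: emeasurable_funM => //; exact/measurable_EFinP.
    - by apply: emeasurable_funD; apply: emeasurable_funM => //; apply/measurable_EFinP; exact: measurable_funX.
    - move=> y _; rewrite -!EFinM -EFinD lee_fin -mulrDr ler_wpM2l ?normal_pdf_ge0//.
      rewrite muln0 muln1 expr0 /pos ge_max addr_ge0 ?sqr_ge0// andbT.
      have := sqr_ge0 (y - 2^-1)%R; rewrite -subr_ge0 => h.
      rewrite -subr_ge0 (_ : _ - _ = (y - 2^-1) ^+ 2 + 3 / 4)%R; last by field.
      by rewrite addr_ge0 ?sqr_ge0.
  rewrite ge0_integralD//.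
  - by rewrite !integral_normal_moment// -EFinD ltry.
  - by move=> y _; rewrite mule_ge0// lee_fin.
  - by apply: emeasurable_funM => //; apply/measurable_EFinP; exact: measurable_funX.
  - by move=> y _; rewrite mule_ge0// lee_fin sqr_ge0.
  - by apply: emeasurable_funM => //; apply/measurable_EFinP; exact: measurable_funX.
have mX1 : measurable_fun [set: T] (fun w => pos (X w - m)%R).
  by apply: measurableT_comp => //; exact: measurable_funB.
have mX2 : measurable_fun [set: T] (fun w => pos (m - X w)%R).
  by apply: measurableT_comp => //; exact: measurable_funB.
have I1 : P.-integrable setT (fun w => (pos (X w - m)%R)%:E).
  apply/integrableP; split; first exact/measurable_EFinP.
  under eq_integral do rewrite gee0_abs ?lee_fin//.
  by rewrite E1 -ge0_fin_numE// integral_ge0// => y _; rewrite mule_ge0 ?pdf0 ?lee_fin ?pos0.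
have I2 : P.-integrable setT (fun w => (pos (m - X w)%R)%:E).
  apply/integrableP; split; first exact/measurable_EFinP.
  under eq_integral do rewrite gee0_abs ?lee_fin//.
  by rewrite E2 -ge0_fin_numE// integral_ge0// => y _; rewrite mule_ge0 ?pdf0 ?lee_fin ?pos0.
have m0 : m = 0%R.
  apply: EFin_inj; transitivity (\int[P]_w (X w)%:E); last exact: EX.
  apply/esym; transitivity (\int[P]_w (cst m%:E w + ((pos (X w - m))%:E - (pos (m - X w))%:E))); last first.
    rewrite integralD//; last 2 first.
    - exact: finite_measure_integrable_cst.
    - exact: integrableB.
    rewrite integralB// E1 E2 subee// adde0 integral_cst//= [P _]probability_setT mule1//.
  apply: eq_integral => w _; rewrite -EFinB -EFinD; congr EFin; rewrite /pos.
  by case: (leP (X w - m)%R 0%R); case: (leP (m - X w)%R 0%R) => ? ?; lra.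
have sv : (s ^+ 2 = v)%R.
  apply: EFin_inj; rewrite -EX2 (sh (fun x => (x ^+ 2)%:E)).
  - transitivity (\int[mu]_y ((normal_pdf 0%R s y : R)%:E * (y ^+ (2 * 1))%:E)).
      by rewrite (integral_normal_moment 1)// gauss_moment1 mul1r expr1.
    by apply: eq_integral => y _; rewrite m0 addr0.
  - by apply/measurable_EFinP; exact: measurable_funX.
  - by move=> y; rewrite lee_fin sqr_ge0.
rewrite (sh (fun x => (x ^+ (2 * n))%:E)).
- transitivity (\int[mu]_y ((normal_pdf 0%R s y : R)%:E * (y ^+ (2 * n))%:E)).
    by apply: eq_integral => y _; rewrite m0 addr0.
  by rewrite integral_normal_moment// sv.
- by apply/measurable_EFinP; exact: measurable_funX.
- by move=> y; rewrite lee_fin exprM exprn_ge0// sqr_ge0.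
Qed.

End gaussian_moments.

(** * The variance as a limit over uniform grids *)

Section grid.
Context {R : realType}.
Local Notation mu := (@lebesgue_measure R).
Local Notation RR := (measurableTypeR R * measurableTypeR R)%type.
Local Open Scope ereal_scope.

Lemma integral_grid M (c : 'I_M -> set R) (F : RR -> \bar R) :
  (forall i, measurable (c i)) -> trivIset setT c ->
  measurable_fun [set: RR] F -> (forall z, 0 <= F z) ->
  \int[mu \x mu]_(z in (\big[setU/set0]_(i < M) c i) `*` (\big[setU/set0]_(i < M) c i)) F z =
  \sum_(i < M) \sum_(j < M) \int[mu \x mu]_(z in c i `*` c j) F z.
Proof.
move=> mc tc mF F0.
pose D : set R := \big[setU/set0]_(i < M) c i.
have mD : measurable (D : set (measurableTypeR R)) by apply: bigsetU_measurable => i _; exact: mc.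
have uM : uniq (index_enum 'I_M) := index_enum_uniq _.
have tM : trivIset [set` index_enum 'I_M] c by apply: sub_trivIset tc.
have bU (f : measurableTypeR R -> \bar R) : measurable_fun [set: measurableTypeR R] f ->
    (forall x, 0 <= f x) -> \int[mu]_(x in D) f x = \sum_(i < M) \int[mu]_(x in c i) f x.
  move=> mf f0; apply: (@ge0_integral_bigsetU _ (measurableTypeR R) R mu _ c f _ mc uM tM) => //.
  exact: measurable_funTS.
rewrite (@fubini_rectangle1 _ _ _ _ R mu mu D D F mD mD mF F0).
have mI A : measurable A -> measurable_fun [set: measurableTypeR R] (fun x => \int[mu]_(y in A) F (x, y)).
  move=> mA; exact: (@measurable_fubini_rectangle _ _ _ _ R mu A F mA mF F0).
have I0 A x : 0 <= \int[mu]_(y in A) F (x, y) by apply: integral_ge0.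
rewrite bU//; last exact: mI.
apply: eq_bigr => i _.
transitivity (\int[mu]_(x in c i) \sum_(j < M) \int[mu]_(y in c j) F (x, y)).
  apply: eq_integral => x _; apply: bU => //.
  by apply: (measurableT_comp mF); exact: measurable_pair1.
rewrite ge0_integral_sum; [|exact: mc|by move=> j; apply: measurable_funTS; exact: mI (mc j)
    |by move=> j x _; exact: I0].
  apply: eq_bigr => j _.
  by rewrite (@fubini_rectangle1 _ _ _ _ R mu mu (c i) (c j) F (mc i) (mc j) mF F0).
Qed.

End grid.

Section variance_limit.
Context {R : realType}.
Variables (q theta : R).
Hypothesis q0 : 0 < q.
Hypothesis theta0 : 0 < theta.
Local Notation mu := (@lebesgue_measure R).
Local Notation RR := (measurableTypeR R * measurableTypeR R)%type.

(** The variance formula after scaling both integration variables by [theta], which absorbs the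
    power of [theta]; for [q = 2H - 1] the constant is [H (2H - 1)]. *)
Definition V2 (t : R) : R :=
  q * (q + 1) / 2 * fine (damped_int q theta^-1 `]0%R, t]).

(* the variance of the Riemann-Stieltjes sum [expR (- (t / theta)) * unif_sum t N] *)
Definition unif_var (t : R) (N : nat) : R :=
  \sum_(i < N.+1) \sum_(j < N.+1)
    expR ((unif_point t N i - t) / theta) * expR ((unif_point t N j - t) / theta) *
    inc_cov q (unif_point t N i) (unif_point t N i.+1) (unif_point t N j) (unif_point t N j.+1).

Let c0 : 0 < q * (q + 1) / 2.
Proof. by rewrite divr_gt0 ?mulr_gt0 ?addr_gt0. Qed.

Let dfin (t : R) : damped_int q theta^-1 `]0%R, t] \is a fin_num.
Proof. by apply: damped_int_fin; rewrite ?invr_gt0//; exact: subset_itvl. Qed.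

Lemma V2_ge0 t : 0 <= V2 t.
Proof.
apply: mulr_ge0; first exact: ltW.
by apply/fine_ge0/integral_ge0 => z _; rewrite lee_fin; exact: damped_ge0.
Qed.

Lemma V2_lt (s t : R) : 0 <= s < t -> V2 s < V2 t.
Proof.
move=> st; rewrite /V2 ltr_pM2l// fine_lt//.
by apply: lt_damped_int; rewrite ?invr_gt0.
Qed.

Lemma V2_le (s t : R) : 0 <= s <= t -> V2 s <= V2 t.
Proof.
move=> /andP[s0]; rewrite le_eqVlt => /predU1P[->//|st].
by apply/ltW/V2_lt; rewrite s0.
Qed.

Definition V2lim : R := q * (q + 1) / 2 * (theta `^ (q + 1) * Gamma q).

Lemma V2lim_damped :
  (V2lim%:E = (q * (q + 1) / 2)%:E * damped_int q theta^-1 `]0%R, +oo[)%E.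
Proof.
rewrite damped_int_total ?invr_gt0// /V2lim -EFinM.
by rewrite -(powR_inv1 (ltW theta0)) -powRrM mulrNN mul1r.
Qed.

Lemma V2_le_lim t : V2 t <= V2lim.
Proof.
rewrite -lee_fin V2lim_damped /V2 EFinM fineK// lee_wpmul2l//.
  by rewrite lee_fin ltW.
by apply: le_damped_int => //; exact: subset_itvl.
Qed.

Lemma V2_cvg : V2 n%:R @[n --> \oo] --> V2lim.
Proof.
apply: cvgM; first exact: cvg_cst.
have := @damped_int_cvg R q theta^-1.
rewrite damped_int_total ?invr_gt0// => h.
have e : theta^-1 `^ (- (q + 1)) = theta `^ (q + 1).
  by rewrite -(powR_inv1 (ltW theta0)) -powRrM mulrNN mul1r.
by rewrite e in h; move/fine_cvg : h; apply.
Qed.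

Lemma V2lim_ge0 : 0 <= V2lim.
Proof. exact: le_trans (V2_ge0 0) (V2_le_lim 0). Qed.

(** Two cells of a grid are disjoint, in one order or the other, or equal: these are the three
    cases. *)
Lemma inc_covE (a b c d : R) : a <= b -> c <= d -> [|| (b <= c), (d <= a) | (a == c) && (b == d)] ->
  ((inc_cov q a b c d)%:E = (q * (q + 1) / 2)%:E * kernel_int q `]a, b] `]c, d])%E.
Proof.
move=> ab cd.
have E (x : R) : (x%:E = (q * (q + 1) / 2)%:E * (x * 2 / (q * (q + 1)))%:E)%E.
  by rewrite -EFinM; congr EFin; field; rewrite !gt_eqF ?addr_gt0.
case/or3P => [bc|da|/andP[/eqP -> /eqP ->]].
- by rewrite kernel_int_lt// ab.
- rewrite kernel_intC// kernel_int_lt//; last by rewrite cd.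
  rewrite [LHS]E; congr (_ * (_ * _ / _)%:E)%E.
  rewrite /inc_cov (distrC b c) (distrC a d) (distrC b d) (distrC a c); ring.
- by rewrite kernel_int_diag// -?ab.
Qed.

Let up : R -> nat -> nat -> R := @unif_point R.

Let up_mono t N i j : 0 <= t -> (i <= j)%N -> up t N i <= up t N j.
Proof. by move=> t0 ij; rewrite /up /unif_point ler_pM2r ?invr_gt0// ler_wpM2l// ler_nat. Qed.

Let cell t N (i : 'I_N.+1) : set R := `]up t N i, up t N i.+1]%classic.

Let cells t N : 0 <= t -> \big[setU/set0]_(i < N.+1) cell t i = `]0%R, t]%classic.
Proof.
move=> t0.
have H M : \big[setU/set0]_(i < M) `]up t N i, up t N i.+1]%classic = `]0, up t N M]%classic.
  elim: M => [|M IH].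
    by rewrite big_ord0 /up /unif_point mulr0 mul0r set_itvoc0.
  rewrite big_ord_recr/= IH -itv_bndbnd_setU// bnd_simp.
    by rewrite divr_ge0// mulr_ge0.
  exact: up_mono.
by rewrite H /up /unif_point mulfK// gt_eqF.
Qed.

Let trivcell t N : 0 <= t -> trivIset setT (@cell t N).
Proof.
move=> t0; apply/trivIsetP => i j _ _ ij.
wlog lt_ij : i j ij / (i < j)%N.
  move=> h; have [lij|lji|/val_inj eij] := ltngtP i j; first exact: h.
    by rewrite setIC; apply: h => //; rewrite eq_sym.
  by rewrite eij eqxx in ij.
apply/seteqP; split => // x []; rewrite /cell/= !in_itv/= => /andP[_ xi] /andP[jx _].
have := lt_le_trans jx xi; rewrite ltNge => /negP; apply.
exact: up_mono.
Qed.

(** On a cell of length [t / (N+1)] the left value of [exp((x - t) / theta)] falls short by a factor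
    of at most [exp(t / (N+1) / theta)], which appears squared here. The first inequality also
    serves as the uniform bound on the moments of the sums. *)
Lemma unif_var_bounds (t : R) (N : nat) : 0 <= t ->
  unif_var t N <= V2 t <= expR (2 * t / N.+1%:R / theta) * unif_var t N.
Proof.
move=> t0.
pose e x := expR ((x - t) / theta).
have e0 x : 0 <= e x by exact: expR_ge0.
have me : measurable_fun [set: R] e.
  apply: measurableT_comp => //; apply: measurable_funM => //.
  exact: measurable_funB.
pose F (z : RR) := (e z.1 * e z.2 * kernel q z)%:E.
have F0 z : (0 <= F z)%E by rewrite lee_fin !mulr_ge0 ?kernel_ge0.
have mF : measurable_fun [set: RR] F.
  apply/measurable_EFinP; apply: measurable_funM; last exact: measurable_kernel.
  by apply: measurable_funM; apply: (measurable_compR me).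
have mk : measurable_fun [set: RR] (EFin \o kernel q).
  by apply/measurable_EFinP; exact: measurable_kernel.
have k0 z : (0 <= (EFin \o kernel q) z)%E by rewrite lee_fin kernel_ge0.
(* Time reversal [x -> t - x] in both variables turns the weights of the stochastic integral into
   [exp(- x / theta)]. *)
have FW : (\int[mu \x mu]_(z in `]0%R, t]%classic `*` `]0%R, t]%classic) F z =
    damped_int q theta^-1 `]0%R, t])%E.
  rewrite (@fubini_rectangle1 _ _ _ _ R mu mu _ _ F (measurable_itv _) (measurable_itv _) mF F0).
  have mg x : measurable_fun [set: R] (fun y => F (x, y)).
    by apply: (measurableT_comp mF); exact: measurable_pair1.
  have mG : measurable_fun [set: R] (fun x => \int[mu]_(y in `]0%R, t]) F (x, y))%E.
    exact: (@measurable_fubini_rectangle _ _ _ _ R mu _ F (measurable_itv _) mF F0).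
  rewrite (integral_reflect _ _ t mG); last by move=> x; exact: integral_ge0.
  rewrite subrr subr0 (damped_intE _ _ (measurable_itv _)).
  apply: eq_integral => x _.
  rewrite (integral_reflect _ _ t (mg (t - x))); last by move=> y; exact: F0.
  rewrite subrr subr0; apply: eq_integral => y _.
  rewrite /F /e /damped /= -expRD mulrC; congr (_ * expR _)%:E; last first.
    by field; rewrite gt_eqF.
  by rewrite /kernel/= distrC; congr (`|_| `^ _); ring.
have V2E : ((V2 t)%:E = (q * (q + 1) / 2)%:E *
    \int[mu \x mu]_(z in `]0%R, t]%classic `*` `]0%R, t]%classic) F z)%E.
  by rewrite FW /V2 EFinM fineK.
have grid : (\int[mu \x mu]_(z in `]0%R, t]%classic `*` `]0%R, t]%classic) F z =
    \sum_(i < N.+1) \sum_(j < N.+1) \int[mu \x mu]_(z in cell t i `*` cell t j) F z)%E.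
  rewrite -(cells N t0); apply: integral_grid => //; last exact: trivcell.
  by move=> i; exact: measurable_itv.
have step i : up t N i.+1 = up t N i + t / N.+1%:R.
  by rewrite /up /unif_point -mulrDl -natr1 mulrDr mulr1.
have rho1 : 0 <= t / N.+1%:R by rewrite divr_ge0.
have ecell (i : 'I_N.+1) x : cell t i x -> e (up t N i) <= e x <= expR (t / N.+1%:R / theta) * e (up t N i).
  rewrite /cell/= in_itv/= => /andP[h1 h2]; rewrite /e -expRD !ler_expR.
  rewrite ler_pM2r ?invr_gt0// lerB ?(ltW h1)//= -mulrDl ler_pM2r ?invr_gt0//.
  by rewrite addrA lerB// addrC -step.
have covE (i j : 'I_N.+1) :
    ((inc_cov q (up t N i) (up t N i.+1) (up t N j) (up t N j.+1))%:E =
      (q * (q + 1) / 2)%:E * kernel_int q (cell t i) (cell t j))%E.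
  apply: inc_covE; [exact: up_mono|exact: up_mono|].
  have [ij|ji|/val_inj ->] := ltngtP i j.
  - by rewrite (up_mono _ t0 ij).
  - by rewrite (up_mono _ t0 ji) orbT.
  - by rewrite !eqxx !orbT.
have mc (i : 'I_N.+1) : measurable (cell t i : set (measurableTypeR R)) by exact: measurable_itv.
have cell_int (i j : 'I_N.+1) (a : R) : 0 <= a ->
    (\int[mu \x mu]_(z in cell t i `*` cell t j) (a%:E * (EFin \o kernel q) z) =
     a%:E * kernel_int q (cell t i) (cell t j))%E.
  move=> a0; rewrite ge0_integralZl//.
  - exact: measurableX.
  - exact: measurable_funTS.
have varE (a : R) : 0 <= a -> ((a * unif_var t N)%:E = (q * (q + 1) / 2)%:E *
  \sum_(i < N.+1) \sum_(j < N.+1) \int[mu \x mu]_(z in cell t i `*` cell t j)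
    ((a * (e (up t N i) * e (up t N j)))%:E * (EFin \o kernel q) z))%E.
  move=> a0; rewrite ge0_sume_distrr; last first.
    by move=> i _; apply: sume_ge0 => j _; apply: integral_ge0 => z _; rewrite mule_ge0// lee_fin !mulr_ge0.
  rewrite /unif_var mulr_sumr -sumEFin; apply: eq_bigr => i _.
  rewrite ge0_sume_distrr; last first.
    by move=> j _; apply: integral_ge0 => z _; rewrite mule_ge0// lee_fin !mulr_ge0.
  rewrite mulr_sumr -sumEFin; apply: eq_bigr => j _.
  by rewrite cell_int ?mulr_ge0// muleCA -covE -EFinM mulrA.
have le_cell (i j : 'I_N.+1) (f1 f2 : RR -> \bar R) : measurable_fun [set: RR] f1 ->
  measurable_fun [set: RR] f2 -> (forall z, 0 <= f1 z)%E ->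
  (forall z, (cell t i `*` cell t j) z -> f1 z <= f2 z)%E ->
  (\int[mu \x mu]_(z in cell t i `*` cell t j) f1 z <=
   \int[mu \x mu]_(z in cell t i `*` cell t j) f2 z)%E.
  move=> m1 m2 p1 f12; apply: ge0_le_integral => //.
  - exact: measurableX.
  - exact: measurable_funTS.
  - exact: measurable_funTS.
have mak (a : R) : measurable_fun [set: RR] (fun z => a%:E * (EFin \o kernel q) z)%E.
  by apply: emeasurable_funM.
have ak0 (a : R) z : 0 <= a -> (0 <= a%:E * (EFin \o kernel q) z)%E.
  by move=> a0; rewrite mule_ge0.
apply/andP; split.
  rewrite -[leLHS]mul1r -lee_fin (varE 1 ler01) V2E lee_wpmul2l//.
    by rewrite lee_fin ltW.
  rewrite grid; apply: lee_sum => i _; apply: lee_sum => j _.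
  apply: le_cell => //; first by move=> z; apply: ak0; rewrite !mulr_ge0.
  move=> [x y] [/= /ecell/andP[h1 _] /ecell/andP[h2 _]].
  by rewrite -EFinM lee_fin mul1r ler_wpM2r ?kernel_ge0// ler_pM.
rewrite -lee_fin varE ?expR_ge0// V2E lee_wpmul2l//.
  by rewrite lee_fin ltW.
rewrite grid; apply: lee_sum => i _; apply: lee_sum => j _.
apply: le_cell => // -[x y] [/= /ecell/andP[_ h1] /ecell/andP[_ h2]].
rewrite -EFinM lee_fin ler_wpM2r ?kernel_ge0//.
rewrite (le_trans (ler_pM (e0 _) (e0 _) h1 h2))//.
rewrite mulrACA -expRD le_eqVlt; apply/orP; left; apply/eqP; congr (expR _ * _).
by field; rewrite !gt_eqF.
Qed.

Lemma unif_var_cvg (t : R) : 0 <= t -> unif_var t N @[N --> \oo] --> V2 t.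
Proof.
move=> t0.
have rho : expR (- (2 * t / theta * N.+1%:R^-1)) * V2 t @[N --> \oo] --> V2 t.
  have c : - (2 * t / theta * N.+1%:R^-1) @[N --> \oo] --> (0 : R).
    rewrite -oppr0; apply: cvgN; rewrite -(mulr0 (2 * t / theta)).
    by apply: cvgM; [exact: cvg_cst|exact: cvg_harmonic].
  have c' : expR (- (2 * t / theta * N.+1%:R^-1)) @[N --> \oo] --> expR (0 : R).
    by apply: continuous_cvg c; exact: continuous_expR.
  rewrite expR0 in c'.
  by rewrite -[X in _ --> X]mul1r; apply: cvgM c' _; exact: cvg_cst.
apply: (squeeze_cvgr _ rho (cvg_cst _)).
apply: nearW => N; have /andP[h1 h2] := unif_var_bounds N t0.
rewrite h1 andbT mulrC -ler_pdivlMr ?expR_gt0// -expRN opprK mulrC.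
rewrite (le_trans h2)// le_eqVlt; apply/orP; left; apply/eqP; congr (expR _ * _).
by field; rewrite !gt_eqF.
Qed.

End variance_limit.

Section linear_combinations.
Context d (T : measurableType d) (R : realType) (P : probability T R).
Local Open Scope ereal_scope.

Lemma integrable_mul (X Y : T -> R) :
  measurable_fun [set: T] X -> measurable_fun [set: T] Y ->
  P.-integrable setT (fun w => (X w ^+ 2)%:E) ->
  P.-integrable setT (fun w => (Y w ^+ 2)%:E) ->
  P.-integrable setT (fun w => (X w * Y w)%:E).
Proof.
move=> mX mY IX IY.
apply: (@le_integrable _ _ _ P setT measurableT _ (fun w => (X w ^+ 2)%:E + (Y w ^+ 2)%:E)).
- by apply/measurable_EFinP; exact: measurable_funM.
- move=> w _; rewrite -EFinD !abse_EFin lee_fin [leRHS]ger0_norm ?addr_ge0 ?sqr_ge0//.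
  rewrite normrM -(real_normK (num_real (X w))) -(real_normK (num_real (Y w))).
  have := sqr_ge0 (`|X w| - `|Y w|)%R; have : (0 <= `|X w| * `|Y w|)%R by rewrite mulr_ge0.
  rewrite sqrrB; move: (`|X w|)%R (`|Y w|)%R => x y h1 h2.
  rewrite -subr_ge0 (_ : _ - _ = (x ^+ 2 - x * y *+ 2 + y ^+ 2) + x * y)%R; last by ring.
  exact: addr_ge0.
- exact: integrableD.
Qed.

Lemma integrable_of_sqr (X : T -> R) :
  measurable_fun [set: T] X ->
  P.-integrable setT (fun w => (X w ^+ 2)%:E) -> P.-integrable setT (fun w => (X w)%:E).
Proof.
move=> mX IX.
have I1 : P.-integrable setT (fun w => ((cst 1%R : T -> R) w ^+ 2)%:E).
  by under eq_fun do rewrite expr1n; exact: (finite_measure_integrable_cst P 1%R).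
have m1 : measurable_fun [set: T] (cst 1%R : T -> R) by [].
by have := integrable_mul mX m1 IX I1; under eq_fun do rewrite mulr1.
Qed.

Lemma moments_lincomb M (a : 'I_M -> R) (Y : 'I_M -> T -> R) (r : 'I_M -> 'I_M -> R) :
  (forall i, P.-integrable setT (fun w => (Y i w)%:E)) ->
  (forall i, \int[P]_w (Y i w)%:E = 0) ->
  (forall i j, P.-integrable setT (fun w => (Y i w * Y j w)%:E)) ->
  (forall i j, \int[P]_w (Y i w * Y j w)%:E = (r i j)%:E) ->
  \int[P]_w (\sum_(i < M) a i * Y i w)%:E = 0 /\
  \int[P]_w ((\sum_(i < M) a i * Y i w) ^+ 2)%:E =
    (\sum_(i < M) \sum_(j < M) a i * a j * r i j)%:E.
Proof.
move=> I1 E1 I2 E2; split.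
- transitivity (\int[P]_w \sum_(i < M) ((a i)%:E * (Y i w)%:E)).
    by apply: eq_integral => w _; rewrite -sumEFin; apply: eq_bigr => i _; rewrite EFinM.
  rewrite integral_sum//; last by move=> i; exact: integrableZl.
  by rewrite big1// => i _; rewrite integralZl// E1 mule0.
- transitivity (\int[P]_w \sum_(i < M) \sum_(j < M) ((a i * a j)%:E * (Y i w * Y j w)%:E)).
    apply: eq_integral => w _; rewrite expr2 mulr_suml -sumEFin; apply: eq_bigr => i _.
    rewrite mulr_sumr -sumEFin; apply: eq_bigr => j _.
    by rewrite -EFinM mulrACA.
  have IS i : P.-integrable setT (fun w => \sum_(j < M) ((a i * a j)%:E * (Y i w * Y j w)%:E)).
    by apply: integrable_sum => // j _; exact: integrableZl.
  rewrite integral_sum// -sumEFin; apply: eq_bigr => i _.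
  rewrite integral_sum//; last by move=> j; exact: integrableZl.
  by rewrite -sumEFin; apply: eq_bigr => j _; rewrite integralZl// E2 -EFinM.
Qed.

End linear_combinations.

Section fou_moments.
Context d (T : measurableType d) (R : realType) (P : probability T R).
Variables (H theta : R) (B : R -> T -> R).
Hypothesis H1 : 2^-1 < H < 1.
Hypothesis theta0 : 0 < theta.
Hypothesis Pc : measure_is_complete P.
Hypothesis BH : fBm P H B.
Let q := 2 * H - 1.
Let q0 : 0 < q. Proof. by rewrite /q; move/andP: H1 => [? ?]; lra. Qed.
Let q2 : q + 1 = 2 * H. Proof. by rewrite /q; ring. Qed.

Let mB t : 0 <= t -> measurable_fun [set: T] (B t).
Proof.
move=> t0.
have [m _] := fBm_gaussian BH (fun=> 1) (fun _ : 'I_1 => t0).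
by move: m; under eq_fun do rewrite big_ord1 mul1r.
Qed.

Let cov t s := 2^-1 * (t `^ (q + 1) + s `^ (q + 1) - `|t - s| `^ (q + 1)).

Let EBB t s : 0 <= t -> 0 <= s -> (\int[P]_w (B t w * B s w)%:E = (cov t s)%:E)%E.
Proof. by move=> t0 s0; rewrite /cov q2 -(fBm_cov BH t0 s0) unlock. Qed.

Let IB2 t : 0 <= t -> P.-integrable setT (fun w => (B t w ^+ 2)%:E).
Proof.
move=> t0; apply/integrableP; split.
  by apply/measurable_EFinP; apply: measurable_funX; exact: mB.
rewrite (_ : (\int[P]_w _)%E = (\int[P]_w (B t w * B t w)%:E)%E); first by rewrite EBB// ltry.
by apply: eq_integral => w _; rewrite gee0_abs ?lee_fin ?sqr_ge0// expr2.
Qed.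

Let IB t : 0 <= t -> P.-integrable setT (fun w => (B t w)%:E).
Proof. by move=> t0; apply: integrable_of_sqr; [exact: mB|exact: IB2]. Qed.

Let IBB t s : 0 <= t -> 0 <= s -> P.-integrable setT (fun w => (B t w * B s w)%:E).
Proof. by move=> t0 s0; apply: integrable_mul; [exact: mB|exact: mB|exact: IB2|exact: IB2]. Qed.

Let inc a b w := B b w - B a w.

Let Iinc a b : 0 <= a -> 0 <= b -> P.-integrable setT (fun w => (inc a b w)%:E).
Proof. by move=> a0 b0; under eq_fun do rewrite /inc EFinB; apply: integrableB => //; exact: IB. Qed.

Let Einc a b : 0 <= a -> 0 <= b -> (\int[P]_w (inc a b w)%:E = 0)%E.
Proof.
move=> a0 b0; under eq_integral do rewrite /inc EFinB.
rewrite integralB//; [|exact: IB|exact: IB].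
by have := fBm_mean BH a0; have := fBm_mean BH b0; rewrite unlock => -> ->; rewrite subee.
Qed.

Let incM a b c e w : (inc a b w * inc c e w =
  (B b w * B e w - B b w * B c w) - (B a w * B e w - B a w * B c w))%R.
Proof. by rewrite /inc; ring. Qed.

Let Iincinc a b c e : 0 <= a -> 0 <= b -> 0 <= c -> 0 <= e ->
  P.-integrable setT (fun w => (inc a b w * inc c e w)%:E).
Proof.
move=> a0 b0 c0 e0; under eq_fun do rewrite incM !EFinB.
by apply: integrableB => //; apply: integrableB => //; exact: IBB.
Qed.

Let Eincinc a b c e : 0 <= a -> 0 <= b -> 0 <= c -> 0 <= e ->
  (\int[P]_w (inc a b w * inc c e w)%:E = (inc_cov q a b c e)%:E)%E.
Proof.
move=> a0 b0 c0 e0; under eq_integral do rewrite incM !EFinB.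
have I1 : P.-integrable setT (fun w => (B b w * B e w)%:E - (B b w * B c w)%:E)%E.
  by apply: integrableB => //; exact: IBB.
have I2 : P.-integrable setT (fun w => (B a w * B e w)%:E - (B a w * B c w)%:E)%E.
  by apply: integrableB => //; exact: IBB.
rewrite integralB// !integralB//; do ?exact: IBB.
rewrite !EBB// -!EFinB; congr EFin; rewrite /cov /inc_cov; ring.
Qed.

Let S t N w := expR (- (t / theta)) * unif_sum theta (fun s => B s w) t N.

Let up_ge0 (t : R) N i : 0 <= t -> 0 <= unif_point t N i.
Proof. by move=> t0; rewrite divr_ge0// mulr_ge0. Qed.

Let SE t N w : S t N w = \sum_(i < N.+1) expR ((unif_point t N i - t) / theta) *
  inc (unif_point t N i) (unif_point t N i.+1) w.
Proof.
rewrite /S /unif_sum mulr_sumr; apply: eq_bigr => i _.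
by rewrite mulrA -expRD; congr (expR _ * _); ring.
Qed.

Let S_moments t N : 0 <= t -> (\int[P]_w (S t N w)%:E = 0)%E /\
  (\int[P]_w (S t N w ^+ 2)%:E = (unif_var q theta t N)%:E)%E.
Proof.
move=> t0.
have [] := @moments_lincomb _ T R P N.+1 (fun i => expR ((unif_point t N i - t) / theta))
  (fun i => inc (unif_point t N i) (unif_point t N i.+1))
  (fun i j => inc_cov q (unif_point t N i) (unif_point t N i.+1) (unif_point t N j) (unif_point t N j.+1)).
- by move=> i; apply: Iinc; exact: up_ge0.
- by move=> i; apply: Einc; exact: up_ge0.
- by move=> i j; apply: Iincinc; exact: up_ge0.
- by move=> i j; apply: Eincinc; exact: up_ge0.
by move=> h1 h2; split; [rewrite -h1|rewrite -h2]; apply: eq_integral => w _; rewrite SE.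
Qed.

(** [gaussian_process] is about values, so the sum of increments is rewritten over [2 (N+1)] times:
    right ends with coefficient [e i], left ends with [- e i]. *)
Let S_gaussian t N : 0 <= t -> gaussian_rv P (S t N).
Proof.
move=> t0.
pose e i := expR ((unif_point t N i - t) / theta).
pose a (k : 'I_(N.+1 + N.+1)) := match fintype.split k with inl i => e i | inr i => - e i end.
pose s (k : 'I_(N.+1 + N.+1)) := match fintype.split k with inl i => unif_point t N i.+1 | inr i => unif_point t N i end.
have s0 k : 0 <= s k by rewrite /s; case: fintype.split => i; exact: up_ge0.
have := fBm_gaussian BH a s0.
rewrite (_ : (fun w => _) = S t N)//; apply/funext => w.
rewrite SE big_split_ord/= -big_split/=; apply: eq_bigr => i _.
rewrite /a /s (unsplitK (inl i)) (unsplitK (inr i)) /inc -/(e i); ring.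
Qed.

Let U := fOU theta B.

Let S_cvg t : 0 <= t -> {ae P, forall w, S t N w @[N --> \oo] --> U t w}.
Proof.
move=> t0; apply: filterS (fBm_continuous BH) => w cw.
apply: cvgM; first exact: cvg_cst.
exact: (RS_integral_cvg_unif theta0 cw t0).
Qed.

Lemma measurable_fOU t : 0 <= t -> measurable_fun [set: T] (U t).
Proof.
move=> t0; apply: (ae_cvg_measurable Pc _ (S_cvg t0)) => N.
by have [] := S_gaussian N t0.
Qed.

(** One null set serves all sequences and all limits, so that random times may be substituted. *)
Lemma fOU_path_cvg : {ae P, forall w, forall (u : nat -> R) (t : R), 0 <= t ->
  (forall k, 0 <= u k) -> u k @[k --> \oo] --> t -> U (u k) w @[k --> \oo] --> U t w}.
Proof.
apply: filterS (fBm_continuous BH) => w cw u t t0 u0 ut.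
apply: cvgM; last exact: (RS_integral_cvg theta0 cw t0 u0 ut).
have h : - (u k / theta) @[k --> \oo] --> - (t / theta).
  by apply: cvgN; apply: cvgM => //; exact: cvg_cst.
by apply: continuous_cvg h; exact: continuous_expR.
Qed.

(** The moments of the Gaussian sums [S t N] are explicit, and [unif_var <= V2] bounds those of
    order [4n] uniformly in [N], as [moment_cvg] requires. *)
Lemma fOU_moment n t : 0 <= t ->
  (\int[P]_w (`|U t w| ^+ (2 * n))%:E = (gauss_moment R n * V2 q theta t ^+ n)%:E)%E.
Proof.
move=> t0.
have ES k N : (\int[P]_w (`|S t N w| ^+ (2 * k))%:E = (gauss_moment R k * unif_var q theta t N ^+ k)%:E)%E.
  have [E1 E2] := S_moments N t0.
  exact: gaussian_even_moment (S_gaussian N t0) E1 E2.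
have vb N := @unif_var_bounds R q theta q0 theta0 t N t0.
have v0 N : 0 <= unif_var q theta t N.
  rewrite -(pmulr_rge0 _ (expR_gt0 (2 * t / N.+1%:R / theta))).
  by have /andP[_] := vb N; apply: le_trans; exact: V2_ge0.
have mS N : measurable_fun [set: T] (S t N) by have [] := S_gaussian N t0.
have mP (X : T -> R) k : measurable_fun [set: T] X -> measurable_fun [set: T] (fun w => `|X w| ^+ k).
  by move=> mX; apply: measurable_funX; exact: measurableT_comp.
have := @moment_cvg _ T R P (fun N w => `|S t N w| ^+ (2 * n)) (fun w => `|U t w| ^+ (2 * n))
  (gauss_moment R (2 * n) * V2 q theta t ^+ (2 * n)).
move=> /(_ (fun N => mP _ _ (mS N)) (mP _ _ (measurable_fOU t0))) h.
have {}h : ((\int[P]_w (`|S t N w| ^+ (2 * n))%:E) @[N --> \oo] -->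
    \int[P]_w (`|U t w| ^+ (2 * n))%:E)%E.
  apply: h.
  - by move=> N w; exact: exprn_ge0.
  - by move=> w; exact: exprn_ge0.
  - apply: filterS (S_cvg t0) => w cw.
    have cn : `|S t N w| @[N --> \oo] --> `|U t w| by exact: cvg_norm.
    apply: (@continuous_cvg _ _ _ _ _ _ (fun x : R => x ^+ (2 * n))) => //.
    exact: exprn_continuous.
  - move=> N; under eq_integral do rewrite -exprM mulnC.
    rewrite ES lee_fin ler_wpM2l ?gauss_moment_ge0//.
    by rewrite lerXn2r ?nnegrE ?V2_ge0//; have /andP[] := vb N.
apply: (cvg_unique _ h) => //.
rewrite (_ : (fun N => _) = (fun N => (gauss_moment R n * unif_var q theta t N ^+ n)%:E)); last first.
  by apply/funext => N; exact: ES.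
apply: cvg_EFin; first exact: nearW.
apply: cvgM; first exact: cvg_cst.
apply: (@continuous_cvg _ _ _ _ _ _ (fun x : R => x ^+ n)); first exact: exprn_continuous.
exact: unif_var_cvg.
Qed.

End fou_moments.

(** * Subordinators and their inverses *)

Section subordinator_paths.
Context (R : realType).
Implicit Types (g : R -> R) (s t y z : R).

Let above g t := [set y : R | 0 < y /\ t < g y].

(** The last clause keeps the set [above g t] nonempty, so that its infimum is not the default value
    0. *)
Definition regular_path g := [/\ g 0 = 0,
  {in `[0, +oo[ &, {homo g : x y / x <= y}},
  (forall y, 0 <= y -> g z @[z --> y^'+] --> g y) &
  forall t, exists y, 0 < y /\ t < g y].

Let has_lbound_above g t : has_lbound (above g t).
Proof. by exists 0 => y [/ltW]. Qed.

(** Valid on every path: the infimum of the empty set is 0. The inverse is therefore nonnegative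
    everywhere and not just almost surely. *)
Lemma inf_above_ge0 g t : 0 <= inf (above g t).
Proof.
have [->|] := eqVneq (above g t) set0; first by rewrite inf0.
by move=> /set0P h; apply: lb_le_inf => // y [/ltW].
Qed.

Lemma inf_above_le g s t : regular_path g -> s <= t -> inf (above g s) <= inf (above g t).
Proof.
move=> [_ _ _ gy] st; apply: lb_le_inf; first exact: gy.
move=> y [y0 ty]; apply: ge_inf; first exact: has_lbound_above.
by split => //; exact: le_lt_trans ty.
Qed.

Lemma le_inf_above g y t : regular_path g -> 0 <= y -> g y <= t -> y <= inf (above g t).
Proof.
move=> [_ gm _ gy] y0 yt; apply: lb_le_inf; first exact: gy.
move=> z [z0 tz]; rewrite leNgt; apply/negP => zy.
have : g z <= g y by apply: gm; rewrite ?in_itv/= ?andbT//; exact: ltW.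
by rewrite leNgt (le_lt_trans yt).
Qed.

(** The condition on the right involves countably many values of the path, which is what
    measurability of the inverse calls for. *)
Lemma inf_above_ltP g t y : regular_path g ->
  inf (above g t) < y <-> exists r : rat, [/\ 0 < (ratr r : R), ratr r < y & t < g (ratr r)].
Proof.
move=> [_ gm _ gy]; split.
- move=> /(inf_lt (gy t))[z [z0 tz] zy].
  have [r] := rat_in_itvoo zy; rewrite in_itv/= => /andP[zr ry]; exists r.
  have r0 : 0 < (ratr r : R) by exact: lt_trans zr.
  split => //; apply: (lt_le_trans tz); apply: gm; rewrite ?in_itv/= ?andbT//; do ?exact: ltW.
- move=> [r [r0 ry tr]]; apply: le_lt_trans ry.
  by apply: ge_inf; [exact: has_lbound_above|split].
Qed.

(** The path exceeds [s] at time [y], so the first infimum is at most [y]; by right-continuity it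
    stays below [t] slightly beyond [y], so the second infimum is larger than [y]. *)
Lemma inf_above_lt g s t y : regular_path g -> 0 < y -> s < g y -> g y < t ->
  inf (above g s) < inf (above g t).
Proof.
move=> [_ gm gr gy] y0 sy yt.
have [e /= e0 he] : \forall z \near y^'+, g z < t.
  exact: (cvgr_lt _ (gr y (ltW y0))).
pose z1 := y + e / 2.
have yz1 : y < z1 by rewrite ltrDl divr_gt0.
apply: (@le_lt_trans _ _ y); first by apply: ge_inf; [exact: has_lbound_above|split].
apply: (lt_le_trans yz1); apply: lb_le_inf; first exact: gy.
move=> z [z0 tz]; rewrite leNgt; apply/negP => zz1.
have gz1 : g z1 < t.
  apply: he => //=; rewrite /z1 opprD addNKr normrN gtr0_norm ?divr_gt0//.
  by rewrite ltr_pdivrMr// ltr_pMr// ltr1n.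
have z10 : 0 < z1 by exact: lt_trans z0 zz1.
have : g z <= g z1 by apply: gm; rewrite ?in_itv/= ?andbT//; exact: ltW.
by rewrite leNgt (lt_trans gz1).
Qed.

End subordinator_paths.

(** * Unboundedness of the Laplace exponent *)

Section laplace_exponent.
Context (R : realType) (nu : {measure set (measurableTypeR R) -> \bar R}).
Hypothesis LN : levy_measure nu.
Local Open Scope ereal_scope.

Let f (n : nat) (x : measurableTypeR R) : \bar R := (1 - expR (- (n%:R * x)))%R%:E.

Let mf n D : measurable_fun D (f n).
Proof.
apply: measurable_funTS; apply/measurable_EFinP.
apply: (@measurable_compR _ _ _ _ _ (fun x : R => 1 - expR (- (n%:R * x)))%R id) => //.
apply: measurable_realfun.measurable_funB; first exact: measurable_cst.
apply: measurableT_comp => //; exact: measurableT_comp.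
Qed.

Let exp_min (m y : R) : (0 <= m -> 0 < y -> 1 - expR (- (m * y)) <= (m + 1) * Num.min 1 y)%R.
Proof.
move=> m0 y0; have := expR_ge1Dx (- (m * y)); have := expR_ge0 (- (m * y)).
by move: (expR _) => e e0 h; case: (leP 1%R y) => ?; nra.
Qed.

(** [laplace_exponent] is a real integral and would be 0 if the extended one were infinite.
    Integrability identifies the two, and [exp_min] reduces it to the integrability condition on the
    Levy measure. *)
Let f_integrable n : nu.-integrable (`]0%R, +oo[ : set (measurableTypeR R)) (f n).
Proof.
have mD : measurable (`]0%R, +oo[ : set (measurableTypeR R)) by exact: measurable_itv.
have mm : measurable_fun (`]0%R, +oo[ : set (measurableTypeR R)) (fun x : measurableTypeR R => (Num.min 1 x)%R%:E).
  apply: measurable_funTS; apply/measurable_EFinP.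
  apply: (@measurable_compR _ _ _ _ _ (fun x : R => Num.min 1 x)%R id) => //.
  by apply: measurable_realfun.measurable_minr => //; exact: measurable_cst.
have Im : nu.-integrable (`]0%R, +oo[ : set (measurableTypeR R)) (fun x : measurableTypeR R => (Num.min 1 x)%R%:E).
  apply/integrableP; split => //.
  rewrite (_ : integral _ _ _ = \int[nu]_(x in `]0%R, +oo[) (Num.min 1 x)%R%:E); first exact: (levy_integrable LN).
  apply: eq_integral => x; rewrite inE/= in_itv/= andbT => x0.
  by rewrite ger0_norm// le_min ler01 ltW.
apply: (@le_integrable _ _ _ nu _ mD _ (fun x : measurableTypeR R => (n.+1%:R)%:E * (Num.min 1 x)%R%:E)) => //.
- move=> x; rewrite /= in_itv/= andbT => x0.
  rewrite !lee_fin ger0_norm; last first.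
    by rewrite subr_ge0 -expR0 ler_expR oppr_le0 mulr_ge0// ltW.
  rewrite ger0_norm; last by rewrite mulr_ge0// le_min ler01 ltW.
  by rewrite -natr1; exact: exp_min.
- exact: integrableZl.
Qed.

(** Monotone convergence: [1 - exp(- n x)] increases to 1 on []0, +oo[], a set of infinite mass. *)
Lemma laplace_exponent_pinfty M : exists n : nat, (M <= laplace_exponent nu n%:R)%R.
Proof.
have mD : measurable (`]0%R, +oo[ : set (measurableTypeR R)) by exact: measurable_itv.
have h : \int[nu]_(x in `]0%R, +oo[) f n x @[n --> \oo] --> \int[nu]_(x in `]0%R, +oo[) (fun _ : measurableTypeR R => 1) x.
  rewrite (_ : integral _ _ (fun _ => 1) = \int[nu]_(x in `]0%R, +oo[) limn (f^~ x)); last first.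
    apply: eq_integral => x; rewrite inE/= in_itv/= andbT => x0; apply/esym/cvg_lim => //.
    apply: cvg_EFin; first exact: nearW.
    rewrite -[X in _ --> X]subr0; apply: cvgB; first exact: cvg_cst.
    have cx : (fun n => expR (- (n%:R * x))) = (fun n => (expR (- x) ^+ n))%R.
      by apply/funext => n; rewrite -expRM_natl mulrN.
    rewrite cx; apply: cvg_expr; rewrite gtr0_norm ?expR_gt0//.
    by rewrite -expR0 ltr_expR oppr_lt0.
  apply: cvg_monotone_convergence => //.
  - move=> n x; rewrite /= in_itv/= andbT => x0.
    by rewrite lee_fin subr_ge0 -expR0 ler_expR oppr_le0 mulr_ge0// ltW.
  - move=> x; rewrite /= in_itv/= andbT => x0 m n mn.
    by rewrite lee_fin lerB// ler_expR lerN2 ler_pM2r// ler_nat.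
move: h; rewrite integral_cst// mul1e (levy_infinite LN) => /cvgeyPge/(_ M)[n _ /(_ n (leqnn n))/= hn].
exists n; rewrite -lee_fin; apply: (le_trans hn).
by rewrite /laplace_exponent /Rintegral fineK//; exact: (integrable_fin_num mD (f_integrable n)).
Qed.

End laplace_exponent.

Section inverse_subordinator.
Context (R : realType) d (T : measurableType d) (P : probability T R).
Context (nu : {measure set (measurableTypeR R) -> \bar R}) (sigma : R -> T -> R).
Hypothesis Pc : measure_is_complete P.
Hypothesis LN : levy_measure nu.
Hypothesis SUB : subordinator P nu sigma.

Let msigma y : 0 <= y -> measurable_fun [set: T] (sigma y).
Proof. by move=> y0; exact: (sub_measurable SUB y0). Qed.

Let m_le y t : 0 <= y -> measurable [set w | sigma y w <= t].
Proof.
move=> y0; have := msigma y0 measurableT (measurable_itv `]-oo, t]).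
by rewrite setTI; congr measurable; apply/seteqP; split => w /=; rewrite in_itv.
Qed.

(** Chernoff bound: Markov's inequality for [exp(- n * sigma y)], whose expectation is the Laplace
    transform. *)
Let tail y t (n : nat) : 0 <= y ->
  expR (- (n%:R * t)) * fine (P [set w | sigma y w <= t]) <=
  expR (- (y * laplace_exponent nu n%:R)).
Proof.
move=> y0; rewrite -lee_fin -(sub_laplace SUB y0 (ler0n R n)) unlock EFinM.
have mA := m_le t y0.
have me : measurable_fun [set: T] (fun w => (expR (- (n%:R * sigma y w)))%:E).
  apply/measurable_EFinP; apply: measurableT_comp => //; apply: measurableT_comp => //.
  by apply: measurable_realfun.measurable_funM => //; exact: msigma.
rewrite fineK ?fin_num_measure// -integral_cst//.
have h0 (w : T) : (0 <= (expR (- (n%:R * sigma y w)))%:E)%E by rewrite lee_fin expR_ge0.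
have h1 : (\int[P]_(w in [set w | (sigma y w <= t)%R]) (cst (expR (- (n%:R * t)))%:E) w <=
    \int[P]_(w in [set w | (sigma y w <= t)%R]) (expR (- (n%:R * sigma y w)))%:E)%E.
  apply: ge0_le_integral => //.
  - by move=> w _; rewrite lee_fin expR_ge0.
  - exact: measurable_funTS.
  - by move=> w wt; rewrite lee_fin ler_expR lerN2 ler_wpM2l.
apply: (Order.POrderTheory.le_trans h1).
exact: (@ge0_subset_integral _ _ _ P _ _ mA measurableT _ me (fun w _ => h0 w) (@subsetT _ _)).
Qed.

(* turns the Chernoff bound [tail] into [p = 0] *)
Let null_of_tail (p a : R) : 0 <= p -> 0 < a ->
  (forall M : R, exists2 b, M <= b & a * p <= expR (- b)) -> p = 0.
Proof.
move=> p0 a0 h; apply/eqP; rewrite eq_le p0 andbT leNgt; apply/negP => pp.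
have ap : 0 < a * p by exact: mulr_gt0.
have [b Mb hb] := h (a * p)^-1.
have : a * p * expR b <= 1.
  by rewrite -(expRxMexpNx_1 b) [leRHS]mulrC ler_pM2r// expR_gt0.
rewrite leNgt => /negP; apply; rewrite -ltr_pdivrMl// mulr1.
apply: (le_lt_trans Mb); apply: lt_le_trans (expR_ge1Dx b).
by rewrite ltrDr.
Qed.

(** The bound [tail] at [t = 0] has no prefactor; with [y] fixed, the exponent is made large through
    [n]. *)
Let sub_pos y : 0 < y -> {ae P, forall w, 0 < sigma y w}.
Proof.
move=> y0; exists [set w | sigma y w <= 0]; split.
- by apply: m_le; exact: ltW.
- rewrite -[LHS]fineK ?fin_num_measure//; last by apply: m_le; exact: ltW.
  congr EFin; apply: (@null_of_tail _ 1) => //; first exact: fine_ge0.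
  move=> M; have [n hn] := laplace_exponent_pinfty LN (M / y).
  exists (y * laplace_exponent nu n%:R); first by rewrite mulrC -ler_pdivrMr.
  by have := tail 0 n (ltW y0); rewrite mulr0 oppr0 expR0.
- by move=> w /=; rewrite leNgt => /negP.
Qed.

(** Now [n] is fixed with Laplace exponent at least 1, and the exponent in [tail] is made large
    through the time [m]. *)
Let sub_unbounded (k : nat) : {ae P, forall w, exists m : nat, k%:R < sigma m%:R w}.
Proof.
exists (\bigcap_m [set w | sigma m%:R w <= k%:R]).
have mB : measurable (\bigcap_(m : nat) [set w | sigma m%:R w <= k%:R]).
  by apply: bigcapT_measurable => m; exact: m_le.
split => //.
- rewrite -[LHS]fineK ?fin_num_measure//; congr EFin.
  have [n hn] := laplace_exponent_pinfty LN 1.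
  apply: (@null_of_tail _ (expR (- (n%:R * k%:R)))); [exact: fine_ge0|exact: expR_gt0|].
  move=> M; pose m := Num.truncn `|M|.
  exists (m.+1%:R * laplace_exponent nu n%:R).
    apply: (@le_trans _ _ m.+1%:R); last by rewrite ler_peMr.
    by rewrite (le_trans (ler_norm M))// ltW// truncnS_gt.
  apply: le_trans (tail k%:R n (ler0n R m.+1)).
  rewrite ler_pM2l ?expR_gt0//; apply: fine_le; rewrite ?fin_num_measure//; do ?exact: m_le.
  by apply: le_measure; rewrite ?inE//; [exact: m_le|exact: bigcap_inf].
- move=> w /= h m _ /=; rewrite leNgt; apply/negP => km; apply: h; by exists m.
Qed.

Lemma subordinator_regular : {ae P, forall w, regular_path (sigma^~ w)}.
Proof.
have := ae_foralln sub_unbounded; have := sub_paths SUB.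
apply: filterS2 => w [s0 sm sr] su; split => // t.
have [m hm] := su (Num.truncn `|t|).+1.
have tm : t < sigma m%:R w.
  by apply: le_lt_trans hm; rewrite (le_trans (ler_norm t))// ltW// truncnS_gt.
case: m hm tm => [|m] hm tm; last by exists m.+1%:R.
by move: hm; rewrite s0 ltrn0.
Qed.

Let E := inverse_subordinator sigma.

Let measurable_ae_set (A D : set T) : measurable D ->
  {ae P, forall w, A w <-> D w} -> measurable A.
Proof.
move=> mD AD.
have AmD : measurable (A `\` D).
  by apply: Pc; apply: negligibleS AD => w [Aw Dw] /=; rewrite /mkset; tauto.
have DmA : measurable (D `\` A).
  by apply: Pc; apply: negligibleS AD => w [Aw Dw] /=; rewrite /mkset; tauto.
rewrite (_ : A = (D `\` (D `\` A)) `|` (A `\` D)).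
  by apply: measurableU => //; exact: measurableD.
apply/seteqP; split => w; rewrite /setD /setU /mkset; last by have := EM (A w); tauto.
by have := EM (D w); tauto.
Qed.

(** The event [E t < y] agrees almost surely with a countable union over rational times;
    completeness absorbs the paths that are not regular. *)
Lemma measurable_inverse_subordinator t : measurable_fun [set: T] (E t).
Proof.
apply: (measurability (@RGenInftyO.G R)); first exact: RGenInftyO.measurableE.
move=> _ [_ [y ->] <-]; rewrite setTI.
pose D := \bigcup_(r : rat) [set w | [/\ 0 < (ratr r : R), ratr r < y & t < sigma (ratr r) w]].
apply: (@measurable_ae_set _ D).
- apply: bigcupT_measurable_rat => r.
  case: (ltP 0 (ratr r : R)) => r0; last first.
    rewrite (_ : [set _ | _] = set0)//; apply/seteqP; split => w //= [].
    by rewrite ltNge => /negP.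
  case: (ltP (ratr r : R) y) => ry; last first.
    rewrite (_ : [set _ | _] = set0)//; apply/seteqP; split => w //= [_].
    by rewrite ltNge => /negP.
  have := measurableC (m_le t (ltW r0)); congr measurable.
  by apply/seteqP; split => w /=; [rewrite leNgt => /negP /negPn|move=> [_ _]; rewrite ltNge => /negP].
- apply: filterS subordinator_regular => w rw.
  have := inf_above_ltP t y rw; rewrite /= in_itv/= => -[h1 h2]; split.
    by move=> /h1[r hr]; exists r.
  by move=> [r _ hr]; apply: h2; exists r.
Qed.

Lemma inverse_subordinator_ge0 t w : 0 <= E t w.
Proof. exact: inf_above_ge0. Qed.

Lemma inverse_subordinator_le : {ae P, forall w, forall s t : R, s <= t -> E s w <= E t w}.
Proof. by apply: filterS subordinator_regular => w rw s t st; exact: inf_above_le. Qed.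

Lemma inverse_subordinator_cvg : {ae P, forall w, forall k : nat,
  exists t0, forall t, t0 <= t -> k%:R <= E t w}.
Proof.
apply: filterS subordinator_regular => w rw k; exists (sigma k%:R w) => t st.
exact: le_inf_above.
Qed.

(* Otherwise [sigma dt >= h] almost surely for arbitrarily small [dt] (it is positive as [nu]
   is infinite), against right-continuity at 0. *)
Let increment_prob h : 0 < h -> exists dt e : R, [/\ 0 < dt, 0 < e &
  (0 < P (sigma dt @^-1` `]e, h[))%E].
Proof.
move=> h0; apply: contrapT => H.
have N0 (i j : nat) : {ae P, forall w, ~ (sigma (i.+1%:R^-1) w \in `]j.+1%:R^-1, h[)}.
  have mA : measurable (sigma i.+1%:R^-1 @^-1` `]j.+1%:R^-1, h[).
    rewrite -[X in measurable X]setTI; exact: (@msigma i.+1%:R^-1 (ltW _) _ _ (measurable_itv _)).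
  exists (sigma i.+1%:R^-1 @^-1` `]j.+1%:R^-1, h[); split => //.
  - apply/eqP; rewrite eq_le measure_ge0 andbT leNgt; apply/negP => p0; apply: H.
    by exists i.+1%:R^-1, j.+1%:R^-1; rewrite !invr_gt0 !ltr0n.
  - by move=> w /= /contrapT.
have N1 := ae_foralln (fun i => ae_foralln (N0 i)).
have N2 : {ae P, forall w, forall i : nat, 0 < sigma i.+1%:R^-1 w}.
  by apply: ae_foralln => i; apply: sub_pos; rewrite invr_gt0 ltr0n.
have : {ae P, forall w, False}.
  apply: filterS3 subordinator_regular N1 N2 => w [g0 gm gr _] n1 n2.
  have [e /= e0 he] : \forall z \near 0^'+, sigma z w < h.
    by apply: (cvgr_lt _ (gr 0 (lexx 0))); rewrite g0.
  have [i ie] : exists i : nat, (i.+1%:R : R)^-1 < e.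
    exists (Num.truncn e^-1); rewrite invf_plt ?posrE ?ltr0n//.
    exact: truncnS_gt.
  have hi : sigma i.+1%:R^-1 w < h.
    by apply: he => /=; rewrite ?invr_gt0 ?ltr0n// sub0r normrN gtr0_norm ?invr_gt0 ?ltr0n.
  pose j := Num.truncn (sigma i.+1%:R^-1 w)^-1.
  apply: (n1 i j); rewrite in_itv/= hi andbT.
  by rewrite invf_plt ?posrE ?ltr0n//; exact: truncnS_gt.
move=> [N [mN N00 sN]].
have : (P setT <= 0)%E by rewrite -N00; apply: le_measure; rewrite ?inE// => w _; exact: sN.
by rewrite [P _]probability_setT lee_fin ler10.
Qed.

(* Independent increments of size in ]e, t - s[ on a grid of step [dt] cannot jump over ]s, t[,
   and E(s) < E(t) as soon as [sigma] takes a value in ]s, t[. *)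
Lemma inverse_subordinator_lt s t : 0 <= s -> s < t -> ~ {ae P, forall w, E t w <= E s w}.
Proof.
move=> s0 st hae; have h0 : 0 < t - s by rewrite subr_gt0.
have [dt [e [dt0 e0 pp]]] := increment_prob h0.
(* Enough increments larger than [e] to carry the path from 0 above [s]. *)
pose N := (Num.truncn (s / e)).+1.
have Ne : s < N%:R * e by rewrite -ltr_pdivrMr//; exact: truncnS_gt.
pose y (i : nat) := i%:R * dt.
have yS i : y i.+1 = y i + dt by rewrite /y -natr1 mulrDl mul1r.
have y0 i : 0 <= y i by rewrite mulr_ge0// ltW.
pose X (i : nat) w := sigma (y i.+1) w - sigma (y i) w.
have mX i : measurable_fun [set: T] (X i).
  by apply: measurable_realfun.measurable_funB; apply: msigma.
pose G := \bigcap_(i in [set: 'I_N]) (X i @^-1` `]e, (t - s)[).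
have PG : (0 < P G)%E.
  rewrite (@sub_independent _ _ _ _ _ _ SUB N y (y0 0%N) _ (fun=> `]e, (t - s)[%classic))//; last first.
    by move=> i; rewrite yS lerDl ltW.
  rewrite (eq_bigr (fun=> (fine (P (sigma dt @^-1` `]e, (t - s)[)))%:E)); last first.
    move=> i _; rewrite fineK ?fin_num_measure//; last first.
      by rewrite -[X in measurable X]setTI; apply: msigma => //; exact: ltW.
    rewrite -(sub_stationary SUB (y0 i) (ltW dt0) (measurable_itv _)).
    by rewrite -yS.
  rewrite prodEFin lte_fin prodr_gt0// => i _; apply: fine_gt0; rewrite pp/=.
  by rewrite -ge0_fin_numE// fin_num_measure// -[X in measurable X]setTI; apply: msigma => //; exact: ltW.
have mG : measurable G.
  by apply: fin_bigcap_measurable => // i _; rewrite -[X in measurable X]setTI; exact: mX.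
have GN : {ae P, forall w, ~ G w}.
  apply: filterS2 subordinator_regular hae => w rw hw Gw.
  have [g0 _ _ _] := rw.
  have gX i : (i < N)%N -> e < sigma (y i.+1) w - sigma (y i) w < t - s.
    by move=> iN; have := Gw (Ordinal iN) I; rewrite /= in_itv.
  have ge i : (i <= N)%N -> i%:R * e <= sigma (y i) w.
    elim: i => [|i IH] iN; first by rewrite /y !mul0r g0.
    have := IH (ltnW iN); have /andP[h _] := gX _ iN.
    by rewrite -natr1 mulrDl mul1r; lra.
  have exk : exists k, s < sigma (y k) w.
    by exists N; exact: lt_le_trans Ne (ge _ (leqnn N)).
  (* At the first grid time above level [s], the last increment is smaller than [t - s] and started
     from a value at most [s], so the path is still below [t]. *)
  have [k sk kmin] := ex_minnP exk.
  have kN : (k <= N)%N by apply: kmin; exact: lt_le_trans Ne (ge _ (leqnn N)).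
  case: k => [|k] in sk kmin kN *.
    by move: sk; rewrite /y mul0r g0 ltNge s0.
  have ks : sigma (y k) w <= s.
    by rewrite leNgt; apply/negP => /kmin; rewrite ltnn.
  have /andP[_ h] := gX _ kN.
  have kt : sigma (y k.+1) w < t by lra.
  have yk : 0 < y k.+1 by rewrite mulr_gt0.
  by have := inf_above_lt rw yk sk kt; rewrite ltNge hw.
move: PG; suff -> : P G = 0 by rewrite ltxx.
apply: measure_negligible => //; apply: negligibleS GN => w Gw /=; rewrite /mkset; tauto.
Qed.

End inverse_subordinator.

(** * The process at an independent random time *)

Section independent_integrals.
Context d (T : measurableType d) (R : realType) (P : probability T R).
Local Open Scope ereal_scope.

(** Independence says that the image under [Y] of [P] restricted to [A] is the law of [Y] scaled by
    [P A], so that [ge0_integral_transfer] applies. *)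
Lemma ge0_integral_indep (A : set T) (Y : T -> R) (f : R -> \bar R) :
  measurable A -> measurable_fun [set: T] Y ->
  (forall C, measurable C -> P (A `&` Y @^-1` C) = P A * P (Y @^-1` C)) ->
  measurable_fun [set: R] f -> (forall y, 0 <= f y) ->
  \int[P]_(w in A) f (Y w) = P A * \int[P]_w f (Y w).
Proof.
move=> mA mY ind mf f0.
pose Y' : {mfun T >-> R} := HB.pack Y (isMeasurableFun.Build _ _ _ _ Y mY).
pose c : {nonneg R} := NngNum (fine_ge0 (measure_ge0 P A)).
have cE : c%:num%:E = P A by rewrite /c/= fineK ?fin_num_measure.
have m12 C : measurable C -> mscale c (distribution P Y') C = \int[P]_(w in A `&` Y @^-1` C) (cst 1%R w)%:E.
  move=> mC; have mYC : measurable (Y @^-1` C) by rewrite -[X in measurable X]setTI; exact: (mY measurableT C mC).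
  rewrite (@integral_cst _ _ _ P _ _ 1); last exact: measurableI.
  rewrite mul1e; transitivity (P A * P (Y @^-1` C)); last exact: (esym (ind C mC)).
  by rewrite -cE.
have := @ge0_integral_transfer _ _ _ _ R P (mscale c (distribution P Y')) A Y (cst 1%R) mA
  (measurable_funTS mY) (measurable_cst _) (fun _ _ => ler01) m12 f mf f0.
rewrite ge0_integral_mscale// cE ge0_integral_distribution//= => ->.
by apply: eq_integral => w _; rewrite mul1e.
Qed.

Variable K : T -> nat.
Hypothesis mK : forall k, measurable (K @^-1` [set k]).

Let bigcup_K : \bigcup_k (K @^-1` [set k]) = [set: T].
Proof. by apply/seteqP; split => // w _; exists (K w). Qed.

Let trivIset_K : trivIset setT (fun k => K @^-1` [set k]).
Proof. by move=> i j _ _ [w [/= <- <-]]. Qed.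

Lemma measurable_select (X : nat -> T -> R) :
  (forall k, measurable_fun [set: T] (X k)) -> measurable_fun [set: T] (fun w => X (K w) w).
Proof.
move=> mX; rewrite -bigcup_K; apply/measurable_fun_bigcup => // k.
apply: (eq_measurable_fun (X k)); last exact: measurable_funTS.
by move=> w; rewrite inE/= => ->.
Qed.

(** Splitting over the countably many values of [K] lets a process be evaluated at a random index
    while only its single variables are known to be measurable. *)
Lemma integral_select (f g : nat -> T -> R) :
  (forall k, measurable_fun [set: T] (f k)) -> (forall k, measurable_fun [set: T] (g k)) ->
  (forall k w, 0 <= f k w)%R -> (forall k w, 0 <= g k w)%R ->
  (forall k, \int[P]_(w in K @^-1` [set k]) (f k w)%:E =
             \int[P]_(w in K @^-1` [set k]) (g k w)%:E) ->
  \int[P]_w (f (K w) w)%:E = \int[P]_w (g (K w) w)%:E.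
Proof.
move=> mf mg f0 g0 fg.
have decomp (X : nat -> T -> R) : (forall k, measurable_fun [set: T] (X k)) ->
    (forall k w, 0 <= X k w)%R ->
    \int[P]_w (X (K w) w)%:E = \sum_(k <oo) \int[P]_(w in K @^-1` [set k]) (X k w)%:E.
  move=> mX X0; rewrite -bigcup_K ge0_integral_bigcup//.
  - by apply: eq_eseriesr => k _; apply: eq_integral => w; rewrite inE/= => ->.
  - by rewrite bigcup_K; apply/measurable_EFinP; exact: measurable_select.
  - by move=> w _; rewrite lee_fin.
by rewrite !decomp//; apply: eq_eseriesr.
Qed.

End independent_integrals.

Section even_moments.
Context (R : realType) (q theta : R).
Hypotheses (q0 : 0 < q) (theta0 : 0 < theta).

Definition fou_moment n (y : R) : R := gauss_moment R n * V2 q theta y ^+ n.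

Lemma fou_moment_ge0 n y : 0 <= fou_moment n y.
Proof. by rewrite mulr_ge0 ?gauss_moment_ge0// exprn_ge0// V2_ge0. Qed.

Lemma fou_moment_le n s t : 0 <= s -> s <= t -> fou_moment n s <= fou_moment n t.
Proof.
move=> s0 st; rewrite ler_wpM2l ?gauss_moment_ge0// lerXn2r ?nnegrE ?V2_ge0//.
by apply: V2_le => //; rewrite s0.
Qed.

Lemma fou_moment_lt n s t : (0 < n)%N -> 0 <= s -> s < t -> fou_moment n s < fou_moment n t.
Proof.
move=> n0 s0 st; rewrite ltr_pM2l ?gauss_moment_gt0// ltrXn2r -?lt0n// ?V2_ge0//.
by apply: V2_lt => //; rewrite s0.
Qed.

Definition fou_moment_lim n : R := gauss_moment R n * V2lim q theta ^+ n.

Lemma fou_moment_le_lim n y : fou_moment n y <= fou_moment_lim n.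
Proof.
rewrite ler_wpM2l ?gauss_moment_ge0// lerXn2r ?nnegrE ?V2_ge0//; first exact: V2lim_ge0.
exact: V2_le_lim.
Qed.

Lemma fou_moment_cvg n : fou_moment n k%:R @[k --> \oo] --> fou_moment_lim n.
Proof.
apply: cvgM; first exact: cvg_cst.
apply: (@continuous_cvg _ _ _ _ _ _ (fun x : R => x ^+ n)); first exact: exprn_continuous.
exact: V2_cvg.
Qed.

(** Measurability comes from monotonicity, which [fou_moment_le] gives on the half-line; clipping at
    0 extends it to the whole line. *)
Lemma measurable_fou_moment n (D : set R) : measurable D ->
  measurable_fun D (fun y : R => fou_moment n (Num.max 0 y)).
Proof.
move=> mD; apply: nondecreasing_measurable => // s t st.
by apply: fou_moment_le; [rewrite le_max lexx|rewrite ge_max !le_max lexx st orbT].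
Qed.

End even_moments.

Section random_time.
Context d (T : measurableType d) (R : realType) (P : probability T R).
Variables (H theta : R) (B : R -> T -> R).
Hypothesis H1 : 2^-1 < H < 1.
Hypothesis theta0 : 0 < theta.
Hypothesis Pc : measure_is_complete P.
Hypothesis BH : fBm P H B.
Let q := 2 * H - 1.
Let q0 : 0 < q. Proof. by rewrite /q; move/andP: H1 => [? ?]; lra. Qed.
Let U := fOU theta B.
Let v := @fou_moment R q theta.

Let mabs (X : T -> R) k : measurable_fun [set: T] X -> measurable_fun [set: T] (fun w => `|X w| ^+ k).
Proof. by move=> mX; apply: measurable_funX; exact: measurableT_comp. Qed.

Let mU s n : 0 <= s -> measurable_fun [set: T] (fun w => `|U s w| ^+ n).
Proof. by move=> s0; apply: mabs; exact: (measurable_fOU theta0 Pc BH). Qed.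

Let cvg_absX (u : nat -> R) (x : R) n : u k @[k --> \oo] --> x ->
  `|u k| ^+ n @[k --> \oo] --> `|x| ^+ n.
Proof.
move=> ux; apply: (@continuous_cvg _ _ _ _ _ _ (fun x : R => x ^+ n)); first exact: exprn_continuous.
exact: cvg_norm.
Qed.

(** Continuity in time is drawn from the continuity of the paths and the bound on the moments of
    order [4n], rather than from the double integral. *)
Lemma fou_moment_seq_continuous (n : nat) (u : nat -> R) (t : R) : 0 <= t -> (forall k, 0 <= u k) ->
  u k @[k --> \oo] --> t -> v n (u k) @[k --> \oo] --> v n t.
Proof.
move=> t0 u0 ut.
have h := @moment_cvg _ T R P (fun k w => `|U (u k) w| ^+ (2 * n)) (fun w => `|U t w| ^+ (2 * n))
  (fou_moment_lim q theta (2 * n)).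
have {}h : ((\int[P]_w (`|U (u k) w| ^+ (2 * n))%:E) @[k --> \oo] -->
    \int[P]_w (`|U t w| ^+ (2 * n))%:E)%E.
  apply: h.
  - by move=> k; exact: mU.
  - exact: mU.
  - by move=> k w; exact: exprn_ge0.
  - by move=> w; exact: exprn_ge0.
  - by apply: filterS (fOU_path_cvg theta0 BH) => w cw; apply: cvg_absX; exact: cw.
  - move=> k; under eq_integral do rewrite -exprM mulnC.
    by rewrite (fOU_moment H1 theta0 Pc BH)// lee_fin; exact: fou_moment_le_lim.
move: h; rewrite (fOU_moment H1 theta0 Pc BH)//.
under eq_fun do rewrite (fOU_moment H1 theta0 Pc BH)//.
by move=> /fine_cvgP[].
Qed.

Variable tau : T -> R.
Hypothesis tau0 : forall w, 0 <= tau w.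
Hypothesis mtau : measurable_fun [set: T] tau.
Hypothesis indep : forall s C D, 0 <= s -> measurable C -> measurable D ->
  P (tau @^-1` C `&` U s @^-1` D) = (P (tau @^-1` C) * P (U s @^-1` D))%E.

(* [tau] is rounded up to the grid of step [1 / m.+1] *)
Let K m w := Num.truncn (m.+1%:R * tau w).
Let grid (m k : nat) : R := k.+1%:R / m.+1%:R.

Let grid_ge0 m k : 0 <= grid m k. Proof. by rewrite divr_ge0. Qed.

Let KE m k : K m @^-1` [set k] = tau @^-1` `[k%:R / m.+1%:R, k.+1%:R / m.+1%:R[.
Proof.
apply/seteqP; split => w; rewrite /= in_itv/= ler_pdivrMr// ltr_pdivlMr// [_ * m.+1%:R]mulrC.
  by move=> <-; apply: Num.Theory.truncn_itv; rewrite mulr_ge0.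
exact: Num.Theory.truncn_def.
Qed.

Let mK m k : measurable (K m @^-1` [set k]).
Proof. by rewrite KE -[X in measurable X]setTI; exact: mtau. Qed.

Let grid_cvg w : grid m (K m w) @[m --> \oo] --> tau w.
Proof.
apply/cvgrPdist_le => e e0.
have : \forall m \near \oo, m.+1%:R^-1 <= e :> R.
  by apply: filterS (near_infty_natSinv_lt (PosNum e0)) => m; exact: ltW.
apply: filterS => m; apply: le_trans.
have : (K m @^-1` [set (K m w)]) w by [].
rewrite KE /= in_itv/= -/(grid m (K m w)) => /andP[h1 h2].
rewrite ler0_norm; last by rewrite subr_le0 ltW.
rewrite opprB lerBlDl; apply: le_trans (lerD h1 (lexx _)).
by rewrite /grid -natr1 mulrDl mul1r.
Qed.

Let v_ge0 n y : 0 <= v n y. Proof. exact: fou_moment_ge0. Qed.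

Let mv n : measurable_fun [set: T] (fun w => v n (tau w)).
Proof.
rewrite (_ : (fun _ => _) = (fun y => v n (Num.max 0 y)) \o tau).
  by apply: measurableT_comp => //; exact: measurable_fou_moment.
by apply/funext => w /=; rewrite max_r.
Qed.

Let grid_moment n m : (\int[P]_w (`|U (grid m (K m w)) w| ^+ (2 * n))%:E =
  \int[P]_w (v n (grid m (K m w)))%:E)%E.
Proof.
apply: (@integral_select _ _ _ P (K m) (mK m) (fun k w => `|U (grid m k) w| ^+ (2 * n))
  (fun k _ => v n (grid m k))) => //; [by move=> k; exact: mU|].
move=> k; have mUk : measurable_fun [set: T] (U (grid m k)).
  exact: (measurable_fOU theta0 Pc BH).
rewrite integral_cst// (@ge0_integral_indep _ _ _ P _ (U (grid m k)) (fun x => (`|x| ^+ (2 * n))%:E))//.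
- by rewrite (fOU_moment H1 theta0 Pc BH)// muleC.
- by move=> C mC; rewrite KE indep.
- by apply/measurable_EFinP; apply: measurable_funX; exact: normr_measurable.
Qed.

Let U_grid_cvg : {ae P, forall w, U (grid m (K m w)) w @[m --> \oo] --> U (tau w) w}.
Proof.
by apply: filterS (fOU_path_cvg theta0 BH) => w cw; apply: cw => //; exact: grid_cvg.
Qed.

Let mU_grid m : measurable_fun [set: T] (fun w => U (grid m (K m w)) w).
Proof.
apply: (@measurable_select _ _ _ (K m) (mK m) (fun k w => U (grid m k) w)) => k.
exact: (measurable_fOU theta0 Pc BH).
Qed.

Lemma measurable_fOU_random_time : measurable_fun [set: T] (fun w => U (tau w) w).
Proof. exact: (ae_cvg_measurable Pc mU_grid U_grid_cvg). Qed.

Lemma fOU_moment_random_time n :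
  (\int[P]_w (`|U (tau w) w| ^+ (2 * n))%:E = \int[P]_w (v n (tau w))%:E)%E.
Proof.
have mvg k m : measurable_fun [set: T] (fun w => v k (grid m (K m w))).
  exact: (@measurable_select _ _ _ (K m) (mK m) (fun j _ => v k (grid m j))).
have vlim0 k : 0 <= fou_moment_lim q theta k.
  exact: le_trans (v_ge0 k 0) (fou_moment_le_lim q0 theta0 k 0).
have h1 := @moment_cvg _ T R P (fun m w => `|U (grid m (K m w)) w| ^+ (2 * n))
  (fun w => `|U (tau w) w| ^+ (2 * n)) (fou_moment_lim q theta (2 * n))
  (fun m => mabs _ (mU_grid m)) (mabs _ measurable_fOU_random_time)
  (fun _ _ => exprn_ge0 _ (normr_ge0 _)) (fun _ => exprn_ge0 _ (normr_ge0 _)).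
have {}h1 : ((\int[P]_w (`|U (grid m (K m w)) w| ^+ (2 * n))%:E) @[m --> \oo] -->
    \int[P]_w (`|U (tau w) w| ^+ (2 * n))%:E)%E.
  apply: h1; first by apply: filterS U_grid_cvg => w; exact: cvg_absX.
  (* Squaring doubles the order, and [grid_moment] at the doubled order bounds the result by the
     limit moment, uniformly in [m]. *)
  move=> m; under eq_integral do rewrite -exprM mulnC.
  rewrite grid_moment.
  apply: (@le_trans _ _ (\int[P]_(w in [set: T]) (cst (fou_moment_lim q theta (2 * n))%:E) w)%E).
    apply: ge0_le_integral => //.
    - by move=> w _; rewrite lee_fin.
    - by apply/measurable_EFinP; exact: mvg.
    - by move=> w _; rewrite lee_fin; exact: fou_moment_le_lim.
  by rewrite integral_cst//= [P _]probability_setT mule1.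
apply: (cvg_unique _ h1) => //.
rewrite (_ : (fun m => _) = (fun m => \int[P]_w (v n (grid m (K m w)))%:E)%E); last first.
  by apply/funext => m; exact: grid_moment.
apply: (@bounded_cvg _ T R P (fun m w => v n (grid m (K m w))) (fun w => v n (tau w))
  (fou_moment_lim q theta n)) => //.
- by move=> m w; rewrite ger0_norm//; exact: fou_moment_le_lim.
- apply: nearW => w; apply: fou_moment_seq_continuous => //; exact: grid_cvg.
Qed.

End random_time.

(** * The two expressions for the limit *)

Section limit_constants.
Context (R : realType) (H theta : R).
Hypothesis H1 : 2^-1 < H < 1.
Let q := 2 * H - 1.
Let q0 : 0 < q. Proof. by rewrite /q; move/andP: H1 => [? ?]; lra. Qed.

(** With [2H = q + 1], the functional equation gives [Gamma (2H) = q * Gamma q]. *)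
Lemma V_inftyE n : V_infty H theta n = fou_moment_lim q theta n.
Proof.
congr (_ * _ ^+ _); rewrite /V2_infty /V2lim.
have -> : 2 * H = q + 1 by rewrite /q; ring.
rewrite GammaD1//; have -> : H = (q + 1) / 2 by rewrite /q; field.
by field.
Qed.

Let GammaH_gt0 n : 0 < Gamma (2 * n%:R * H + 1).
Proof.
apply: Gamma_gt0; move/andP: H1 => [h _]; rewrite ltr_wpDl// !mulr_ge0//.
by rewrite (le_trans _ (ltW h)).
Qed.

(** Read off from [multi_integralE]: a positive factor times an infinite integral could not be a
    real number. *)
Lemma multi_kernel_integrable n :
  (lebesgue_tuple R (n + n)%N).-integrable (@orthant R (n + n)%N) (fun z => (multi_kernel H z)%:E).
Proof.
apply/integrableP; split; first exact: measurable_multi_kernel.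
rewrite (_ : (\int[_]_(_ in _) _)%E = multi_integral H n).
  have := multi_integralE H1 n; case: (multi_integral H n) => [r _| |]; first exact: ltry.
    by rewrite mulry gtr0_sg// mul1e.
  by rewrite ltNye.
apply: eq_integral => z; rewrite inE => z0; rewrite gee0_abs// lee_fin divr_ge0 ?powR_ge0//.
by apply: prodr_ge0 => i _; exact: powR_ge0.
Qed.

Lemma limit_formulaE n : limit_formula H theta n = (V_infty H theta n)%:E.
Proof.
rewrite /limit_formula.
have [_ h] := integrableP _ _ _ (multi_kernel_integrable n).
have -> : multi_integral H n = (Gamma q ^+ n / Gamma (2 * n%:R * H + 1))%:E.
  have := multi_integralE H1 n; case: (multi_integral H n) => [r|/eqP|/eqP]; last 2 first.
  - by rewrite mulry gtr0_sg// mul1e.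
  - by rewrite mulrNy gtr0_sg// mul1e.
  by rewrite -EFinM => -[<-]; rewrite mulrAC divff ?mul1r// gt_eqF.
rewrite -EFinM V_inftyE /fou_moment_lim /V2lim; congr EFin.
have -> : theta `^ (2 * n%:R * H) = (theta `^ (q + 1)) ^+ n.
  by rewrite -powR_mulrn ?powR_ge0// -powRrM; congr (_ `^ _); rewrite /q; ring.
have -> : H ^+ n * (2 * H - 1) ^+ n = (q * (q + 1) / 2) ^+ n.
  by rewrite -exprMn; congr (_ ^+ _); rewrite /q; field.
rewrite !exprMn; move: (gt_eqF (GammaH_gt0 n)) => /negbT; move: (Gamma (_ + 1)) => G G0.
by field.
Qed.

End limit_constants.

(** * Moments of the time-changed process *)

Section random_time_moments.
Context d (T : measurableType d) (R : realType) (P : probability T R).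
Context (nu : {measure set (measurableTypeR R) -> \bar R}).
Variables (H theta : R) (B sigma : R -> T -> R).
Hypothesis H1 : 2^-1 < H < 1.
Hypothesis theta0 : 0 < theta.
Hypothesis Pc : measure_is_complete P.
Hypothesis BH : fBm P H B.
Hypothesis LN : levy_measure nu.
Hypothesis SUB : subordinator P nu sigma.
Let U := fOU theta B.
Let E := inverse_subordinator sigma.
Hypothesis IND : independent_processes P E U.
Let V := abs_moment P U.
Let VPsi := abs_moment P (time_change U E).
Let q := 2 * H - 1.
Let q0 : 0 < q. Proof. by rewrite /q; move/andP: H1 => [? ?]; lra. Qed.
Variable n : nat.
Let v := fou_moment q theta n.
Let L := fou_moment_lim q theta n.

Let mE t : measurable_fun [set: T] (E t).
Proof. exact: (measurable_inverse_subordinator Pc LN SUB). Qed.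

Let E0 t w : 0 <= E t w. Proof. exact: inverse_subordinator_ge0. Qed.

Let v0 y : 0 <= v y. Proof. exact: fou_moment_ge0. Qed.

Let vL y : v y <= L. Proof. exact: fou_moment_le_lim. Qed.

Let L0 : 0 <= L. Proof. exact: le_trans (v0 0) (vL 0). Qed.

Let VE y : 0 <= y -> V (2 * n)%N y = (v y)%:E.
Proof. by move=> y0; rewrite /V /abs_moment unlock; exact: (fOU_moment H1 theta0 Pc BH). Qed.

(** Finite and bounded by [L] at every real [t], which keeps the limit arguments free of sign
    conditions; for [t >= 0] it is the moment of the time-changed process. *)
Let phi t := (\int[P]_w (v (E t w))%:E)%E.

Let VPsiE t : 0 <= t -> VPsi (2 * n)%N t = phi t.
Proof.
move=> t0; rewrite /VPsi /abs_moment unlock.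
apply: (fOU_moment_random_time H1 theta0 Pc BH) => // s C D s0 mC mD.
by apply: IND; apply: sub_sigma_algebra; [exists t, C|exists s, D].
Qed.

Let mvE t : measurable_fun [set: T] (fun w => v (E t w)).
Proof.
rewrite (_ : (fun _ => _) = (fun y => v (Num.max 0 y)) \o E t).
  by apply: measurableT_comp => //; exact: measurable_fou_moment.
by apply/funext => w /=; rewrite max_r.
Qed.

Let vE_integrable t : P.-integrable setT (fun w => (v (E t w))%:E).
Proof.
apply: (@le_integrable _ _ _ P setT measurableT _ (cst L%:E)).
- exact/measurable_EFinP.
- by move=> w _; rewrite !abse_EFin lee_fin !ger0_norm.
- exact: finite_measure_integrable_cst.
Qed.

Let int_cst : (\int[P]_w L%:E)%E = L%:E.
Proof.
transitivity (\int[P]_(w in [set: T]) (cst L%:E) w)%E; first by [].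
by rewrite integral_cst//= [P _]probability_setT mule1.
Qed.

Let phi_le t : (phi t <= L%:E)%E.
Proof.
rewrite -[leRHS]int_cst; apply: ge0_le_integral => //.
- by move=> w _; rewrite lee_fin.
- exact/measurable_EFinP.
- by move=> w _; rewrite lee_fin.
Qed.

Let phi_fin t : phi t \is a fin_num.
Proof.
rewrite ge0_fin_numE; first exact: le_lt_trans (phi_le t) (ltry _).
by apply: integral_ge0 => w _; rewrite lee_fin.
Qed.

Lemma random_time_moment_le t : 0 <= t -> (VPsi (2 * n)%N t <= (V_infty H theta n)%:E)%E.
Proof. by move=> t0; rewrite VPsiE// V_inftyE. Qed.

Lemma random_time_moment_nondecreasing s t : 0 <= s -> s <= t ->
  (VPsi (2 * n)%N s <= VPsi (2 * n)%N t)%E.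
Proof.
move=> s0 st; have t0 : 0 <= t by exact: le_trans s0 st.
rewrite (VPsiE s0) (VPsiE t0).
apply: ae_ge0_le_integral => //.
- by move=> w _; rewrite lee_fin.
- exact/measurable_EFinP.
- by move=> w _; rewrite lee_fin.
- exact/measurable_EFinP.
- apply: filterS (inverse_subordinator_le LN SUB) => w hw _.
  by rewrite lee_fin; apply: fou_moment_le => //; exact: hw.
Qed.

(** If the moments were equal, the almost surely nonnegative difference of [v (E t)] and [v (E s)]
    would vanish almost surely. As [v] is strictly increasing, this gives [E t <= E s] almost
    surely, which [inverse_subordinator_lt] excludes. *)
Lemma random_time_moment_increasing s t : (0 < n)%N -> 0 <= s -> s < t ->
  (VPsi (2 * n)%N s < VPsi (2 * n)%N t)%E.
Proof.
move=> n0 s0 st; have t0 : 0 <= t by rewrite (le_trans s0)// ltW.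
rewrite lt_neqAle (random_time_moment_nondecreasing s0 (ltW st)) andbT; apply/eqP => eqV.
apply: (inverse_subordinator_lt LN SUB s0 st).
move: eqV; rewrite (VPsiE s0) (VPsiE t0) => eqphi.
pose D w := ((v (E t w))%:E - (v (E s w))%:E)%E.
have mD : measurable_fun [set: T] D by apply: emeasurable_funB; exact/measurable_EFinP.
have D0 : {ae P, forall w, `|D w|%E = D w}.
  apply: filterS (inverse_subordinator_le LN SUB) => w hw.
  have h := fou_moment_le q0 theta0 n (E0 s w) (hw _ _ (ltW st)).
  by apply: gee0_abs; rewrite /D -EFinB lee_fin subr_ge0.
have DD : (\int[P]_w `|D w| = \int[P]_w D w)%E.
  apply: ae_eq_integral; [exact: measurableT|exact: measurableT_comp|exact: mD|].
  by apply: filterS D0 => w hw _; exact: hw.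
have : (\int[P]_w `|D w|)%E = 0.
  rewrite DD (integralB measurableT (vE_integrable t) (vE_integrable s)).
  exact: (etrans (congr1 (fun x => phi t - x)%E eqphi) (subee (phi_fin t))).
move=> /(ae_eq_integral_abs P measurableT mD); apply: filterS => w /(_ I).
rewrite /D -EFinB => -[] /eqP; rewrite subr_eq0 => /eqP vv; rewrite leNgt; apply/negP => Est.
have : v (E s w) < v (E t w) by exact: fou_moment_lt.
by rewrite vv ltxx.
Qed.

(** Bounded convergence along an arbitrary sequence of times tending to infinity: almost surely
    [E (u k)] eventually passes every integer, and [v] is monotone with limit [L]. *)
Lemma random_time_moment_cvg : VPsi (2 * n)%N t @[t --> +oo] --> (V_infty H theta n)%:E.
Proof.
rewrite V_inftyE//; apply/cvge_pinftyP => u uoo.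
have u0 : \forall k \near \oo, 0 <= u k by move/cvgryPge : uoo => /(_ 0).
have -> : L%:E = (\int[P]_w (cst L w)%:E)%E.
  by rewrite -[LHS]int_cst.
apply: cvg_trans (@bounded_cvg _ T R P (fun k w => v (E (u k) w)) (cst L) L _ _ _ _) => //.
- by apply: near_eq_cvg; apply: filterS u0 => k uk; rewrite VPsiE.
- by move=> k w; rewrite ger0_norm.
- apply: filterS (inverse_subordinator_cvg LN SUB) => w hw.
  apply/cvgrPdist_lt => e e0.
  have /cvgrPdist_lt/(_ e e0)[k _ /(_ k (leqnn k)) hk] := fou_moment_cvg q0 theta0 (n := n).
  have [t1 ht] := hw k.
  have : \forall j \near \oo, t1 <= u j by move/cvgryPge : uoo.
  apply: filterS => j /ht kE; apply: le_lt_trans hk.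
  by rewrite !ger0_norm ?subr_ge0// lerB//; apply: fou_moment_le.
Qed.

Let D : set R := `]0, +oo[.
Let mD : measurable D. Proof. exact: measurable_itv. Qed.

Let density_integral t f (g : R -> R) : is_density P (E t) f ->
  measurable_fun [set: R] g -> (forall y, 0 <= g y) ->
  (\int[P]_w (g (E t w))%:E = \int[lebesgue_measure]_(y in D) (f y * g y)%:E)%E.
Proof.
move=> [mf f0 fP] mg g0.
rewrite (@ge0_integral_law _ T R P (E t) D f (fun y => (g y)%:E))//.
- by move=> y; rewrite /D/= in_itv/= andbT; exact: f0.
- by move=> A mA; rewrite fP// setIC.
- exact/measurable_EFinP.
Qed.

Let vp y := v (Num.max 0 y).
Let mvp : measurable_fun [set: R] vp. Proof. exact: measurable_fou_moment. Qed.
Let vpE t w : vp (E t w) = v (E t w). Proof. by rewrite /vp max_r. Qed.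

Lemma random_time_moment_density t f : 0 <= t -> is_density P (E t) f ->
  (VPsi (2 * n)%N t = \int[lebesgue_measure]_(y in `]0%R, +oo[) (V (2 * n)%N y * (f y)%:E))%E.
Proof.
move=> t0 df; rewrite VPsiE// /phi; under eq_integral do rewrite -vpE.
rewrite (density_integral df)//; last by move=> y; exact: v0.
apply: eq_integral => y; rewrite inE /D/= in_itv/= andbT => y0.
by rewrite VE ?ltW// -EFinM mulrC /vp max_r ?ltW.
Qed.

(** The minimum with the limit density supplies the dominating function that pointwise convergence
    of the densities lacks. It is applied to [g = vp] and to [g = L - vp]. *)
Let min_cvg (f : nat -> R -> R) (f1 : R -> R) t (g : R -> R) :
  (forall k, measurable_fun D (f k)) -> (forall k y, D y -> 0 <= f k y) ->
  is_density P (E t) f1 -> (forall y, D y -> f k y @[k --> \oo] --> f1 y) ->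
  measurable_fun [set: R] g -> (forall y, 0 <= g y <= L) ->
  (\int[lebesgue_measure]_(y in D) (Num.min (f k y) (f1 y) * g y)%:E @[k --> \oo] -->
   \int[P]_w (g (E t w))%:E)%E.
Proof.
move=> mf f0 df ff mg gL.
have [mf1 f10 _] := df.
have g0 y : 0 <= g y by have /andP[] := gL y.
have f10' y : D y -> 0 <= f1 y by rewrite /D/= in_itv/= andbT; exact: f10.
have mgD : measurable_fun D g by exact: measurable_funTS.
(* The integral of [f1 * L] is the expectation of the constant [L]. *)
have I1 : lebesgue_measure.-integrable D (fun y => (f1 y * L)%:E).
  apply/integrableP; split.
    by apply/measurable_EFinP; apply: measurable_realfun.measurable_funM.
  rewrite (_ : (\int[_]_(_ in _) _)%E = (\int[P]_w (cst L (E t w))%:E)%E).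
    by rewrite [ltLHS]int_cst ltry.
  rewrite (density_integral df)//; apply: eq_integral => y; rewrite inE => Dy.
  by rewrite gee0_abs// lee_fin mulr_ge0// f10'.
rewrite (density_integral df)//.
have mk k : measurable_fun D (fun y => (Num.min (f k y) (f1 y) * g y)%:E).
  apply/measurable_EFinP; apply: measurable_realfun.measurable_funM => //.
  exact: measurable_realfun.measurable_minr.
have m1 : measurable_fun D (fun y => (f1 y * g y)%:E).
  by apply/measurable_EFinP; apply: measurable_realfun.measurable_funM.
have c1 : {ae (@lebesgue_measure R), forall y, D y ->
    (Num.min (f k y) (f1 y) * g y)%:E @[k --> \oo] --> (f1 y * g y)%:E}.
  apply: aeW => y Dy; apply: cvg_EFin; first exact: nearW.
  apply: cvgM; last exact: cvg_cst.
  rewrite -[X in _ --> X]minxx [X in _ --> X]minr_absE.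
  under eq_fun do rewrite minr_absE.
  apply: cvgM; last exact: cvg_cst.
  have fy := ff y Dy.
  apply: cvgB; first by apply: cvgD => //; exact: cvg_cst.
  by apply: cvg_norm; apply: cvgB => //; exact: cvg_cst.
have b1 : {ae (@lebesgue_measure R), forall y k, D y ->
    (`|(Num.min (f k y) (f1 y) * g y)%:E| <= (f1 y * L)%:E)%E}.
  apply: aeW => y k Dy; have fk := f0 k y Dy; have fy := f10' y Dy.
  rewrite lee_fin ger0_norm; last by apply: mulr_ge0 => //; rewrite le_min fk fy.
  have /andP[_ gl] := gL y.
  by apply: ler_pM => //; rewrite ?le_min ?ge_min ?lexx ?orbT ?fk ?fy.
by have [_ _] := @dominated_convergence _ _ _ (@lebesgue_measure R) D mD _ _ _ mk m1 c1 I1 b1.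
Qed.

Let min_le (f f1 : R -> R) (s : R) (g : R -> R) : is_density P (E s) f -> measurable_fun D f1 ->
  (forall y, D y -> 0 <= f1 y) -> measurable_fun [set: R] g -> (forall y, 0 <= g y) ->
  (\int[lebesgue_measure]_(y in D) (Num.min (f y) (f1 y) * g y)%:E <= \int[P]_w (g (E s w))%:E)%E.
Proof.
move=> df mf1 f10 mg g0; have [mf f0 _] := df.
have mgD : measurable_fun D g by exact: measurable_funTS.
have f0' y : D y -> 0 <= f y by rewrite /D/= in_itv/= andbT; exact: f0.
rewrite (density_integral df)//; apply: ge0_le_integral => //.
- by move=> y Dy; rewrite lee_fin mulr_ge0// le_min f0'//= f10.
- apply/measurable_EFinP; apply: measurable_realfun.measurable_funM => //.
  exact: measurable_realfun.measurable_minr.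
- by apply/measurable_EFinP; apply: measurable_realfun.measurable_funM.
- by move=> y Dy; rewrite lee_fin ler_wpM2r// ge_min lexx.
Qed.

Let compl_integral t : (\int[P]_w (L - vp (E t w))%:E = L%:E - phi t)%E.
Proof.
under eq_integral do rewrite vpE EFinB.
rewrite integralB//; last exact: finite_measure_integrable_cst.
by rewrite int_cst.
Qed.

(* Squeeze: with [m_k = min (f (u k)) (f t)], which is dominated by [f t], the integral of
   [m_k * v] bounds [phi (u k)] from below and that of [m_k * (L - v)] bounds [L - phi (u k)]. *)
Let phi_seq_cvg (f : R -> R -> R) (u : nat -> R) (t : R) :
  (forall s, 0 < s -> is_density P (E s) (f s)) ->
  (forall y, 0 < y -> forall s, 0 < s -> {for s, continuous (fun r => f r y)}) ->
  0 < t -> (forall k, 0 < u k) -> u k @[k --> \oo] --> t ->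
  (phi (u k) @[k --> \oo] --> phi t)%E.
Proof.
move=> df cf t0 u0 ut.
have fp s y : 0 < s -> D y -> 0 <= f s y.
  by move=> s0; have [_ h _] := df s s0; rewrite /D/= in_itv/= andbT; exact: h.
have mf s : 0 < s -> measurable_fun D (f s) by move=> s0; have [h] := df s s0.
have ff y : D y -> f (u k) y @[k --> \oo] --> f t y.
  rewrite /D/= in_itv/= andbT => y0.
  exact: (cvg_comp _ _ ut (cf y y0 t t0)).
have vpL y : 0 <= vp y <= L by rewrite v0 vL.
have cL y : 0 <= L - vp y <= L by rewrite subr_ge0 vL/= gerBl v0.
have mc : measurable_fun [set: R] (fun y => L - vp y).
  by apply: measurable_realfun.measurable_funB.
have g0 (g : R -> R) : (forall y, 0 <= g y <= L) -> forall y, 0 <= g y.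
  by move=> h y; have /andP[] := h y.
have c1 := min_cvg (fun k => mf _ (u0 k)) (fun k y => fp _ y (u0 k)) (df t t0) ff mvp vpL.
have c2 := min_cvg (fun k => mf _ (u0 k)) (fun k y => fp _ y (u0 k)) (df t t0) ff mc cL.
rewrite compl_integral in c2.
have e1 s : (\int[P]_w (vp (E s w))%:E)%E = phi s by apply: eq_integral => w _; rewrite vpE.
rewrite e1 in c1.
apply: squeeze_cvge c1 _; last first.
  have c3 := cvgeB _ (cvg_cst L%:E) c2.
  rewrite -[X in _ --> X](_ : (L%:E - (L%:E - phi t))%E = _); last first.
    by rewrite -(fineK (phi_fin t)) -!EFinB subKr.
  by apply: c3; rewrite fin_num_adde_defr.
apply: nearW => k.
have := min_le (df _ (u0 k)) (mf _ t0) (fun y => fp _ y t0) mvp (g0 _ vpL).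
rewrite e1 => -> /=.
have := min_le (df _ (u0 k)) (mf _ t0) (fun y => fp _ y t0) mc (g0 _ cL).
rewrite compl_integral; move: (\int[_]_(_ in _) _)%E => x.
rewrite -(fineK (phi_fin (u k))); case: x => [r| |]//.
  by rewrite -!EFinB !lee_fin; lra.
by rewrite leey.
Qed.

Lemma random_time_moment_continuous (f : R -> R -> R) (t : R) :
  (forall s, 0 < s -> is_density P (E s) (f s)) ->
  (forall y, 0 < y -> forall s, 0 < s -> {for s, continuous (fun r => f r y)}) ->
  0 < t -> {for t, continuous (VPsi (2 * n)%N)}.
Proof.
move=> df cf t0.
suff h : (phi s @[s --> t] --> phi t)%E.
  rewrite /prop_for /continuous_at VPsiE ?ltW//; apply: cvg_trans h.
  apply: near_eq_cvg; have : \forall s \near t, 0 < s by exact: lt_nbhsr.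
  by apply: filterS => s s0; rewrite VPsiE ?ltW.
rewrite -(fineK (phi_fin t)); apply/fine_cvgP; split.
  by apply: nearW => s; exact: phi_fin.
suff hu (u : nat -> R) : u k @[k --> \oo] --> t -> fine (phi (u k)) @[k --> \oo] --> fine (phi t).
  apply/(@left_right_continuousP _ _ (fun s => fine (phi s)) t); split.
    by apply/cvg_at_leftP => u [_]; exact: hu.
  by apply/cvg_at_rightP => u [_]; exact: hu.
(* The sequence is raised to stay positive, where the densities are given; only finitely many terms
   change, since [t / 2 < t]. *)
move=> ut; pose w k := Num.max (t / 2) (u k).
have w0 k : 0 < w k by rewrite lt_max divr_gt0.
have wu : \forall k \near \oo, u k = w k.
  have : \forall k \near \oo, t / 2 < u k.
    by apply: (cvgr_gt _ ut); rewrite ltr_pdivrMr// ltr_pMr// ltr1n.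
  by apply: filterS => k tk; rewrite /w max_r// ltW.
have wt : w k @[k --> \oo] --> t.
  by apply: cvg_trans ut; apply: near_eq_cvg; apply: filterS wu => k ->.
have := phi_seq_cvg df cf t0 w0 wt.
rewrite -[X in _ --> X](fineK (phi_fin t)) => /fine_cvgP[_]; apply: cvg_trans.
by apply: near_eq_cvg; apply: filterS wu => k /= ->.
Qed.

End random_time_moments.

Theorem lemma3p1 (R : realType) (d : measure_display) (T : measurableType d)
    (P : probability T R) (H theta : R) (B sigma : R -> T -> R)
    (nu : {measure set (measurableTypeR R) -> \bar R}) :
  2^-1 < H < 1 -> 0 < theta ->
  measure_is_complete P ->
  fBm P H B ->
  levy_measure nu -> subordinator P nu sigma ->
  let U := fOU theta B in
  let E := inverse_subordinator sigma in
  let V := abs_moment P U in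
  let VPsi := abs_moment P (time_change U E) in
  independent_processes P E U ->
  forall n : nat,
  [/\ (* 1 *)
      (forall (t : R) (f : R -> R), 0 < t -> is_density P (E t) f ->
        VPsi (2 * n)%N t =
          (\int[lebesgue_measure]_(y in `]0%R, +oo[) (V (2 * n)%N y * (f y)%:E))%E
        /\ (VPsi (2 * n)%N t <= (V_infty H theta n)%:E)%E) /\
      (forall f : R -> R -> R,
        (forall t : R, 0 < t -> is_density P (E t) (f t)) ->
        (forall y : R, 0 < y -> forall t : R, 0 < t ->
          {for t, continuous (fun s => f s y)}) ->
        forall t : R, 0 < t -> {for t, continuous (VPsi (2 * n)%N)}),
      (* 2 *)
      (forall s t : R, 0 <= s -> s <= t ->
        (VPsi (2 * n)%N s <= VPsi (2 * n)%N t)%E) /\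
      ((0 < n)%N -> forall s t : R, 0 <= s -> s < t ->
        (VPsi (2 * n)%N s < VPsi (2 * n)%N t)%E) &
      (* 3 *)
      [/\ (lebesgue_tuple R (n + n)%N).-integrable (@orthant R (n + n)%N)
            (fun z => (multi_kernel H z)%:E),
          VPsi (2 * n)%N t @[t --> +oo] --> limit_formula H theta n &
          limit_formula H theta n = (V_infty H theta n)%:E]].
Proof.
move=> H1 theta0 Pc BH LN SUB U E V VPsi IND n; split; [split|split|split].
- move=> t f t0 df; split.
    exact: (random_time_moment_density H1 theta0 Pc BH LN SUB IND n (ltW t0) df).
  exact: (random_time_moment_le H1 theta0 Pc BH LN SUB IND n (ltW t0)).
- move=> f df cf t t0.
  exact: (random_time_moment_continuous H1 theta0 Pc BH LN SUB IND df cf t0).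
- by move=> s t s0 st; exact: (random_time_moment_nondecreasing H1 theta0 Pc BH LN SUB IND n s0 st).
- by move=> n0 s t s0 st; exact: (random_time_moment_increasing H1 theta0 Pc BH LN SUB IND n0 s0 st).
- exact: multi_kernel_integrable.
- rewrite limit_formulaE//; exact: (random_time_moment_cvg H1 theta0 Pc BH LN SUB IND (n := n)).
- exact: limit_formulaE.
Qed.
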